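(* Fix $\nu\ge 1/2$ and $b_0,\theta_0>0$. (i) For any fixed $\delta>0$, $b>0$, $\theta>0$, as $n\to\infty$, $$\frac{\mathbf y^T A_{b,\theta}(I_n-A_{b,\theta})\mathbf y}{\mathrm{tr}\,A_{b,\theta}}-1\;\longrightarrow\;\psi(\delta,b,\theta,b_0,\theta_0)\quad\text{in probability},$$ where $$\psi(\delta,b,\theta,b_0,\theta_0):=\frac{1}{\int_{-\pi}^{\pi}a^\delta_{b,\theta}(\lambda)\,d\lambda}\int_{-\pi}^{\pi}\big[a^\delta_{b,\theta}(\lambda)\big]^2\left(\frac{b_0\,g^\delta_{\nu,\theta_0}(\lambda)}{b\,g^\delta_{\nu,\theta}(\lambda)}-1\right)d\lambda .$$ (ii) For fixed $b,\theta,b_0,\theta_0>0$, $$\psi(\delta,b,\theta,b_0,\theta_0)\longrightarrow \frac{2\nu}{2\nu+1}\left(\frac{b_0\theta_0^{2\nu}}{b\,\theta^{2\nu}}-1\right)\quad\text{as }\delta\to 0 .$$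
   Context: Fix $\nu\ge1/2$. For $\alpha>0$, $\omega\in\mathbb R$ let $g^*_{\nu,\alpha}(\omega)=C_\nu\alpha^{2\nu}(\alpha^2+\omega^2)^{-(\nu+1/2)}$ with $C_\nu=\Gamma(\nu+\frac12)/(\sqrt\pi\,\Gamma(\nu))$ (so $\int_{\mathbb R}g^*_{\nu,\alpha}=1$). For $\delta,\theta>0$ and $\lambda\in[-\pi,\pi]$ let $g^\delta_{\nu,\theta}(\lambda)=\sum_{k\in\mathbb Z}g^*_{\nu,\delta\theta}(\lambda+2k\pi)$ (the spectral density of the sampled series), and for $b>0$ let $a^\delta_{b,\theta}(\lambda)=\dfrac{b\,g^\delta_{\nu,\theta}(\lambda)}{b\,g^\delta_{\nu,\theta}(\lambda)+(2\pi)^{-1}}$. Model: $Z$ is a zero-mean stationary Gaussian process on $\mathbb R$ with $\mathrm{Cov}(Z(s),Z(t))=b_0K_{\nu,\theta_0}(t-s)$, where $K_{\nu,\theta}(t)=\int_{\mathbb R}g^*_{\nu,\theta}(\omega)\cos(\omega t)\,d\omega$, $b_0,\theta_0>0$. For $\delta>0$ and $n\ge1$, $\mathbf z=(Z(\delta),Z(2\delta),\dots,Z(n\delta))^T$ and $\mathbf y=\mathbf z+\boldsymbol\varepsilon$ with $\boldsymbol\varepsilon\sim N(0,I_n)$ independent of $Z$. $R_\theta$ is the $n\times n$ Toeplitz matrix with entries $[R_\theta]_{j,k}=K_{\nu,\theta}(\delta|j-k|)$, and $A_{b,\theta}=bR_\theta(I_n+bR_\theta)^{-1}$. *)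

(* Defs.v *)
From HB Require Import structures.
From mathcomp Require Import all_boot all_order all_algebra.
From mathcomp Require Import all_classical all_reals all_analysis.
Set Implicit Arguments. Unset Strict Implicit. Unset Printing Implicit Defensive.
Import Order.TTheory GRing.Theory Num.Theory.
Import numFieldNormedType.Exports.
Local Open Scope classical_set_scope.
Local Open Scope ring_scope.

Section Defs.
Variable R : realType.
Notation mu := (@lebesgue_measure R).

Definition Gamma (x : R) : R :=
  Rintegral mu `]0, +oo[ (fun t => powR t (x - 1) * expR (- t)).

Definition Cnu (nu : R) : R := Gamma (nu + 2^-1) / (Num.sqrt pi * Gamma nu).

Definition gstar (nu alpha omega : R) : R :=
  Cnu nu * powR alpha (2 * nu) * powR (alpha ^+ 2 + omega ^+ 2) (- (nu + 2^-1)).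

Definition Kmat (nu theta t : R) : R :=
  Rintegral mu setT (fun w => gstar nu theta w * cos (w * t)).

(* g^delta_{nu,theta}(lambda) = sum_{k in Z} g*_{nu,delta theta}(lambda + 2 k pi),
   the sum over Z written as k = 0 plus the pairs k, -k for k >= 1 *)
Definition gdelta (nu delta theta lambda : R) : R :=
  limn (fun N : nat => \sum_(0 <= k < N)
    (if k == 0%N then gstar nu (delta * theta) lambda
     else gstar nu (delta * theta) (lambda + 2 * k%:R * pi)
          + gstar nu (delta * theta) (lambda - 2 * k%:R * pi))).

Definition adelta (nu delta b theta lambda : R) : R :=
  b * gdelta nu delta theta lambda
  / (b * gdelta nu delta theta lambda + (2 * pi)^-1).

Definition psi (nu delta b theta b0 theta0 : R) : R :=
  (Rintegral mu `[- pi, pi]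
     (fun l => adelta nu delta b theta l ^+ 2
               * (b0 * gdelta nu delta theta0 l / (b * gdelta nu delta theta l) - 1)))
  / Rintegral mu `[- pi, pi] (adelta nu delta b theta).

Definition Rmat (nu delta theta : R) (n : nat) : 'M[R]_n :=
  \matrix_(i < n, j < n) Kmat nu theta (delta * `|(i%:R - j%:R : R)|).

Definition Amat (nu delta b theta : R) (n : nat) : 'M[R]_n :=
  (b *: Rmat nu delta theta n) *m invmx (1%:M + b *: Rmat nu delta theta n).

Definition stat (nu delta b theta : R) (n : nat) (y : 'cV[R]_n) : R :=
  ((y^T *m Amat nu delta b theta n *m (1%:M - Amat nu delta b theta n) *m y) 0 0)
  / \tr (Amat nu delta b theta n) - 1.

Context {d : measure_display} {T : measurableType d} (P : probability T R).

Definition centered_normal_law (X : T -> R) (v : R) : Prop :=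
  if v == 0 then P [set w | X w = 0] = 1%E
  else forall A : set R, measurable A ->
         P (X @^-1` A) = normal_prob 0 (Num.sqrt v) A.

Definition gaussian_family (I : Type) (X : I -> T -> R) (C : I -> I -> R) : Prop :=
  (forall i, measurable_fun setT (X i)) /\
  forall (m : nat) (ts : 'I_m -> I) (c : 'I_m -> R),
    centered_normal_law (fun w => \sum_(i < m) c i * X (ts i) w)
      (\sum_(i < m) \sum_(j < m) c i * c j * C (ts i) (ts j)).

Definition indep_families (I J : Type) (X : I -> T -> R) (Y : J -> T -> R) : Prop :=
  forall (m k : nat) (ts : 'I_m -> I) (A : 'I_m -> set R)
         (us : 'I_k -> J) (B : 'I_k -> set R),
    (forall i, measurable (A i)) -> (forall j, measurable (B j)) ->
    P ([set w | forall i, A i (X (ts i) w)] `&` [set w | forall j, B j (Y (us j) w)])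
    = (P [set w | forall i, A i (X (ts i) w)] * P [set w | forall j, B j (Y (us j) w)])%E.

Definition conv_in_prob (X : nat -> T -> R) (c : R) : Prop :=
  forall e : R, 0 < e ->
    (fun n => P [set w | e < `|X n w - c|]) @ \oo --> 0%E.

End Defs.

(* Main.v *)
(* The spectral density f = 2 pi g^delta is the symbol of the Toeplitz
   matrix R_theta. Say that matrices X_n have symbol xi when X_n e - xi(x) e
   is small in normalized mean square over the circle, e = (cos jx + sin
   jx)_j. A Lipschitz even f is a symbol of its Toeplitz matrices because
   the Fejer kernel F_n satisfies F_n(z) sin^2(z/2) = O(1/n); symbols pass
   to linear combinations, to products and to the resolvent (I + b
   R_theta)^-1, and tr X_n / n tends to the mean of xi. Hence tr A / n and
   E[y^T A(I-A) y] / n converge, and their quotient minus 1 tends to psi.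
   Isserlis' formula, obtained by polarizing the fourth moments of the
   Gaussian linear forms, bounds the variance of the quadratic form by
   2 ||A(I-A) Cov y||_F^2 = O(n), so Chebyshev's inequality gives (i).

   For (ii) put p = 2 nu + 1 and lambda = delta^(2 nu / p) u. Then a^delta
   tends to q(u) = c / (c + |u|^p), dominated by a multiple of 1 / (1 +
   u^2), and b_0 g_0 / (b g) tends to rho = b_0 theta_0^(2 nu) / (b theta^(2
   nu)). So psi tends to (rho - 1) (int q^2) / (int q), and integrating
   (u q)' = q - p q + p q^2 gives int q^2 / int q = (p - 1) / p. *)
Require Import Defs.
From HB Require Import structures.
From mathcomp Require Import all_boot all_order all_algebra.
From mathcomp Require Import all_classical all_reals all_analysis.
From mathcomp Require Import measurable_realfun ring lra.
Import Order.TTheory GRing.Theory Num.Theory.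
Import numFieldNormedType.Exports.
Local Open Scope classical_set_scope.
Local Open Scope ring_scope.
Set Implicit Arguments. Unset Strict Implicit. Unset Printing Implicit Defensive.

(** Szego theory usually goes through eigenvalue distributions. Here only traces and Frobenius norms
    occur, and for these an averaged comparison with multiplication operators suffices. The vectors
    e satisfy mean (e e^T) = I, so the mean of |X e|^2 is the squared Frobenius norm of X and the
    mean of e . X e is its trace. Each algebraic step costs one triangle inequality, provided the
    left factor of a product is a contraction; hence everything is expressed through M = (I + b
    R)^-1, with A = I - M and A(I - A) = M - M^2.

    The Gaussian hypotheses speak of laws of linear forms, separately for Z and for the noise. No
    joint density is built: Chebyshev's inequality asks only for moments of order two and four of
    linear forms in y.

    In (ii) the scale is forced: near 0, g^delta behaves like a constant times delta^(2 nu)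
    |lambda|^(-p), which is of order one at lambda = delta^(2 nu / p) u. The shifted copies in the
    sum defining g^delta are O(delta^(2 nu)), hence negligible there. *)

Section Affine.
Variable R : realType.
Notation mu := (@lebesgue_measure R).
Local Notation mT := (measurableTypeR R).

Lemma measurable_affine (c d : R) :
  measurable_fun setT ((fun x => c * x + d) : mT -> mT).
Proof. by apply: measurable_funD => //; exact: measurable_funM. Qed.

(** Lebesgue measure is determined by its values on half-open intervals; the factor |c| is moved
    onto the image measure so that this uniqueness applies. *)
Lemma lebesgue_measure_affine (c d : R) (A : set R) : c != 0 -> measurable A ->
  pushforward mu ((fun x => c * x + d) : mT -> mT) A = (`|c|^-1%:E * mu A)%E.
Proof.
move=> c0 mA.
pose m := mscale (NngNum (normr_ge0 c))
   (pushforward mu ((fun x => c * x + d) : mT -> mT)).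
have mE : forall X, ocitv X -> mu X = m (measurable_affine c d) X.
  move=> _ [[a b]] _ <-; rewrite /m /mscale/= /pushforward.
  have [cn|cp] : c < 0 \/ 0 < c by apply/orP; exact: lt_total.
  2: {
    rewrite (_ : _ @^-1` _ = `](a - d) / c, (b - d) / c]%classic).
      rewrite !lebesgue_measure_itv/= !lte_fin ltr_pM2r ?invr_gt0// ltrD2r.
      case: ifP => _; last by rewrite mule0.
      by rewrite -!EFinB -EFinM gtr0_norm//; congr EFin; field.
    apply/seteqP; split=> x /=; rewrite !in_itv/= ltr_pdivrMr// ler_pdivlMr//.
      by move=> /andP[? ?]; apply/andP; split; lra.
    by move=> /andP[? ?]; apply/andP; split; lra.
  }
  (* A negative slope exchanges the open and the closed end, which does not change the length. *)
  rewrite (_ : _ @^-1` _ = `[(b - d) / c, (a - d) / c[%classic).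
    rewrite !lebesgue_measure_itv/= !lte_fin ltr_nM2r ?invr_lt0// ltrD2r.
    case: ifP => _; last by rewrite mule0.
    by rewrite -!EFinB -EFinM ltr0_norm//; congr EFin; field.
  apply/seteqP; split=> x /=; rewrite !in_itv/= ltr_ndivlMr// ler_ndivrMr//.
    by move=> /andP[? ?]; apply/andP; split; lra.
  by move=> /andP[? ?]; apply/andP; split; lra.
have := lebesgue_measure_unique mE mA; rewrite /m /mscale/= => ->.
by rewrite muleA -EFinM mulVf ?mul1e// normr_eq0.
Qed.

Lemma ge0_integral_affine (c d : R) (D : set R) (f : R -> \bar R) : (c != 0)%R ->
  measurable D -> measurable_fun D f -> (forall x, D x -> 0 <= f x)%E ->
  (\int[mu]_(x in (fun x : R => (c * x + d)%R) @^-1` D) f (c * x + d)%R =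
   (`|c|^-1)%:E * \int[mu]_(x in D) f x)%E.
Proof.
move=> c0 mD mf f0.
have ci0 : 0 <= `|c|^-1 by rewrite invr_ge0.
have := @ge0_integral_mscale _ mT R mu D mD (NngNum ci0) f mf f0.
rewrite /= => <-.
have f0' : {in D, forall y, (0 <= f y)%E} by move=> x /[!inE]; exact: f0.
have := @ge0_integral_pushforward _ _ mT mT R (fun x => c * x + d)%R
  (measurable_affine c d) mu D f mD mf f0'.
rewrite /= => <-.
apply: eq_measure_integral => [|mphi A mA AD]; first exact: measurable_affine.
rewrite /mscale/=.
exact: lebesgue_measure_affine.
Qed.

Lemma integral_affine (c d : R) (D : set R) (f : R -> \bar R) : (c != 0)%R ->
  measurable D -> mu.-integrable D f ->
  (\int[mu]_(x in (fun x : R => (c * x + d)%R) @^-1` D) f (c * x + d)%R =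
   (`|c|^-1)%:E * \int[mu]_(x in D) f x)%E.
Proof.
move=> c0 mD intf; have mf := measurable_int mu intf.
rewrite integralE [in RHS]integralE muleBr//; last first.
  exact: integrable_add_def.
rewrite -!(ge0_integral_affine d)//; last 2 first.
- exact: measurable_funeneg.
- exact: measurable_funepos.
by congr (_ - _)%E; apply: eq_integral => x _; rewrite ?funeposE ?funenegE.
Qed.

Lemma Rintegral_affine (c d : R) (D : set R) (f : R -> R) : c != 0 ->
  measurable D -> mu.-integrable D (EFin \o f) ->
  Rintegral mu ((fun x => c * x + d) @^-1` D) (fun x => f (c * x + d)) =
  `|c|^-1 * Rintegral mu D f.
Proof.
move=> c0 mD intf; rewrite /Rintegral (integral_affine d c0 mD intf) fineM//.
exact: integrable_fin_num.
Qed.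

Lemma integrable_affine (c d : R) (D : set R) (f : R -> R) : c != 0 ->
  measurable D -> mu.-integrable D (EFin \o f) ->
  mu.-integrable ((fun x => c * x + d) @^-1` D) (EFin \o (fun x => f (c * x + d))).
Proof.
move=> c0 mD intf; have mf := measurable_int mu intf.
have mE : measurable ((fun x : R => c * x + d) @^-1` D).
  by rewrite -[X in measurable X]setTI; exact: (measurable_affine c d).
apply/integrableP; split.
  apply: (measurable_comp (F := D) mD _ mf) => //.
    by move=> _ [x ? <-].
  by apply: measurable_funTS; exact: (measurable_affine c d).
rewrite (@ge0_integral_affine c d D (fun x => `|(EFin \o f) x|%E))//.
  move/integrableP : intf => [_ ifoo].
  by rewrite lte_mul_pinfty.
exact: measurableT_comp.
Qed.
End Affine.

(** * Toeplitz matrices and their symbols *)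

Section CircleMean.
Variable R : realType.
Notation mu := (@lebesgue_measure R).
Notation circ := (`[- pi, pi]%classic : set R).

Lemma FTC_Rintegral (F f : R -> R) (a b : R) : a < b -> continuous f ->
  (forall x : R, is_derive x (1 : R) F (f x)) -> Rintegral mu `[a, b] f = F b - F a.
Proof.
move=> ab cf dF; have cF : continuous F.
  by move=> x; apply/differentiable_continuous/derivable1_diffP; case: (dF x).
rewrite /Rintegral (@continuous_FTC2 _ f F) ?EFinN//.
- exact: continuous_subspaceT.
- split.
  + by move=> x _; case: (dF x).
  + exact/cvg_at_right_filter/cF.
  + exact/cvg_at_left_filter/cF.
- by move=> x _; rewrite derive1E; case: (dF x).
Qed.

(** Boundedness, unlike integrability, is stable under products, so every mean below is finite
    without side conditions. *)
Definition nice (h : R -> R) :=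
  measurable_fun circ h /\ exists C, forall x, circ x -> `|h x| <= C.

Definition mean (h : R -> R) : R := (2 * pi)^-1 * Rintegral mu circ h.

Lemma measurable_circ : measurable circ. Proof. exact: measurable_itv. Qed.
Hint Resolve measurable_circ : core.

Lemma lebesgue_circ : mu circ = (2 * pi)%:E.
Proof.
rewrite lebesgue_measure_itv/= lte_fin ifT; last by rewrite gtrN ?pi_gt0.
by rewrite -EFinB opprK mulr_natl mulr2n.
Qed.

Lemma nice_integrable h : nice h -> mu.-integrable circ (EFin \o h).
Proof.
move=> [mh [C hC]]; apply: measurable_bounded_integrable => //.
  exact: (eq_ind_r (fun z => (z < +oo)%E) (ltry _) lebesgue_circ).
exists C; split; first exact: num_real.
by move=> M CM x /hC /le_trans; apply; exact: ltW.
Qed.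

Lemma nice_cst c : nice (cst c).
Proof. by split=> //; exists `|c|. Qed.

Lemma nice_continuous h : continuous h -> nice h.
Proof.
move=> ch; split.
  by apply: measurable_funTS; exact: continuous_measurable_fun.
have /compact_bounded[M [_ mrt]] :=
  continuous_compact (continuous_subspaceT ch) (@segment_compact R (- pi) pi).
exists (M + 1) => x cx; apply: (mrt (M + 1)); last by exists x.
by rewrite ltrDl.
Qed.

Lemma niceD f g : nice f -> nice g -> nice (fun x => f x + g x).
Proof.
move=> [mf [C hC]] [mg [D hD]]; split; first exact: measurable_funD.
exists (C + D) => x cx; apply: le_trans (ler_normD _ _) _.
by apply: lerD; [exact: hC|exact: hD].
Qed.

Lemma niceM f g : nice f -> nice g -> nice (fun x => f x * g x).
Proof.
move=> [mf [C hC]] [mg [D hD]]; split; first exact: measurable_funM.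
exists (C * D) => x cx; rewrite normrM.
by apply: ler_pM => //; [exact: hC|exact: hD].
Qed.

Lemma niceZ c f : nice f -> nice (fun x => c * f x).
Proof. by apply: niceM; exact: nice_cst. Qed.

Lemma niceN f : nice f -> nice (fun x => - f x).
Proof.
move=> nf; rewrite (_ : (fun _ => _) = fun x => -1 * f x); last first.
  by apply/funext => x; rewrite mulN1r.
exact: niceZ.
Qed.

Lemma niceB f g : nice f -> nice g -> nice (fun x => f x - g x).
Proof. by move=> nf ng; apply: niceD => //; exact: niceN. Qed.

Lemma niceX f k : nice f -> nice (fun x => f x ^+ k).
Proof.
move=> nf; elim: k => [|k IH].
  by under eq_fun do rewrite expr0; exact: nice_cst.
by under eq_fun do rewrite exprS; exact: niceM.
Qed.

Lemma nice_sum (I : Type) (s : seq I) (P : pred I) (F : I -> R -> R) :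
  (forall i, nice (F i)) -> nice (fun x => \sum_(i <- s | P i) F i x).
Proof.
move=> nF; elim: s => [|i s IH].
  by under eq_fun do rewrite big_nil; exact: nice_cst.
under eq_fun do rewrite big_cons; case: (P i) => //; exact: niceD.
Qed.

Lemma nice_cos a : nice (fun x => cos (a * x)).
Proof.
apply: nice_continuous => x.
by apply: continuous_comp; [exact: mulrl_continuous|exact: continuous_cos].
Qed.

Lemma nice_sin a : nice (fun x => sin (a * x)).
Proof.
apply: nice_continuous => x.
by apply: continuous_comp; [exact: mulrl_continuous|exact: continuous_sin].
Qed.

Lemma eq_mean f g : (forall x, circ x -> f x = g x) -> mean f = mean g.
Proof.
move=> fg; rewrite /mean; congr (_ * _); apply: eq_Rintegral => x.
by rewrite inE => /fg.
Qed.

Lemma meanD f g : nice f -> nice g ->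
  mean (fun x => f x + g x) = mean f + mean g.
Proof. by move=> nf ng; rewrite /mean RintegralD ?mulrDr//; exact: nice_integrable. Qed.

Lemma meanZ c f : nice f -> mean (fun x => c * f x) = c * mean f.
Proof.
by move=> nf; rewrite /mean RintegralZl//; [rewrite mulrCA|exact: nice_integrable].
Qed.

Lemma meanB f g : nice f -> nice g ->
  mean (fun x => f x - g x) = mean f - mean g.
Proof. by move=> nf ng; rewrite /mean RintegralB ?mulrBr//; exact: nice_integrable. Qed.

Lemma mean_sum (I : Type) (s : seq I) (P : pred I) (F : I -> R -> R) :
  (forall i, nice (F i)) ->
  mean (fun x => \sum_(i <- s | P i) F i x) = \sum_(i <- s | P i) mean (F i).
Proof.
move=> nF; elim: s => [|i s IH].
  rewrite big_nil (_ : mean _ = mean (fun x => 0 * cst 0 x)).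
    by rewrite meanZ ?mul0r//; exact: nice_cst.
  by apply: eq_mean => x _; rewrite big_nil mul0r.
rewrite big_cons -IH; under eq_fun do rewrite big_cons.
by case: (P i) => //; rewrite meanD//; exact: nice_sum.
Qed.

Lemma two_pi_gt0 : 0 < (2 * pi : R)^-1.
Proof. by rewrite invr_gt0 mulr_gt0 ?pi_gt0. Qed.

Lemma le_mean f g : nice f -> nice g -> (forall x, circ x -> f x <= g x) ->
  mean f <= mean g.
Proof.
move=> nf ng fg; rewrite /mean ler_pM2l ?two_pi_gt0//.
by apply: le_Rintegral => //; exact: nice_integrable.
Qed.

Lemma mean_ge0 f : (forall x, circ x -> 0 <= f x) -> 0 <= mean f.
Proof.
move=> f0; rewrite /mean mulr_ge0//; first exact/ltW/two_pi_gt0.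
exact: Rintegral_ge0.
Qed.

Lemma mean_cst c : mean (cst c) = c.
Proof.
rewrite /mean Rintegral_cst// (_ : fine _ = 2 * pi).
  by rewrite mulrCA mulVf ?mulr1// gt_eqF// -invr_gt0 two_pi_gt0.
by rewrite [X in fine X]lebesgue_circ.
Qed.

(** The vanishing sine stands for integrality of k, and fits differences of two indices without a
    case split on their sign. *)
Lemma mean_cos (k : R) : sin (k * pi) = 0 -> k != 0 ->
  mean (fun x => cos (k * x)) = 0.
Proof.
move=> sk k0.
have dF (x : R) : is_derive x (1 : R) (fun x => k^-1 * sin (k * x)) (cos (k * x)).
  have -> : cos (k * x) = k^-1 *: (cos (k * x) * k).
    by rewrite /GRing.scale/=; field.
  apply: is_deriveZ.
  apply: (@is_derive1_comp R (@sin R) (fun x => k * x) x).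
  have := @is_deriveZ R R R id k x 1 1 _.
  by rewrite /GRing.scale/= mulr1; apply.
have cc : continuous (fun x => cos (k * x)).
  by move=> x; apply: continuous_comp; [exact: mulrl_continuous|exact: continuous_cos].
have pp : (- pi : R) < pi by rewrite gtrN ?pi_gt0.
by rewrite /mean (FTC_Rintegral pp cc dF) mulrN sinN sk oppr0 !mulr0 subr0 mulr0.
Qed.

Lemma mean_opp (h : R -> R) : nice h -> mean (fun x => h (- x)) = mean h.
Proof.
move=> nh; rewrite /mean; congr (_ * _).
have n10 : (-1 : R) != 0 by rewrite oppr_eq0 oner_neq0.
have := @Rintegral_affine R (-1) 0 circ h n10 measurable_circ (nice_integrable nh).
rewrite normrN normr1 invr1 mul1r => <-.
rewrite (_ : _ @^-1` _ = circ).
  by apply: eq_Rintegral => x _; rewrite mulN1r addr0.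
apply/seteqP; split=> x /=; rewrite !in_itv/= mulN1r addr0.
  by move=> /andP[? ?]; apply/andP; split; lra.
by move=> /andP[? ?]; apply/andP; split; lra.
Qed.

Lemma mean_odd (h : R -> R) : nice h -> (forall x, h (- x) = - h x) -> mean h = 0.
Proof.
move=> nh hN; have : mean h = - mean h.
  rewrite -[LHS]mean_opp// -mulN1r -meanZ//; apply: eq_mean => x cx.
  by rewrite hN// mulN1r.
by move/eqP; rewrite -addr_eq0 -mulr2n mulrn_eq0/= => /eqP.
Qed.

End CircleMean.

(** * Toeplitz forms as averages over the circle *)

Section Szego.
Variable R : realType.
Notation mu := (@lebesgue_measure R).
Notation circ := (`[- pi, pi]%classic : set R).

Section Dot.
Variable n : nat.
Implicit Types u w : 'cV[R]_n.

Definition dot u w : R := \sum_i u i 0 * w i 0.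
Definition sqn u : R := dot u u.

Lemma dotC u w : dot u w = dot w u.
Proof. by apply: eq_bigr => i _; rewrite mulrC. Qed.

Lemma dotDl u u' w : dot (u + u') w = dot u w + dot u' w.
Proof. by rewrite /dot -big_split; apply: eq_bigr => i _; rewrite mxE mulrDl. Qed.

Lemma dotZl a u w : dot (a *: u) w = a * dot u w.
Proof. by rewrite /dot mulr_sumr; apply: eq_bigr => i _; rewrite mxE mulrA. Qed.

Lemma dotDr u w w' : dot u (w + w') = dot u w + dot u w'.
Proof. by rewrite dotC dotDl ![dot _ u]dotC. Qed.

Lemma dotZr a u w : dot u (a *: w) = a * dot u w.
Proof. by rewrite dotC dotZl dotC. Qed.

Lemma dotMl (M : 'M[R]_n) u w : dot (M *m u) w = dot u (M^T *m w).
Proof.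
rewrite /dot; under eq_bigr do rewrite mxE mulr_suml.
rewrite exchange_big/=; apply: eq_bigr => i _.
by rewrite mxE mulr_sumr; apply: eq_bigr => j _; rewrite mxE; ring.
Qed.

Lemma dotMr (M : 'M[R]_n) u w : dot u (M *m w) = \sum_i \sum_j M i j * (u i 0 * w j 0).
Proof.
rewrite /dot; apply: eq_bigr => i _; rewrite mxE mulr_sumr.
by apply: eq_bigr => j _; ring.
Qed.

Lemma sqn_ge0 u : 0 <= sqn u.
Proof. by apply: sumr_ge0 => i _; rewrite -expr2 sqr_ge0. Qed.

Lemma sqn_eq0 u : sqn u = 0 -> u = 0.
Proof.
move/eqP; rewrite psumr_eq0; last by move=> i _; rewrite -expr2 sqr_ge0.
move=> /allP u0; apply/matrixP => i j; rewrite ord1 mxE.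
by have := u0 i (mem_index_enum i); rewrite mulf_eq0 orbb => /eqP.
Qed.

Lemma sqnZ a u : sqn (a *: u) = a ^+ 2 * sqn u.
Proof. by rewrite /sqn dotZl dotZr mulrA. Qed.

Lemma sqnD u w : sqn (u + w) = sqn u + 2 * dot u w + sqn w.
Proof. by rewrite /sqn !dotDl !dotDr [dot w u]dotC; ring. Qed.

Lemma sqnD_le u w : sqn (u + w) <= 2 * sqn u + 2 * sqn w.
Proof.
have := sqn_ge0 (u - w); rewrite !sqnD -scaleN1r sqnZ dotZr; lra.
Qed.

(** Expand the square norms of e u + w and e u - w and divide by e. The free weight lets [tr_symbol]
    trade a bounded factor against a small one. *)
Lemma dot_young e u w : 0 < e -> `|dot u w| <= (e * sqn u + e^-1 * sqn w) / 2.
Proof.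
move=> e0; have e1 := mulfV (lt0r_neq0 e0).
have h a : 0 <= e * sqn u + 2 * a * dot u w + e^-1 * a ^+ 2 * sqn w.
  have := sqn_ge0 (e *: u + a *: w).
  rewrite sqnD !sqnZ dotZl dotZr => h.
  have -> : e * sqn u + 2 * a * dot u w + e^-1 * a ^+ 2 * sqn w =
    e^-1 * (e ^+ 2 * sqn u + 2 * (e * (a * dot u w)) + a ^+ 2 * sqn w).
    by field; exact: lt0r_neq0.
  by rewrite mulr_ge0// invr_ge0 ltW.
by have := h 1; have := h (-1); rewrite ler_norml => ? ?; apply/andP; split; lra.
Qed.

End Dot.

(* A real substitute for (e^(ijx))_j: its outer product averages to the identity
   over the circle, and against an even xi to the Toeplitz matrix of xi. *)
Definition cas n (x : R) : 'cV[R]_n :=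
  \col_j (cos (j%:R * x) + sin (j%:R * x)).

Definition Tz n (xi : R -> R) : 'M[R]_n :=
  \matrix_(i, j) mean (fun x => xi x * cos ((i%:R - j%:R) * x)).

Lemma nice_cas n i : nice (fun x => cas n x i 0).
Proof.
under eq_fun do rewrite mxE.
by apply: niceD; [exact: nice_cos|exact: nice_sin].
Qed.

(** The product of two entries is cos ((i - j) x) + sin ((i + j) x). The sine part is odd, so it
    averages to zero against an even xi. *)
Lemma mean_cas n (xi : R -> R) i j : nice xi -> (forall x, xi (- x) = xi x) ->
  mean (fun x => xi x * (cas n x i 0 * cas n x j 0)) = Tz n xi i j.
Proof.
move=> nxi xiN; rewrite mxE.
rewrite (_ : mean _ = mean (fun x => xi x * cos ((i%:R - j%:R) * x) +
                                xi x * sin ((i%:R + j%:R) * x))); last first.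
  apply: eq_mean => x _; rewrite !mxE (mulrBl x) cosB (mulrDl i%:R j%:R x) sinD; ring.
rewrite meanD; last 2 first.
- by apply: niceM => //; exact: nice_cos.
- by apply: niceM => //; exact: nice_sin.
rewrite [X in _ + X]mean_odd ?addr0//.
- by apply: niceM => //; exact: nice_sin.
- by move=> x; rewrite xiN mulrN sinN mulrN.
Qed.

Lemma sin_natpi k : sin (k%:R * pi : R) = 0.
Proof.
elim: k => [|k IH]; first by rewrite mul0r sin0.
by rewrite -natr1 mulrDl mul1r sinDpi IH oppr0.
Qed.

Lemma sin_diffpi (i j : nat) : sin ((i%:R - j%:R) * pi : R) = 0.
Proof. by rewrite mulrBl sinB !sin_natpi !(mul0r, mulr0) subr0. Qed.

Lemma mean_cos_diff (i j : nat) :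
  mean (fun x : R => cos ((i%:R - j%:R) * x)) = (i == j)%:R.
Proof.
have [->|ij] := eqVneq i j.
  rewrite subrr -[RHS](@mean_cst R 1); apply: eq_mean => x _.
  by rewrite mul0r cos0.
by rewrite mean_cos ?sin_diffpi// subr_eq0 eqr_nat.
Qed.

Lemma Tz_cst n (a : R) : Tz n (cst a) = a%:M.
Proof.
apply/matrixP => i j; rewrite !mxE meanZ; last exact: nice_cos.
by rewrite mean_cos_diff mulr_natr.
Qed.

Lemma tr_Tz n xi : \tr (Tz n xi) = n%:R * mean xi.
Proof.
rewrite /mxtrace (eq_bigr (fun=> mean xi)).
  by rewrite sumr_const card_ord mulr_natl.
move=> i _; rewrite mxE; apply: eq_mean => x _.
by rewrite subrr mul0r cos0 mulr1.
Qed.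

Lemma tr_Tzsym n xi : (Tz n xi)^T = Tz n xi.
Proof.
apply/matrixP => i j; rewrite !mxE; apply: eq_mean => x _.
by rewrite -cosN -mulNr opprB.
Qed.

Lemma nice_mulcas n (M : 'M[R]_n) i : nice (fun x => (M *m cas n x) i 0).
Proof.
under eq_fun do rewrite mxE.
by apply: nice_sum => j; apply: niceZ; exact: nice_cas.
Qed.

Lemma nice_dot n (u w : R -> 'cV[R]_n) : (forall i, nice (fun x => u x i 0)) ->
  (forall i, nice (fun x => w x i 0)) -> nice (fun x => dot (u x) (w x)).
Proof. by move=> nu nw; apply: nice_sum => i; apply: niceM. Qed.

Lemma mean_dot_cas n (M : 'M[R]_n) xi : nice xi -> (forall x, xi (- x) = xi x) ->
  mean (fun x => xi x * dot (cas n x) (M *m cas n x)) = \tr (Tz n xi *m M).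
Proof.
move=> nxi xiN.
rewrite (_ : mean _ = mean (fun x => \sum_i \sum_j
   M i j * (xi x * (cas n x i 0 * cas n x j 0)))); last first.
  apply: eq_mean => x _; rewrite dotMr mulr_sumr; apply: eq_bigr => i _.
  by rewrite mulr_sumr; apply: eq_bigr => j _; ring.
have nij i j : nice (fun x => M i j * (xi x * (cas n x i 0 * cas n x j 0))).
  by apply: niceZ; apply: niceM => //; apply: niceM; exact: nice_cas.
rewrite mean_sum; last by move=> i; exact: nice_sum.
under eq_bigr do rewrite mean_sum//.
rewrite /mxtrace; under [RHS]eq_bigr do rewrite mxE.
rewrite [RHS]exchange_big/=; apply: eq_bigr => i _; apply: eq_bigr => j _.
rewrite meanZ ?mean_cas//; last first.
  by apply: niceM => //; apply: niceM; exact: nice_cas.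
by rewrite mulrC -[in LHS]tr_Tzsym mxE.
Qed.

Lemma mean_dot_cas1 n (M : 'M[R]_n) :
  mean (fun x => dot (cas n x) (M *m cas n x)) = \tr M.
Proof.
have := @mean_dot_cas n M (cst 1) (nice_cst _) (fun=> erefl).
rewrite Tz_cst mul1mx => <-; apply: eq_mean => x _; by rewrite mul1r.
Qed.

Lemma mean_sqn_cas n : mean (fun x => sqn (cas n x)) = n%:R.
Proof.
rewrite -[RHS](mxtrace_scalar n (1 : R)) -mean_dot_cas1; apply: eq_mean => x _.
by rewrite mul1mx.
Qed.

Lemma mean_sqn_mulcas n (M : 'M[R]_n) :
  mean (fun x => sqn (M *m cas n x)) = \sum_i \sum_j M i j ^+ 2.
Proof.
transitivity (\tr (M^T *m M)).
  rewrite -mean_dot_cas1; apply: eq_mean => x _.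
  by rewrite /sqn dotMl mulmxA.
rewrite /mxtrace exchange_big/=; apply: eq_bigr => i _; rewrite mxE.
by apply: eq_bigr => j _; rewrite mxE expr2.
Qed.

(** The Toeplitz form is an average of squares weighted by xi, which makes it nonnegative as soon as
    xi is. *)
Lemma dot_Tz n xi (u : 'cV[R]_n) : nice xi -> (forall x, xi (- x) = xi x) ->
  dot u (Tz n xi *m u) = mean (fun x => xi x * dot u (cas n x) ^+ 2).
Proof.
move=> nxi xiN; rewrite dotMr.
transitivity (mean (fun x => \sum_i \sum_j
   (u i 0 * u j 0) * (xi x * (cas n x i 0 * cas n x j 0)))); last first.
  apply: eq_mean => x _; rewrite /dot expr2 big_distrlr/= mulr_sumr.
  by apply: eq_bigr => i _; rewrite mulr_sumr; apply: eq_bigr => j _; ring.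
have nij i j : nice (fun x => (u i 0 * u j 0) * (xi x * (cas n x i 0 * cas n x j 0))).
  by apply: niceZ; apply: niceM => //; apply: niceM; exact: nice_cas.
rewrite mean_sum; last by move=> i; exact: nice_sum.
apply: eq_bigr => i _; rewrite mean_sum//; apply: eq_bigr => j _.
rewrite meanZ ?mean_cas// 1?mulrC//.
by apply: niceM => //; apply: niceM; exact: nice_cas.
Qed.

Lemma dot_Tz_ge0 n xi (u : 'cV[R]_n) : nice xi -> (forall x, xi (- x) = xi x) ->
  (forall x, circ x -> 0 <= xi x) -> 0 <= dot u (Tz n xi *m u).
Proof.
move=> nxi xiN xi0; rewrite dot_Tz//; apply: mean_ge0 => x cx.
by rewrite mulr_ge0 ?sqr_ge0 ?xi0.
Qed.

End Szego.

(** * Fejer means and the Frobenius norm of a Toeplitz matrix *)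

Section Fejer.
Variable R : realType.
Notation circ := (`[- pi, pi]%classic : set R).

(** Telescoping: 2 sin z cos (2 j z) is a difference of sines at consecutive odd multiples of z. The
    doubled frequency avoids half angles. *)
Lemma dirichlet_cos n (z : R) :
  2 * sin z * \sum_(j < n) cos (j%:R * (2 * z)) = sin ((2 * n%:R - 1) * z) + sin z.
Proof.
elim: n => [|n IH]; first by rewrite big_ord0 !mulr0 sub0r mulN1r sinN addNr.
rewrite big_ord_recr/= mulrDr IH.
have -> : (2 * n.+1%:R - 1) * z = 2 * n%:R * z + z by rewrite -natr1; ring.
have -> : (2 * n%:R - 1) * z = 2 * n%:R * z - z by ring.
have -> : n%:R * (2 * z) = 2 * n%:R * z by ring.
by rewrite sinB sinD; ring.
Qed.

Lemma dirichlet_sin n (z : R) :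
  2 * sin z * \sum_(j < n) sin (j%:R * (2 * z)) = cos z - cos ((2 * n%:R - 1) * z).
Proof.
elim: n => [|n IH]; first by rewrite big_ord0 !mulr0 sub0r mulN1r cosN subrr.
rewrite big_ord_recr/= mulrDr IH.
have -> : (2 * n.+1%:R - 1) * z = 2 * n%:R * z + z by rewrite -natr1; ring.
have -> : (2 * n%:R - 1) * z = 2 * n%:R * z - z by ring.
have -> : n%:R * (2 * z) = 2 * n%:R * z by ring.
by rewrite cosB cosD; ring.
Qed.

Definition fejer n (z : R) := n%:R^-1 * \sum_(i < n) \sum_(j < n) cos ((i%:R - j%:R) * z).

Lemma fejerE n z : fejer n z =
  n%:R^-1 * ((\sum_(i < n) cos (i%:R * z)) ^+ 2 + (\sum_(i < n) sin (i%:R * z)) ^+ 2).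
Proof.
rewrite /fejer; congr (_ * _); rewrite !expr2 !big_distrlr/= -big_split/=.
by apply: eq_bigr => i _; rewrite -big_split/=; apply: eq_bigr => j _; rewrite mulrBl cosB.
Qed.

(** The kernel is a sum of two squared Dirichlet sums over n. Multiplied by 2 sin z, each sum
    becomes a two-term trigonometric expression, bounded whatever n is. *)
Lemma fejer_sin_le n z : fejer n (2 * z) * sin z ^+ 2 <= 2 / n%:R.
Proof.
rewrite fejerE -mulrA mulrC ler_wpM2r ?invr_ge0//.
have := dirichlet_cos n z; have := dirichlet_sin n z.
set S := \sum_(i < n) sin _; set C := \sum_(i < n) cos _ => eS eC.
have -> : (C ^+ 2 + S ^+ 2) * sin z ^+ 2 = ((2 * sin z * C) ^+ 2 + (2 * sin z * S) ^+ 2) / 4.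
  by field.
rewrite eS eC.
set w := (2 * n%:R - 1) * z.
have h1 := cos2Dsin2 z; have h2 := cos2Dsin2 w.
have h3 : (sin w + sin z) ^+ 2 + (cos z - cos w) ^+ 2 =
   (cos z ^+ 2 + sin z ^+ 2) + (cos w ^+ 2 + sin w ^+ 2) + 2 * (sin w * sin z - cos w * cos z).
  by ring.
rewrite h3 h1 h2.
have := cos_geN1 (w + z); rewrite cosD; lra.
Qed.

Lemma fejer_ge0 n z : 0 <= fejer n z.
Proof. by rewrite fejerE mulr_ge0 ?invr_ge0// addr_ge0 ?sqr_ge0. Qed.

(** For even h this is the convolution of h with the Fejer kernel ([cesaroE]); the double sum ties
    it to the entries of the Toeplitz matrix. *)
Definition cesaro n (h : R -> R) x :=
  n%:R^-1 * \sum_(i < n) \sum_(j < n) cos ((i%:R - j%:R) * x) * Tz n h i j.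

Lemma nice_fejer n x : nice (fun y => fejer n (x - y)).
Proof.
rewrite (_ : (fun _ => _) = fun y => n%:R^-1 * \sum_(i < n) \sum_(j < n)
  (cos ((i%:R - j%:R) * x) * cos ((i%:R - j%:R) * y) +
   sin ((i%:R - j%:R) * x) * sin ((i%:R - j%:R) * y))).
  apply: niceZ; apply: nice_sum => i; apply: nice_sum => j.
  by apply: niceD; apply: niceZ; [exact: nice_cos|exact: nice_sin].
apply/funext => y; rewrite /fejer; congr (_ * _).
by apply: eq_bigr => i _; apply: eq_bigr => j _; rewrite mulrBr cosB.
Qed.

Lemma cesaroE n h x : nice h -> (forall y, h (- y) = h y) ->
  cesaro n h x = mean (fun y => h y * fejer n (x - y)).
Proof.
move=> nh hN.
have nc i j : nice (fun y : R => cos ((i%:R - j%:R) * x) * (h y * cos ((i%:R - j%:R) * y))).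
  by apply: niceZ; apply: niceM => //; exact: nice_cos.
have ns i j : nice (fun y : R => sin ((i%:R - j%:R) * x) * (h y * sin ((i%:R - j%:R) * y))).
  by apply: niceZ; apply: niceM => //; exact: nice_sin.
rewrite (_ : mean _ = mean (fun y => n%:R^-1 * \sum_(i < n) \sum_(j < n)
  (cos ((i%:R - j%:R) * x) * (h y * cos ((i%:R - j%:R) * y)) +
   sin ((i%:R - j%:R) * x) * (h y * sin ((i%:R - j%:R) * y))))); last first.
  apply: eq_mean => y _; rewrite /fejer mulrCA; congr (_ * _); rewrite mulr_sumr.
  apply: eq_bigr => i _; rewrite mulr_sumr; apply: eq_bigr => j _.
  by rewrite mulrBr cosB; ring.
rewrite meanZ; last by apply: nice_sum => i; apply: nice_sum => j; exact: niceD.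
rewrite /cesaro; congr (_ * _); rewrite mean_sum; last first.
  by move=> i; apply: nice_sum => j; exact: niceD.
apply: eq_bigr => i _; rewrite mean_sum; last by move=> j; exact: niceD.
apply: eq_bigr => j _; rewrite meanD// meanZ; last by apply: niceM => //; exact: nice_cos.
rewrite meanZ; last by apply: niceM => //; exact: nice_sin.
rewrite [X in _ + _ * X]mean_odd ?mulr0 ?addr0 ?mxE//.
  by apply: niceM => //; exact: nice_sin.
by move=> y; rewrite hN mulrN sinN mulrN.
Qed.

Lemma nice_cesaro n h : nice (cesaro n h).
Proof.
apply: niceZ; apply: nice_sum => i; apply: nice_sum => j.
apply: (niceM _ (nice_cst _)); exact: nice_cos.
Qed.

(** Averaging kills the off-diagonal terms and leaves n diagonal ones, each equal to the mean of
    h. *)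
Lemma mean_cesaro n h : (0 < n)%N -> mean (cesaro n h) = mean h.
Proof.
move=> n0; have nij (i j : 'I_n) : nice (fun x => cos ((i%:R - j%:R) * x) * Tz n h i j).
  by apply: (niceM _ (nice_cst _)); exact: nice_cos.
rewrite meanZ; last by apply: nice_sum => i; exact: nice_sum.
rewrite mean_sum; last by move=> i; exact: nice_sum.
rewrite (eq_bigr (fun=> mean h)); last first.
  move=> i _; rewrite mean_sum// (bigD1 i)//= big1 => [|j ji].
    rewrite addr0 (_ : mean _ = mean (fun x => Tz n h i i * cos ((i%:R - i%:R) * x))).
      rewrite meanZ ?mean_cos_diff ?eqxx ?mulr1 ?mxE; last exact: nice_cos.
      by apply: eq_mean => x _; rewrite subrr mul0r cos0 mulr1.
    by apply: eq_mean => x _; rewrite mulrC.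
  rewrite (_ : mean _ = mean (fun x => Tz n h i j * cos ((i%:R - j%:R) * x))).
    rewrite meanZ ?mean_cos_diff; last exact: nice_cos.
    by rewrite (_ : (_ == _) = false) ?mulr0//; apply: contraNF ji => /eqP ij; apply/eqP/val_inj.
  by apply: eq_mean => x _; rewrite mulrC.
by rewrite sumr_const card_ord -[mean h *+ n]mulr_natl mulrA mulVf ?mul1r// pnatr_eq0 -lt0n.
Qed.

Variable f : R -> R.
Hypothesis nf : nice f.
Hypothesis fN : forall x, f (- x) = f x.
Variable C : R.
(** Lipschitz for the chordal distance, in which - pi and pi coincide. Its square is the factor that
    the Fejer estimate absorbs. *)
Hypothesis fC : forall x y, circ x -> circ y -> `|f x - f y| <= C * `|sin ((x - y) / 2)|.

Let nf2 : nice (fun x => f x ^+ 2). Proof. exact: niceX. Qed.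
Let f2N x : f (- x) ^+ 2 = f x ^+ 2. Proof. by rewrite fN. Qed.

(** The left side is the average over y of (f x - f y)^2 against the Fejer kernel centered at x. *)
Lemma cesaro_variance n x : (0 < n)%N -> circ x ->
  f x ^+ 2 - 2 * (f x * cesaro n f x) + cesaro n (fun y => f y ^+ 2) x <= 2 * C ^+ 2 / n%:R.
Proof.
move=> n0 cx.
(* The kernel has total mass one, so f x ^ 2 can be brought under the average over y. *)
have c1 : cesaro n (cst 1) x = 1.
  rewrite /cesaro Tz_cst (eq_bigr (fun=> 1)).
    by rewrite sumr_const card_ord mulVf// pnatr_eq0 -lt0n.
  move=> i _; rewrite (bigD1 i)//= big1 => [|j ji].
    by rewrite mxE eqxx mulr1 subrr mul0r cos0 addr0.
  by rewrite mxE eq_sym (negbTE ji) mulr0.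
have -> : f x ^+ 2 = f x ^+ 2 * cesaro n (cst 1) x by rewrite c1 mulr1.
rewrite !cesaroE//; last exact: nice_cst.
have nF := nice_fejer n x.
have nfF : nice (fun y => f y * fejer n (x - y)) by exact: niceM.
have nf2F : nice (fun y => f y ^+ 2 * fejer n (x - y)) by exact: niceM.
have n1F : nice (fun y => cst 1 y * fejer n (x - y)) by exact: niceZ.
rewrite mulrA -!meanZ// -meanB; [|exact: niceZ|exact: niceZ].
rewrite -meanD//; last by apply: niceB; exact: niceZ.
rewrite -[leRHS]mean_cst; apply: le_mean; last 1 first.
- move=> y cy.
  have -> : f x ^+ 2 * (cst 1 y * fejer n (x - y)) - 2 * f x * (f y * fejer n (x - y)) +
     f y ^+ 2 * fejer n (x - y) = (f x - f y) ^+ 2 * fejer n (x - y).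
    by rewrite /cst; ring.
  apply: (@le_trans _ _ ((C * `|sin ((x - y) / 2)|) ^+ 2 * fejer n (x - y))).
    rewrite ler_wpM2r ?fejer_ge0// -(real_normK (num_real (f x - f y))).
    by rewrite ler_sqr ?nnegrE ?fC// (le_trans _ (fC cx cy)).
  set s := sin _; set F := fejer _ _.
  have -> : (C * `|s|) ^+ 2 * F = C ^+ 2 * (F * s ^+ 2).
    by rewrite exprMn real_normK ?num_real//; ring.
  have -> : 2 * C ^+ 2 / n%:R = C ^+ 2 * (2 / n%:R) by ring.
  rewrite ler_wpM2l ?sqr_ge0//.
  have := fejer_sin_le n ((x - y) / 2).
  by have -> : 2 * ((x - y) / 2) = x - y by field.
- by apply: niceD => //; apply: niceB; exact: niceZ.
- exact: nice_cst.
Qed.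

(** Average the pointwise bound over x: both square terms give the mean of f^2, and the cross term
    gives tr (T^2) / n. *)
Lemma tr_Tz2_lower n : (0 < n)%N ->
  n%:R * mean (fun x => f x ^+ 2) - \tr (Tz n f *m Tz n f) <= C ^+ 2.
Proof.
move=> n0; have n0' : 0 < n%:R :> R by rewrite ltr0n.
have : mean (fun x => f x ^+ 2 - 2 * (f x * cesaro n f x) + cesaro n (fun y => f y ^+ 2) x)
   <= 2 * C ^+ 2 / n%:R.
  rewrite -[leRHS]mean_cst; apply: le_mean; last by move=> x cx; exact: cesaro_variance.
    apply: niceD; last exact: nice_cesaro.
    by apply: niceB => //; apply: niceZ; apply: niceM => //; exact: nice_cesaro.
  exact: nice_cst.
have nfc : nice (fun x => f x * cesaro n f x) by apply: niceM => //; exact: nice_cesaro.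
rewrite meanD; [|by apply: niceB => //; exact: niceZ|exact: nice_cesaro].
rewrite meanB//; last exact: niceZ.
rewrite meanZ// mean_cesaro//.
have -> : mean (fun x => f x * cesaro n f x) = n%:R^-1 * \tr (Tz n f *m Tz n f).
  have nij (i j : 'I_n) : nice (fun x => Tz n f i j * (f x * cos ((i%:R - j%:R) * x))).
    by apply: niceZ; apply: niceM => //; exact: nice_cos.
  rewrite (_ : mean _ = mean (fun x => n%:R^-1 * \sum_(i < n) \sum_(j < n)
     Tz n f i j * (f x * cos ((i%:R - j%:R) * x)))); last first.
    apply: eq_mean => x _; rewrite /cesaro mulrCA; congr (_ * _); rewrite mulr_sumr.
    apply: eq_bigr => i _; rewrite mulr_sumr; apply: eq_bigr => j _; ring.
  rewrite meanZ; last by apply: nice_sum => i; exact: nice_sum.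
  congr (_ * _); rewrite mean_sum; last by move=> i; exact: nice_sum.
  rewrite /mxtrace; apply: eq_bigr => i _; rewrite mean_sum// mxE.
  apply: eq_bigr => j _; rewrite meanZ; last by apply: niceM => //; exact: nice_cos.
  have -> : Tz n f j i = Tz n f i j by rewrite -{1}(tr_Tzsym n f) mxE.
  by rewrite [X in _ * X = _](_ : _ = Tz n f i j)// mxE.
rewrite -subr_ge0 => h.
have := mulr_ge0 (ltW n0') h; rewrite -subr_ge0.
set m2 := mean _; set t := \tr _ => h2.
have e : n%:R * (2 * C ^+ 2 / n%:R - (m2 - 2 * (n%:R^-1 * t) + m2)) =
  2 * C ^+ 2 - 2 * (n%:R * m2 - t) by field; exact: lt0r_neq0.
by move: h2; rewrite e; lra.
Qed.
End Fejer.

(** * Calculus of symbols *)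

Section SymbolCalculus.
Variable R : realType.
Notation circ := (`[- pi, pi]%classic : set R).
Implicit Types xi eta : R -> R.

(** The mean of |cas|^2 is n, so the factor 1/n makes this a relative error. *)
Definition defect n (X : 'M[R]_n) xi :=
  n%:R^-1 * mean (fun x => sqn (X *m cas n x - xi x *: cas n x)).

Definition has_symbol (X : forall n, 'M[R]_n) xi :=
  (fun n => defect (X n) xi) @ \oo --> (0 : R).

Lemma nice_defect n (X : 'M[R]_n) xi i : nice xi ->
  nice (fun x => (X *m cas n x - xi x *: cas n x) i 0).
Proof.
move=> nxi; rewrite (_ : (fun _ => _) = fun x => (X *m cas n x) i 0 - xi x * cas n x i 0).
  2: by apply/funext => x; rewrite !mxE.
apply: niceB; first exact: nice_mulcas.
by apply: niceM => //; exact: nice_cas.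
Qed.

Lemma nice_sqn_defect n (X : 'M[R]_n) xi : nice xi ->
  nice (fun x => sqn (X *m cas n x - xi x *: cas n x)).
Proof. by move=> nxi; apply: nice_dot => i; exact: nice_defect. Qed.

Lemma nice_sqn_cas n : nice (fun x => sqn (@cas R n x)).
Proof. by apply: nice_dot => i; exact: nice_cas. Qed.

Lemma nice_sqn_mulcas n (X : 'M[R]_n) : nice (fun x => sqn (X *m cas n x)).
Proof. by apply: nice_dot => i; exact: nice_mulcas. Qed.

Lemma defect_ge0 n (X : 'M[R]_n) xi : 0 <= defect X xi.
Proof. by rewrite mulr_ge0 ?invr_ge0//; apply: mean_ge0 => x _; exact: sqn_ge0. Qed.

Lemma has_symbol_le (X : forall n, 'M[R]_n) xi (u : nat -> R) :
  (forall n, (0 < n)%N -> defect (X n) xi <= u n) -> u @ \oo --> (0 : R) ->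
  has_symbol X xi.
Proof.
move=> le_u u0; apply: (@squeeze_cvgr _ _ _ _ (cst 0) u) => //; last exact: cvg_cst.
near=> n; rewrite defect_ge0/=; apply: le_u.
by near: n; exists 1%N.
Unshelve. all: by end_near. Qed.

Lemma le_defect n (X : 'M[R]_n) xi (c : R) (h : R -> R) : nice xi -> nice h ->
  (forall x, circ x -> sqn (X *m cas n x - xi x *: cas n x) <= h x) ->
  n%:R^-1 * mean h <= c -> defect X xi <= c.
Proof.
move=> nxi nh le_h; apply: le_trans; rewrite ler_wpM2l ?invr_ge0//.
by apply: le_mean => //; exact: nice_sqn_defect.
Qed.

Lemma has_symbol_lin (X Y : forall n, 'M[R]_n) xi eta a b : nice xi -> nice eta ->
  has_symbol X xi -> has_symbol Y eta ->
  has_symbol (fun n => a *: X n + b *: Y n) (fun x => a * xi x + b * eta x).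
Proof.
move=> nxi neta hX hY.
pose u n := 2 * a ^+ 2 * defect (X n) xi + 2 * b ^+ 2 * defect (Y n) eta.
apply: (@has_symbol_le _ _ u) => [n n0|]; last first.
  rewrite -[X in _ --> X](_ : 2 * a ^+ 2 * 0 + 2 * b ^+ 2 * 0 = 0); last by rewrite !mulr0 addr0.
  by apply: cvgD; apply: cvgMr; [exact: hX|exact: hY].
have nX := nice_sqn_defect (X n) nxi; have nY := nice_sqn_defect (Y n) neta.
apply: (@le_defect _ _ _ _ (fun x =>
   2 * a ^+ 2 * sqn (X n *m cas n x - xi x *: cas n x) +
   2 * b ^+ 2 * sqn (Y n *m cas n x - eta x *: cas n x))).
- by apply: niceD; exact: niceZ.
- by apply: niceD; exact: niceZ.
- move=> x _.
  have -> : (a *: X n + b *: Y n) *m cas n x - (a * xi x + b * eta x) *: cas n x =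
    a *: (X n *m cas n x - xi x *: cas n x) + b *: (Y n *m cas n x - eta x *: cas n x).
    rewrite mulmxDl -!scalemxAl !scalerBr !scalerA scalerDl opprD.
    by rewrite !addrA; congr (_ + _); rewrite -!addrA; congr (_ + _); rewrite addrC.
  by apply: le_trans (sqnD_le _ _) _; rewrite !sqnZ !mulrA.
- rewrite /u /defect meanD ?meanZ//; try exact: niceZ.
  rewrite mulrDr !(mulrCA n%:R^-1); exact: lexx.
Qed.

(** XY e - xi eta e = eta (X e - xi e) + X (Y e - eta e), with e = cas. The scalar eta is bounded,
    and X must not enlarge the error of Y; no norm bound is asked of Y. *)
Lemma has_symbol_mul (X Y : forall n, 'M[R]_n) xi eta : nice xi -> nice eta ->
  (forall n u, sqn (X n *m u) <= sqn u) ->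
  has_symbol X xi -> has_symbol Y eta ->
  has_symbol (fun n => X n *m Y n) (fun x => xi x * eta x).
Proof.
move=> nxi neta cX hX hY; have [_ [E hE]] := neta.
pose u n := 2 * E ^+ 2 * defect (X n) xi + 2 * defect (Y n) eta.
apply: (@has_symbol_le _ _ u) => [n n0|]; last first.
  rewrite -[X in _ --> X](_ : 2 * E ^+ 2 * 0 + 2 * 0 = 0); last by rewrite !mulr0 addr0.
  by apply: cvgD; apply: cvgMr; [exact: hX|exact: hY].
have nX := nice_sqn_defect (X n) nxi; have nY := nice_sqn_defect (Y n) neta.
apply: (@le_defect _ _ _ _ (fun x =>
   2 * E ^+ 2 * sqn (X n *m cas n x - xi x *: cas n x) +
   2 * sqn (Y n *m cas n x - eta x *: cas n x))).
- exact: niceM.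
- by apply: niceD; exact: niceZ.
- move=> x cx.
  have -> : X n *m Y n *m cas n x - (xi x * eta x) *: cas n x =
    eta x *: (X n *m cas n x - xi x *: cas n x) + X n *m (Y n *m cas n x - eta x *: cas n x).
    rewrite mulmxBr !scalerBr -scalemxAr scalerA -mulmxA (mulrC (eta x)).
    by rewrite [RHS]addrC subrKA.
  apply: le_trans (sqnD_le _ _) _; rewrite sqnZ; apply: lerD; last first.
    by rewrite ler_pM2l.
  rewrite -mulrA ler_pM2l// ler_wpM2r ?sqn_ge0//.
  by rewrite -(real_normK (num_real (eta x))) lerXn2r ?nnegrE ?hE// (le_trans _ (hE _ cx)).
- rewrite /u /defect meanD ?meanZ//; try exact: niceZ.
  rewrite mulrDr !(mulrCA n%:R^-1); exact: lexx.
Qed.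

Lemma has_symbol1 : has_symbol (fun n => 1%:M) (cst 1).
Proof.
apply: (@has_symbol_le _ _ (cst 0)); last exact: cvg_cst.
move=> n _; rewrite /defect (_ : mean _ = mean (cst 0)).
  by rewrite mean_cst mulr0.
apply: eq_mean => x _; rewrite mul1mx scale1r subrr.
by rewrite /sqn -[X in dot X](scale0r (0 : 'cV[R]_n)) dotZl mul0r.
Qed.

(** On expanding |T e - f e|^2, both |T e|^2 and f (e . T e) average to tr (T^2). The defect is
    therefore the mean of f^2 minus tr (T^2) / n, which is O(1/n). *)
Lemma has_symbol_Tz f C : nice f -> (forall x, f (- x) = f x) ->
  (forall x y, circ x -> circ y -> `|f x - f y| <= C * `|sin ((x - y) / 2)|) ->
  has_symbol (fun n => Tz n f) f.
Proof.
move=> nf fN fC.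
apply: (@has_symbol_le _ _ (fun n => C ^+ 2 * n%:R^-1)); last first.
  rewrite -[X in _ --> X](mulr0 (C ^+ 2)); apply: cvgMr.
  apply/gtr0_cvgV0; last exact: cvgr_idn.
  by near=> n; rewrite ltr0n; near: n; exists 1%N.
move=> n n0; rewrite mulrC /defect ler_wpM2l ?invr_ge0//.
apply: le_trans (tr_Tz2_lower nf fN fC n0).
have nf2 : nice (fun x => f x ^+ 2) by exact: niceX.
have nd (M : 'M[R]_n) : nice (fun x => dot (cas n x) (M *m cas n x)).
  by apply: nice_dot => i; [exact: nice_cas|exact: nice_mulcas].
rewrite -tr_Tz -[Tz n (fun x => f x ^+ 2)]mulmx1 -(mean_dot_cas 1%:M nf2); last by move=> x; rewrite fN.
have <- : \tr ((Tz n f)^T *m Tz n f) = \tr (Tz n f *m Tz n f) by rewrite tr_Tzsym.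
rewrite -[X in _ - X]mean_dot_cas1.
rewrite -meanB//; last by apply: niceM.
have -> : (fun x => f x ^+ 2 * dot (cas n x) (1%:M *m cas n x) -
    dot (cas n x) ((Tz n f)^T *m Tz n f *m cas n x)) =
   (fun x => f x ^+ 2 * sqn (cas n x) - sqn (Tz n f *m cas n x)).
  by apply/funext => x; rewrite mul1mx -mulmxA /sqn [dot (Tz n f *m _) _]dotMl.
have nfd : nice (fun x => f x * dot (cas n x) (Tz n f *m cas n x)) by exact: niceM.
have ns := nice_sqn_mulcas (Tz n f).
have nc : nice (fun x => f x ^+ 2 * sqn (cas n x)) by apply: niceM => //; exact: nice_sqn_cas.
have e1 : mean (fun x => f x * dot (cas n x) (Tz n f *m cas n x)) =
          mean (fun x => sqn (Tz n f *m cas n x)).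
  rewrite mean_dot_cas// -[LHS]mean_dot_cas1; apply: eq_mean => x _.
  by rewrite /sqn dotMl tr_Tzsym mulmxA.
have -> : mean (fun x => sqn (Tz n f *m cas n x - f x *: cas n x)) =
   mean (fun x => (sqn (Tz n f *m cas n x) -
        2 * (f x * dot (cas n x) (Tz n f *m cas n x))) + f x ^+ 2 * sqn (cas n x)).
  apply: eq_mean => x _; rewrite -scaleNr sqnD sqnZ dotZr sqrrN dotC; ring.
rewrite meanD//; last by apply: niceB => //; exact: niceZ.
rewrite meanB//; last exact: niceZ.
rewrite meanZ// e1 meanB// le_eqVlt; apply/orP; left; apply/eqP; ring.
Unshelve. all: by end_near. Qed.

Section Resolvent.
Variables (f : R -> R) (b : R).
Hypotheses (nf : nice f) (fN : forall x, f (- x) = f x).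
Hypotheses (f0 : forall x, circ x -> 0 <= f x) (b0 : 0 < b).

Definition resolvent n : 'M[R]_n := invmx (1%:M + b *: Tz n f).

(** The cross term 2 b (u . T u) is nonnegative because f is. *)
Lemma sqn_shift n (u : 'cV[R]_n) : sqn u <= sqn ((1%:M + b *: Tz n f) *m u).
Proof.
rewrite mulmxDl mul1mx -scalemxAl sqnD sqnZ dotZr.
have h1 := dot_Tz_ge0 u nf fN f0.
have h2 := sqn_ge0 (Tz n f *m u).
have h3 : 0 <= b * dot u (Tz n f *m u) by rewrite mulr_ge0// ltW.
have h4 : 0 <= b ^+ 2 * sqn (Tz n f *m u) by rewrite mulr_ge0// sqr_ge0.
lra.
Qed.

(** The matrix is injective by [sqn_shift]; its symmetry turns the row kernel of [kermx] into a
    column kernel. *)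
Lemma unit_shift n : 1%:M + b *: Tz n f \in unitmx.
Proof.
rewrite -row_free_unit -kermx_eq0; apply/eqP/row_matrixP => i; rewrite row0.
set u := row i _; have uG : u *m (1%:M + b *: Tz n f) = 0.
  by rewrite -row_mul mulmx_ker row0.
apply: trmx_inj; rewrite trmx0; apply: sqn_eq0; apply/eqP.
rewrite eq_le sqn_ge0 andbT; apply: le_trans (sqn_shift _) _.
have -> : (1%:M + b *: Tz n f) *m u^T = 0.
  have -> : 1%:M + b *: Tz n f = (1%:M + b *: Tz n f)^T.
    by rewrite linearD/= linearZ/= tr_Tzsym trmx1.
  by rewrite -trmx_mul uG trmx0.
by rewrite /sqn -[X in dot X](scale0r (0 : 'cV[R]_n)) dotZl mul0r.
Qed.

Lemma resolvent_contraction n (u : 'cV[R]_n) : sqn (resolvent n *m u) <= sqn u.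
Proof.
apply: le_trans (sqn_shift _) _.
by rewrite mulmxA mulmxV ?unit_shift// mul1mx.
Qed.

Lemma nice_resolvent : nice (fun x => (1 + b * f x)^-1).
Proof.
split.
  (* Inversion agrees with the real power of exponent -1 on nonnegative reals, and real powers are
     measurable. *)
  apply: (@eq_measurable_fun _ _ _ _ _ ((@powR R ^~ (-1)) \o (fun x => 1 + b * f x))).
    by move=> x /[!inE] /f0 fx; rewrite /= powR_inv1// addr_ge0// mulr_ge0// ltW.
  apply: measurableT_comp; first exact: (measurable_powR (-1)).
  by apply: measurable_funD => //; apply: measurable_funM => //; case: nf.
exists 1 => x /f0 fx; have h : 0 <= b * f x by rewrite mulr_ge0// ltW.
by rewrite ger0_norm ?invr_ge0 ?addr_ge0// invf_le1 ?lerDl// ltr_pwDl.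
Qed.

(** With M the resolvent and r = 1 / (1 + b f), M e - r e = - r b M (T e - f e). Since 0 <= r <= 1
    and M is a contraction, the defect of T is multiplied by at most b^2. *)
Lemma resolvent_symbol C :
  (forall x y, circ x -> circ y -> `|f x - f y| <= C * `|sin ((x - y) / 2)|) ->
  has_symbol resolvent (fun x => (1 + b * f x)^-1).
Proof.
move=> fC; have hT := has_symbol_Tz nf fN fC.
apply: (@has_symbol_le _ _ (fun n => b ^+ 2 * defect (Tz n f) f)); last first.
  by rewrite -[X in _ --> X](mulr0 (b ^+ 2)); apply: cvgMr.
move=> n _; have nd := nice_sqn_defect (Tz n f) nf.
apply: (@le_defect _ _ _ _ (fun x => b ^+ 2 * sqn (Tz n f *m cas n x - f x *: cas n x))).
- exact: nice_resolvent.
- exact: niceZ.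
- move=> x /f0 fx; set r := (1 + b * f x)^-1; set v := cas n x.
  have h : 0 <= b * f x by rewrite mulr_ge0// ltW.
  have r1 : r <= 1 by rewrite invf_le1 ?lerDl// ltr_pwDl.
  have r0 : 0 <= r by rewrite invr_ge0 addr_ge0.
  have bMT : b *: (resolvent n *m (Tz n f *m v)) = v - resolvent n *m v.
    have : resolvent n *m ((1%:M + b *: Tz n f) *m v) = v.
      by rewrite mulmxA mulVmx ?unit_shift// mul1mx.
    rewrite mulmxDl mulmxDr mul1mx -scalemxAl -scalemxAr => e.
    by apply/eqP; rewrite eq_sym subr_eq addrC e.
  have -> : resolvent n *m v - r *: v = - r *: (b *: (resolvent n *m (Tz n f *m v - f x *: v))).
    rewrite mulmxBr scalerBr bMT -scalemxAr scalerA.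
    move: (resolvent n *m v) (v) => w v'.
    apply/matrixP => i j; rewrite !mxE /r; field.
    by rewrite lt0r_neq0// ltr_pwDl.
  rewrite !sqnZ sqrrN; apply: (@le_trans _ _ (b ^+ 2 * sqn (resolvent n *m (Tz n f *m v - f x *: v)))).
    by rewrite ler_piMl ?expr_le1// mulr_ge0 ?sqr_ge0 ?sqn_ge0.
  by rewrite ler_wpM2l ?sqr_ge0//; exact: resolvent_contraction.
- by rewrite meanZ// mulrCA.
Qed.

End Resolvent.

(** The error is the normalized mean of cas . (X cas - xi cas). Young's inequality, weighted by the
    tolerance, balances |cas|^2, of normalized mean one, against a defect below the squared
    tolerance. *)
Lemma tr_symbol (X : forall n, 'M[R]_n) xi : nice xi -> (forall x, xi (- x) = xi x) ->
  has_symbol X xi -> (fun n => n%:R^-1 * \tr (X n)) @ \oo --> mean xi.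
Proof.
move=> nxi xiN hX; apply/cvgrPdist_lt => e e0.
move/cvgrPdist_lt : hX => /(_ (e ^+ 2)); rewrite exprn_gt0// => /(_ isT) hX.
near=> n.
have n0 : (0 < n)%N by near: n; exists 1%N.
have n0' : 0 < n%:R :> R by rewrite ltr0n.
have : `|0 - defect (X n) xi| < e ^+ 2 by near: n; exact: hX.
rewrite sub0r normrN ger0_norm ?defect_ge0// => de.
have nd := nice_sqn_defect (X n) nxi.
have ndot : nice (fun x => dot (cas n x) (X n *m cas n x - xi x *: cas n x)).
  by apply: nice_dot => i; [exact: nice_cas|exact: nice_defect].
have E : mean xi - n%:R^-1 * \tr (X n) =
  - (n%:R^-1 * mean (fun x => dot (cas n x) (X n *m cas n x - xi x *: cas n x))).
  have -> : mean (fun x => dot (cas n x) (X n *m cas n x - xi x *: cas n x)) =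
    mean (fun x => dot (cas n x) (X n *m cas n x) - xi x * dot (cas n x) (1%:M *m cas n x)).
    by apply: eq_mean => x _; rewrite -scaleNr dotDr dotZr mulNr mul1mx.
  rewrite meanB; last 2 first.
  - by apply: nice_dot => i; [exact: nice_cas|exact: nice_mulcas].
  - by apply: niceM => //; apply: nice_dot => i; [exact: nice_cas|exact: nice_mulcas].
  rewrite mean_dot_cas1 mean_dot_cas// mulmx1 tr_Tz; field; exact: lt0r_neq0.
rewrite E normrN normrM (ger0_norm (_ : 0 <= n%:R^-1)) ?invr_ge0//.
apply: (@le_lt_trans _ _ ((e + e^-1 * defect (X n) xi) / 2)); last first.
  rewrite ltr_pdivrMr//.
  have : e^-1 * defect (X n) xi < e^-1 * e ^+ 2 by rewrite ltr_pM2l ?invr_gt0.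
  have -> : e^-1 * e ^+ 2 = e by field; exact: lt0r_neq0.
  lra.
have hm : forall x, `|dot (cas n x) (X n *m cas n x - xi x *: cas n x)| <=
   e / 2 * sqn (cas n x) + e^-1 / 2 * sqn (X n *m cas n x - xi x *: cas n x).
  by move=> x; apply: le_trans (dot_young _ _ e0) _; rewrite le_eqVlt; apply/orP; left; apply/eqP; ring.
have nh : nice (fun x => e / 2 * sqn (cas n x) +
     e^-1 / 2 * sqn (X n *m cas n x - xi x *: cas n x)).
  by apply: niceD; apply: niceZ => //; exact: nice_sqn_cas.
have mh : mean (fun x => e / 2 * sqn (cas n x) +
     e^-1 / 2 * sqn (X n *m cas n x - xi x *: cas n x)) =
   n%:R * ((e + e^-1 * defect (X n) xi) / 2).
  rewrite meanD ?meanZ ?mean_sqn_cas /defect//; try exact: nice_sqn_cas.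
  - by field; rewrite !lt0r_neq0.
  - by apply: niceZ; exact: nice_sqn_cas.
  - exact: niceZ.
rewrite mulrC ler_pdivrMr// mulrC -mh ler_norml; apply/andP; split.
  rewrite lerNl -mulN1r -meanZ//; apply: le_mean => //; first exact: niceZ.
  by move=> x _; have := hm x; rewrite ler_norml mulN1r lerNl => /andP[].
by apply: le_mean => // x _; have := hm x; rewrite ler_norml => /andP[].
Unshelve. all: by end_near. Qed.

(** The sum of squares is the mean of |X cas|^2, and X cas differs from xi cas by an error whose
    mean square is eventually below n. *)
Lemma frobenius_symbol (X : forall n, 'M[R]_n) xi : nice xi -> has_symbol X xi ->
  exists C, \forall n \near \oo, \sum_i \sum_j X n i j ^+ 2 <= C * n%:R.
Proof.
move=> nxi hX; have [_ [E hE]] := nxi.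
exists (2 + 2 * E ^+ 2).
move/cvgrPdist_lt : hX => /(_ 1 ltr01) hX.
near=> n.
have n0 : (0 < n)%N by near: n; exists 1%N.
have n0' : 0 < n%:R :> R by rewrite ltr0n.
have : `|0 - defect (X n) xi| < 1 by near: n; exact: hX.
rewrite sub0r normrN ger0_norm ?defect_ge0// => de.
have nd := nice_sqn_defect (X n) nxi.
rewrite -mean_sqn_mulcas.
apply: (@le_trans _ _ (mean (fun x =>
   2 * sqn (X n *m cas n x - xi x *: cas n x) + 2 * E ^+ 2 * sqn (cas n x)))).
  apply: le_mean.
  - exact: nice_sqn_mulcas.
  - by apply: niceD; apply: niceZ => //; exact: nice_sqn_cas.
  - move=> x cx; rewrite -{1}(subrK (xi x *: cas n x) (X n *m cas n x)).
    apply: le_trans (sqnD_le _ _) _; rewrite lerD2l sqnZ -mulrA ler_pM2l//.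
    rewrite ler_wpM2r ?sqn_ge0// -(real_normK (num_real (xi x))).
    by rewrite lerXn2r ?nnegrE ?hE// (le_trans _ (hE _ cx)).
rewrite meanD ?meanZ ?mean_sqn_cas//; try exact: nice_sqn_cas.
- have : mean (fun x => sqn (X n *m cas n x - xi x *: cas n x)) = n%:R * defect (X n) xi.
    by rewrite /defect; field; exact: lt0r_neq0.
  move=> ->; have : n%:R * defect (X n) xi <= n%:R * 1 by rewrite ler_pM2l// ltW.
  by lra.
- exact: niceZ.
- by apply: niceZ; exact: nice_sqn_cas.
Unshelve. all: by end_near. Qed.

End SymbolCalculus.

(** * Moments of Gaussian quadratic forms *)

Section NormalMoments.
Variable R : realType.
Notation mu := (@lebesgue_measure R).

Lemma ge0_integral_normal_prob (s : R) (f : R -> \bar R) : s != 0 ->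
  (forall x, 0 <= f x)%E -> measurable_fun setT f ->
  (\int[normal_prob 0 s]_x f x = \int[mu]_x (f x * (normal_pdf 0 s x)%:E))%E.
Proof.
move=> s0 f0 mf; have dom := @normal_prob_dominates R 0 s.
rewrite -(Radon_Nikodym_SigmaFinite.change_of_variables dom)//.
have nuf := Radon_Nikodym_SigmaFinite.f_integrable dom.
apply: ae_eq_integral => //.
- by apply: emeasurable_funM => //; exact: (measurable_int mu nuf).
- apply: emeasurable_funM => //; apply/measurable_EFinP.
  exact: measurable_normal_pdf.
- apply: ae_eqe_mul2l; apply: integral_ae_eq => //.
  + by apply/measurable_EFinP; exact: measurable_normal_pdf.
  + by move=> E _ mE; rewrite -Radon_Nikodym_SigmaFinite.f_integral.
Qed.

Variable s : R.
Hypothesis s0 : 0 < s.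
Let p := normal_pdf 0 s.

Let pE x : p x = normal_peak s * expR (- (x ^+ 2 / (s ^+ 2 *+ 2))).
Proof.
by rewrite /p normal_pdfE ?lt0r_neq0// /normal_fun subr0 mulNr.
Qed.

Let pN x : p (- x) = p x. Proof. by rewrite !pE sqrrN. Qed.

Let p0 x : 0 <= p x. Proof. exact: normal_pdf_ge0. Qed.

Let cp : continuous p. Proof. by apply: continuous_normal_pdf; rewrite lt0r_neq0. Qed.

Let cxp k : continuous (fun x : R => x ^+ k * p x).
Proof. by move=> x; apply: cvgM; [exact: exprn_continuous|exact: cp]. Qed.

(** Integration by parts in differential form, from p'(x) = - x p(x) / s^2. *)
Lemma is_derive_normal_pdf k (x : R) :
  is_derive x (1 : R) (fun x => - s ^+ 2 * (x ^+ k.+1 * p x))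
    (x ^+ k.+2 * p x - s ^+ 2 * k.+1%:R * (x ^+ k * p x)).
Proof.
have dp : is_derive x (1 : R) p (p x * (- (x / s ^+ 2))).
  have dE : is_derive x (1 : R) (fun x : R => - (x ^+ 2 / (s ^+ 2 *+ 2))) (- (x / s ^+ 2)).
    apply: is_derive_eq; rewrite /GRing.scale/=.
    by field; exact: lt0r_neq0.
  have := @is_derive1_comp R (@expR R) (fun x : R => - (x ^+ 2 / (s ^+ 2 *+ 2))) x _ _
    (is_derive_expR _) dE.
  move=> /(is_deriveZ (normal_peak s)) h.
  rewrite (_ : p = normal_peak s \*: (@expR R \o fun x : R => - (x ^+ 2 / (s ^+ 2 *+ 2)))); last first.
    by apply/funext => y; rewrite pE.
  by apply: is_derive_eq; rewrite /GRing.scale/= mulrA.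
have dk : is_derive x (1 : R) (fun x : R => x ^+ k.+1) (k.+1%:R * x ^+ k).
  have -> : (fun x : R => x ^+ k.+1) = (@id R) ^+ k.+1.
    by apply/funext => y; rewrite exprfctE.
  by apply: is_derive_eq; rewrite /GRing.scale/= ?mulr1 ?mulr_natl.
have := is_deriveZ (- s ^+ 2) (is_deriveM dk dp).
rewrite (_ : _ \*: _ = fun x : R => - s ^+ 2 * (x ^+ k.+1 * p x))//.
move=> h; apply: is_derive_eq; rewrite /GRing.scale/= -natr1 !exprS.
by field; exact: lt0r_neq0.
Qed.

(** Moments truncated to a compact interval, where the fundamental theorem of calculus applies; the
    boundary terms vanish in the limit. *)
Definition Jn k (n : nat) := Rintegral mu `[- n%:R, n%:R] (fun x => x ^+ k * p x).

Let int_xp k (a b : R) : mu.-integrable `[a, b] (EFin \o (fun x => x ^+ k * p x)).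
Proof.
apply: continuous_compact_integrable; first exact: segment_compact.
exact: continuous_subspaceT.
Qed.

Lemma Jn_rec k n : (0 < n)%N ->
  Jn k.+2 n = s ^+ 2 * k.+1%:R * Jn k n - s ^+ 2 * ((1 + (-1) ^+ k) * (n%:R ^+ k.+1 * p n%:R)).
Proof.
move=> n0; have nn : - n%:R < n%:R :> R by rewrite gtrN// ltr0n.
have := FTC_Rintegral nn _ (is_derive_normal_pdf k).
have cc : continuous (fun x : R => x ^+ k.+2 * p x - s ^+ 2 * k.+1%:R * (x ^+ k * p x)).
  by move=> x; apply: cvgB; [exact: cxp|apply: cvgMr; exact: cxp].
have i1 := int_xp k (- n%:R) n%:R; have i2 := int_xp k.+2 (- n%:R) n%:R.
have i3 : mu.-integrable `[- n%:R, n%:R]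
    (EFin \o (fun x : R => s ^+ 2 * k.+1%:R * (x ^+ k * p x))).
  rewrite (_ : EFin \o _ = (fun x : R => (s ^+ 2 * k.+1%:R)%:E *
      (EFin \o (fun x : R => (x ^+ k * p x)%R)) x)%E).
    exact: integrableZl.
  by apply/funext => x /=; rewrite EFinM.
move=> /(_ cc); rewrite RintegralB//.
rewrite RintegralZl//.
rewrite -/(Jn k n) -/(Jn k.+2 n) pN (exprNn n%:R) => h.
have -> : Jn k.+2 n = (Jn k.+2 n - s ^+ 2 * k.+1%:R * Jn k n) + s ^+ 2 * k.+1%:R * Jn k n.
  by rewrite subrK.
by rewrite h (exprS (-1) k); ring.
Qed.

Lemma cvg_integral_itv (f : R -> R) : (forall x, 0 <= f x) -> measurable_fun setT f ->
  (forall n : nat, mu.-integrable `[- n%:R, n%:R] (EFin \o f)) ->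
  (Rintegral mu `[- n%:R, n%:R] f)%:E @[n --> \oo] --> (\int[mu]_x (f x)%:E)%E.
Proof.
move=> f0 mf intf.
have := @ge0_nondecreasing_set_cvg_integral _ (measurableTypeR R) R
  (fun n : nat => `[- n%:R, n%:R]%classic : set R) (EFin \o f) mu.
have -> : \bigcup_n (`[- n%:R, n%:R]%classic : set R) = setT.
  rewrite -subTset => x _; exists (Num.bound `|x|) => //=.
  by rewrite in_itv/= -ler_norml ltW// archi_boundP.
have H1 : {homo (fun n : nat => `[- n%:R, n%:R]%classic : set R) :
    n m / (n <= m)%N >-> (n <= m)%O}.
  move=> n m nm; rewrite subsetEset; apply: subset_itv; rewrite bnd_simp.
    by rewrite lerN2 ler_nat.
  by rewrite ler_nat.
move=> /(_ H1 (fun=> measurable_itv _)).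
have H3 (i : nat) : measurable_fun (`[- i%:R, i%:R]%classic : set R) (EFin \o f).
  by apply: measurable_funTS; exact/measurable_EFinP.
move=> /(_ H3 (fun i x _ => f0 x)).
apply: cvg_trans; apply: near_eq_cvg; apply: nearW => n.
by rewrite /Rintegral fineK//; exact: integrable_fin_num.
Qed.

Lemma cvg_Jn k l : ~~ odd k -> Jn k n @[n --> \oo] --> l ->
  (\int[mu]_x ((x ^+ k)%:E * (p x)%:E) = l%:E)%E.
Proof.
move=> ek Jl.
have xp0 x : 0 <= x ^+ k * p x by rewrite mulr_ge0// exprn_even_ge0.
have mxp : measurable_fun setT (fun x : R => x ^+ k * p x).
  by apply: continuous_measurable_fun; exact: cxp.
have /cvg_lim h := cvg_integral_itv xp0 mxp (fun n => @int_xp k _ _).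
under eq_integral do rewrite -EFinM.
rewrite -h//; apply/cvg_lim => //.
exact: (cvg_comp _ _ Jl).
Qed.

Lemma normal_pdf_tail j : (j <= 3)%N -> n%:R ^+ j * p n%:R @[n --> \oo] --> 0.
Proof.
(* The 48 comes from exp y >= y^3 / 6 at y = n^2 / (2 s^2), where y^3 / 6 = n^6 / (48 s^6). *)
move=> j3; pose C := normal_peak s * (48%:R * s ^+ 6).
apply: (@squeeze_cvgr _ _ _ _ (cst 0) (fun n => C * n%:R^-1)); last 2 first.
- exact: cvg_cst.
- rewrite -[X in _ --> X](mulr0 C); apply: cvgMr.
  apply/gtr0_cvgV0; last exact: cvgr_idn.
  by near=> n; rewrite ltr0n; near: n; exists 1%N.
near=> n.
have n1 : (0 < n)%N by near: n; exists 1%N.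
have n0 : 0 < n%:R :> R by rewrite ltr0n.
rewrite mulr_ge0//= pE expRN mulrCA /C -mulrA ler_wpM2l//.
  by rewrite ltW// normal_peak_gt0// lt0r_neq0.
set y := n%:R ^+ 2 / (s ^+ 2 *+ 2).
have y0 : 0 < y by apply: divr_gt0; [exact: exprn_gt0|rewrite mulrn_wgt0// exprn_gt0].
have ey : y ^+ 3 / 6%:R <= expR y.
  by apply: le_trans (expR_ge1Dxn 2 (ltW y0)); rewrite lerDr.
rewrite ler_pdivrMr ?expR_gt0//.
apply: (@le_trans _ _ (48%:R * s ^+ 6 * n%:R^-1 * (y ^+ 3 / 6%:R))); last first.
  by rewrite ler_wpM2l// !mulr_ge0 ?invr_ge0 ?exprn_ge0 ?(ltW s0) ?(ltW n0).
have -> : 48%:R * s ^+ 6 * n%:R^-1 * (y ^+ 3 / 6%:R) = n%:R ^+ 5.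
  by rewrite /y; field; rewrite !lt0r_neq0.
by rewrite ler_weXn2l ?ler1n// (leq_trans j3).
Unshelve. all: by end_near. Qed.

Lemma cvg_Jn0 : Jn 0 n @[n --> \oo] --> (1 : R).
Proof.
have mp : measurable_fun setT (fun x : R => x ^+ 0 * p x).
  by apply: continuous_measurable_fun; exact: cxp.
have xp0 x : 0 <= x ^+ 0 * p x by rewrite expr0 mul1r.
have := cvg_integral_itv xp0 mp (fun n => @int_xp 0 _ _).
under eq_integral do rewrite expr0 mul1r.
by rewrite integral_normal_pdf => /fine_cvg.
Qed.

Lemma cvg_Jn_rec k l : (k <= 2)%N -> Jn k n @[n --> \oo] --> l ->
  Jn k.+2 n @[n --> \oo] --> s ^+ 2 * k.+1%:R * l.
Proof.
move=> k2 Jl.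
have : s ^+ 2 * k.+1%:R * Jn k n - s ^+ 2 * ((1 + (-1) ^+ k) * (n%:R ^+ k.+1 * p n%:R)) @[n --> \oo]
  --> s ^+ 2 * k.+1%:R * l - s ^+ 2 * ((1 + (-1) ^+ k) * 0).
  apply: cvgB; first exact: cvgMr.
  by apply: cvgMr; apply: cvgMr; exact: normal_pdf_tail.
rewrite !mulr0 subr0; apply: cvg_trans; apply: near_eq_cvg.
by near=> n; rewrite Jn_rec//; near: n; exists 1%N.
Unshelve. all: by end_near. Qed.

Lemma normal_moment2 : (\int[mu]_x ((x ^+ 2)%:E * (p x)%:E) = (s ^+ 2)%:E)%E.
Proof.
by apply: cvg_Jn => //; have := cvg_Jn_rec (isT : (0 <= 2)%N) cvg_Jn0; rewrite !mulr1.
Qed.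

Lemma normal_moment4 : (\int[mu]_x ((x ^+ 4)%:E * (p x)%:E) = (3 * (s ^+ 2) ^+ 2)%:E)%E.
Proof.
apply: cvg_Jn => //; have := cvg_Jn_rec (isT : (0 <= 2)%N) cvg_Jn0.
move=> /(cvg_Jn_rec (isT : (2 <= 2)%N)); rewrite !mulr1.
by have -> : s ^+ 2 * 3%:R * s ^+ 2 = 3 * (s ^+ 2) ^+ 2 by ring.
Qed.

(** The reflection x -> - x preserves the density and exchanges the two parts. *)
Lemma normal_odd_funepos k : odd k ->
  (\int[mu]_x ((fun x => (x ^+ k)%:E)^\+ x * (p x)%:E) =
   \int[mu]_x ((fun x => (x ^+ k)%:E)^\- x * (p x)%:E))%E.
Proof.
move=> ok; have n10 : (-1 : R) != 0 by rewrite oppr_eq0 oner_neq0.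
have mx : measurable_fun setT (fun x : R => (x ^+ k)%:E).
  by apply/measurable_EFinP; exact: exprn_measurable.
have := @ge0_integral_affine R (-1) 0 setT (fun x : R => (fun x : R => (x ^+ k)%:E)^\+ x * (p x)%:E)%E n10 measurableT.
rewrite normrN normr1 invr1 mul1e preimage_setT => <-.
- apply: eq_integral => x _; rewrite mulN1r addr0 pN; congr (_ * _)%E.
  by rewrite funeposE funenegE -EFinN exprNn -signr_odd ok expr1 mulN1r.
- apply: emeasurable_funM; first exact: measurable_funepos.
  by apply/measurable_EFinP; exact: measurable_normal_pdf.
- by move=> x _; rewrite mule_ge0// lee_fin.
Qed.

End NormalMoments.

(** * Moments read off from a centered normal law *)

Section CenteredNormal.
Variable R : realType.
Notation mu := (@lebesgue_measure R).
Context {d : measure_display} {T : measurableType d} (P : probability T R).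
Implicit Types X Y : T -> R.

Definition expect X : R := Rintegral P setT X.

Lemma ge0_integral_normal_law X (s : R) (f : R -> \bar R) : s != 0 ->
  measurable_fun setT X ->
  (forall A : set R, measurable A -> P (X @^-1` A) = normal_prob 0 s A) ->
  (forall x, 0 <= f x)%E -> measurable_fun setT f ->
  (\int[P]_w f (X w) = \int[mu]_x (f x * (normal_pdf 0 s x)%:E))%E.
Proof.
move=> s0 mX lawX f0 mf; rewrite -ge0_integral_normal_prob//.
have f0' : {in [set: R], forall y, (0 <= f y)%E} by [].
have := @ge0_integral_pushforward _ _ T (measurableTypeR R) R X mX P setT f measurableT mf f0'.
rewrite preimage_setT => <-.
by apply: eq_measure_integral => A mA _; exact: lawX.
Qed.

Lemma pow_le_pow4 (x : R) k : (k <= 4)%N -> `|x| ^+ k <= 1 + x ^+ 4.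
Proof.
move=> k4; have x4 : 0 <= x ^+ 4 by rewrite exprn_even_ge0.
have x4E : x ^+ 4 = `|x| ^+ 4 by rewrite -normrX ger0_norm.
have [x1|x1] := leP `|x| 1.
  by apply: (@le_trans _ _ 1); [exact: exprn_ile1|rewrite lerDl].
by rewrite x4E; apply: ler_wpDl => //; rewrite ler_weXn2l// ltW.
Qed.

Lemma integrable_le (f g : T -> R) : measurable_fun setT f ->
  (forall w, `|f w| <= g w) -> P.-integrable setT (EFin \o g) ->
  P.-integrable setT (EFin \o f).
Proof.
move=> mf fg; apply: le_integrable => //; first exact/measurable_EFinP.
by move=> w _ /=; rewrite lee_fin (le_trans (fg w))// ler_norm.
Qed.

Lemma integrable_cst (c : R) : P.-integrable setT (EFin \o cst c).
Proof. by apply: finite_measure_integrable_cst. Qed.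

Lemma integrable_pow4 X k : (k <= 4)%N -> measurable_fun setT X ->
  P.-integrable setT (EFin \o (fun w => X w ^+ 4)) ->
  P.-integrable setT (EFin \o (fun w => X w ^+ k)).
Proof.
move=> k4 mX iX; apply: (@integrable_le _ (fun w => 1 + X w ^+ 4)).
- exact: measurable_funX.
- by move=> w; rewrite normrX; exact: pow_le_pow4.
- rewrite (_ : EFin \o _ = (EFin \o cst 1%R) \+ (EFin \o (fun w => X w ^+ 4)%R))%E.
    by apply: integrableD => //; exact: integrable_cst.
  by apply/funext => w /=.
Qed.

Lemma centered_normal_moments X v : 0 <= v -> measurable_fun setT X ->
  centered_normal_law P X v ->
  P.-integrable setT (EFin \o (fun w => X w ^+ 4)) /\
  [/\ expect X = 0, expect (fun w => X w ^+ 2) = v,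
      expect (fun w => X w ^+ 3) = 0 &
      expect (fun w => X w ^+ 4) = 3 * v ^+ 2].
Proof.
move=> v0 mX; rewrite /centered_normal_law.
have mXk k : measurable_fun setT (fun w => X w ^+ k) by exact: measurable_funX.
have mEXk k : measurable_fun setT (EFin \o (fun w => X w ^+ k)).
  exact/measurable_EFinP.
have mk k : measurable_fun setT (fun x : R => (x ^+ k)%:E).
  by apply/measurable_EFinP; exact: exprn_measurable.
have int4 (c : R) : (\int[P]_w (X w ^+ 4)%:E = c%:E)%E ->
    P.-integrable setT (EFin \o (fun w => X w ^+ 4)).
  move=> h4; apply/integrableP; split=> //.
  rewrite (eq_integral (fun w => (X w ^+ 4)%:E)); first by rewrite h4 ltry.
  by move=> w _ /=; rewrite ger0_norm// exprn_even_ge0.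
move=> lawX; suff h : [/\ (\int[P]_w (X w ^+ 1)%:E = 0)%E,
     (\int[P]_w (X w ^+ 2)%:E = v%:E)%E, (\int[P]_w (X w ^+ 3)%:E = 0)%E &
     (\int[P]_w (X w ^+ 4)%:E = (3 * v ^+ 2)%:E)%E].
  case: h => h1 h2 h3 h4; split; first exact: int4 h4.
  rewrite /expect /Rintegral h2 h3 h4; split=> //.
  by under eq_integral do rewrite -[X _]expr1; rewrite h1.
(* Variance zero is encoded as X = 0 almost surely; all positive powers then have zero
   expectation. *)
move: lawX; case: eqVneq => [-> PX0|v0' lawX].
  have X0k k : (0 < k)%N -> (\int[P]_w (X w ^+ k)%:E = 0)%E.
    move=> k0; transitivity (\int[P]_w (cst 0 w))%E; last exact: integral0_eq.
    apply: ae_eq_integral; [by []|exact: mEXk|exact: measurable_cst|].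
    have mX0 : measurable [set w | X w = 0].
      rewrite (_ : [set w | X w = 0] = X @^-1` [set 0])//.
      by rewrite -[X in measurable X]setTI; exact: mX.
    have nX0 : P.-negligible (~` [set w | X w = 0]).
      exists (~` [set w | X w = 0]); split=> //; first exact: measurableC.
      by have := probability_setC P mX0; rewrite PX0 subee.
    apply: negligibleS nX0; apply: subsetC => w /= Xw _.
    by rewrite Xw expr0n gtn_eqF.
  by rewrite !X0k// expr0n mulr0; split.
have s0 : 0 < Num.sqrt v by rewrite sqrtr_gt0 lt_neqAle eq_sym v0'.
have s0' := lt0r_neq0 s0.
have vE : Num.sqrt v ^+ 2 = v by rewrite sqr_sqrtr.
have h2 := normal_moment2 s0; have h4 := normal_moment4 s0.
have i2 : (\int[P]_w (X w ^+ 2)%:E = v%:E)%E.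
  rewrite (ge0_integral_normal_law s0' mX lawX _ (mk 2%N)) ?h2 ?vE//.
  by move=> x; rewrite lee_fin exprn_even_ge0.
have i4 : (\int[P]_w (X w ^+ 4)%:E = (3 * v ^+ 2)%:E)%E.
  rewrite (ge0_integral_normal_law s0' mX lawX _ (mk 4%N)) ?h4 ?vE//.
  by move=> x; rewrite lee_fin exprn_even_ge0.
have iX4 := int4 _ i4.
(* The positive and negative parts have equal integrals; the fourth moment makes them finite, so
   that their difference is 0. *)
have odd0 k : odd k -> (k <= 4)%N -> (\int[P]_w (X w ^+ k)%:E = 0)%E.
  move=> ok k4; rewrite integralE.
  have mp : measurable_fun setT ((fun x : R => (x ^+ k)%:E)^\+)%E by exact: measurable_funepos.
  have mn : measurable_fun setT ((fun x : R => (x ^+ k)%:E)^\-)%E by exact: measurable_funeneg.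
  rewrite (eq_integral (fun w => (fun x : R => (x ^+ k)%:E)^\+ (X w))%E); last first.
    by move=> w _; rewrite !funeposE.
  rewrite [X in (_ - X)%E](eq_integral (fun w => (fun x : R => (x ^+ k)%:E)^\- (X w))%E); last first.
    by move=> w _; rewrite !funenegE.
  have -> : (\int[P]_w (fun x : R => (x ^+ k)%:E)^\+ (X w) =
             \int[P]_w (fun x : R => (x ^+ k)%:E)^\- (X w))%E.
    rewrite (ge0_integral_normal_law s0' mX lawX _ mp)//.
    by rewrite (ge0_integral_normal_law s0' mX lawX _ mn)// normal_odd_funepos.
  rewrite subee//.
  rewrite (eq_integral ((fun w => (X w ^+ k)%:E)^\-)%E); last by move=> w _; rewrite !funenegE.
  by apply: integrable_neg_fin_num => //; exact: integrable_pow4 mX iX4.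
by split=> //; exact: odd0.
Qed.

End CenteredNormal.

(** * Independence and products of expectations *)

Section Independence.
Variable R : realType.
Context {d : measure_display} {T : measurableType d} (P : probability T R).

Definition indep2 (X Y : T -> R) := forall A B : set R, measurable A -> measurable B ->
  P (X @^-1` A `&` Y @^-1` B) = (P (X @^-1` A) * P (Y @^-1` B))%E.

Lemma indep2_comp X Y (f g : R -> R) : measurable_fun setT f -> measurable_fun setT g ->
  indep2 X Y -> indep2 (f \o X) (g \o Y).
Proof.
move=> mf mg XY A B mA mB; apply: (XY (f @^-1` A) (g @^-1` B)).
  by rewrite -[X in measurable X]setTI; exact: mf.
by rewrite -[X in measurable X]setTI; exact: mg.
Qed.

(** Independence says that the joint law is the product of the marginal laws. Tonelli's theorem on
    absolute values then gives integrability, and Fubini's theorem factors the expectation. *)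
Lemma expectM (X Y : T -> R) : measurable_fun setT X -> measurable_fun setT Y ->
  indep2 X Y -> P.-integrable setT (EFin \o X) -> P.-integrable setT (EFin \o Y) ->
  P.-integrable setT (EFin \o (fun w => X w * Y w)) /\
  expect P (fun w => X w * Y w) = expect P X * expect P Y.
Proof.
move=> mX mY XY iX iY.
pose X' : {mfun T >-> R} := HB.pack X (isMeasurableFun.Build _ _ _ _ X mX).
pose Y' : {mfun T >-> R} := HB.pack Y (isMeasurableFun.Build _ _ _ _ Y mY).
have mZ : measurable_fun setT (fun w => (X w, Y w)) by exact: measurable_fun_pair.
pose Z' : {mfun T >-> (R * R)%type} :=
  HB.pack (fun w => (X w, Y w)) (isMeasurableFun.Build _ _ _ _ _ mZ).
pose m1 := distribution P X'; pose m2 := distribution P Y'; pose m' := distribution P Z'.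
have m12 S : measurable S -> (m1 \x m2)%E S = m' S.
  apply: product_measure_unique => A B mA mB.
  by rewrite /m' /m1 /m2 /distribution /pushforward/= -XY.
pose F (z : R * R) : \bar R := (z.1 * z.2)%:E.
have mF : measurable_fun setT F.
  by apply/measurable_EFinP; apply: measurable_funM; [exact: measurable_fst|exact: measurable_snd].
have mid : measurable_fun setT (fun y : R => y%:E) by apply/measurable_EFinP; exact: measurable_id.
have mabs : measurable_fun setT (fun y : R => `|y|%:E).
  by apply/measurable_EFinP; exact: normr_measurable.
have absY : (\int[m2]_y `|y|%:E = \int[P]_w `|Y w|%:E)%E.
  rewrite (@ge0_integral_distribution _ _ _ _ _ P Y' (fun y : R => `|y|%:E) mabs)//.
have absX : (\int[m1]_y `|y|%:E = \int[P]_w `|X w|%:E)%E.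
  rewrite (@ge0_integral_distribution _ _ _ _ _ P X' (fun y : R => `|y|%:E) mabs)//.
have fX : (\int[P]_w `|X w|%:E < +oo)%E by case/integrableP : iX.
have fY : (\int[P]_w `|Y w|%:E < +oo)%E by case/integrableP : iY.
have iF : (m1 \x m2)%E.-integrable setT F.
  apply/integrable12ltyP => //.
  rewrite (eq_integral (fun x : R => `|x|%:E * \int[P]_w `|Y w|%:E)%E); last first.
    move=> x _; rewrite -absY -ge0_integralZl//.
    by apply: eq_integral => y _; rewrite /F abse_EFin normrM EFinM.
  have iX0 : (0 <= \int[P]_w `|X w|%:E)%E by apply: integral_ge0.
  have iY0 : (0 <= \int[P]_w `|Y w|%:E)%E by apply: integral_ge0.
  rewrite ge0_integralZr//.
  by rewrite absX lte_mul_pinfty// ge0_fin_numE.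
have iXY : P.-integrable setT (EFin \o (fun w => X w * Y w)).
  apply/integrableP; split; first by apply/measurable_EFinP; exact: measurable_funM.
  case/integrableP : iF => _.
  rewrite (eq_measure_integral m'); last by move=> S mS _; rewrite /= m12.
  by rewrite (@ge0_integral_distribution _ _ _ _ _ P Z')//; exact: measurableT_comp.
split=> //; rewrite /expect /Rintegral.
have <- : (\int[m1 \x m2]_z F z = \int[P]_w (X w * Y w)%:E)%E.
  rewrite (eq_measure_integral m'); last by move=> S mS _; rewrite /= m12.
  by rewrite (@integral_distribution _ _ _ _ _ P Z').
rewrite -integral12_prod_meas1//.
have EY : (\int[m2]_y y%:E = \int[P]_w (Y w)%:E)%E.
  by rewrite (@integral_distribution _ _ _ _ _ P Y').
have EX : (\int[m1]_y y%:E = \int[P]_w (X w)%:E)%E.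
  by rewrite (@integral_distribution _ _ _ _ _ P X').
have iidX : m1.-integrable setT (EFin : R -> \bar R).
  by apply/integrableP; split=> //; rewrite absX.
have iidY : m2.-integrable setT (EFin : R -> \bar R).
  by apply/integrableP; split=> //; rewrite absY.
have finY : (\int[P]_w (Y w)%:E)%E \is a fin_num by exact: integrable_fin_num.
have finX : (\int[P]_w (X w)%:E)%E \is a fin_num by exact: integrable_fin_num.
rewrite (eq_integral (fun x : R => (\int[P]_w (Y w)%:E) * x%:E)%E); last first.
  move=> x _; rewrite /fubini_F /F/= -EY muleC -integralZl//.
by rewrite -(fineK finY) integralZl// EX -(fineK finX) -EFinM/= mulrC.
Qed.

(** The product formula is known on cylinders, which form a pi-system. Uniqueness of measures
    extends it to the generated sigma-algebras, one factor at a time, and these contain the events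
    defined by linear forms. *)
Lemma cylinder_indep (n : nat) (z e : 'I_n -> T -> R) :
  (forall i, measurable_fun setT (z i)) -> (forall i, measurable_fun setT (e i)) ->
  (forall A B : 'I_n -> set R, (forall i, measurable (A i)) -> (forall i, measurable (B i)) ->
    P ([set w | forall i, A i (z i w)] `&` [set w | forall i, B i (e i w)])
    = (P [set w | forall i, A i (z i w)] * P [set w | forall i, B i (e i w)])%E) ->
  forall c c' : 'I_n -> R,
  indep2 (fun w => \sum_i c i * z i w) (fun w => \sum_i c' i * e i w).
Proof.
move=> mz me ze c c' A B mA mB.
pose G (z : 'I_n -> T -> R) : set (set T) :=
  [set S | exists2 A : 'I_n -> set R, (forall i, measurable (A i)) &
     S = [set w | forall i, A i (z i w)] ].
have cylE (x : 'I_n -> T -> R) (C : 'I_n -> set R) :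
    [set w | forall i, C i (x i w)] = \bigcap_(i in setT) (x i @^-1` C i).
  by apply/seteqP; split=> w /= h i; [move=> _|]; exact: h.
have Gm (x : 'I_n -> T -> R) : (forall i, measurable_fun setT (x i)) -> G x `<=` measurable.
  move=> mx _ [C mC ->]; rewrite cylE; apply: fin_bigcap_measurable => // i _.
  by rewrite -[X in measurable X]setTI; exact: mx.
have GT x : G x setT.
  by exists (fun=> setT) => //; apply/seteqP; split.
have GI x : setI_closed (G x).
  move=> _ _ [C mC ->] [D mD ->]; exists (fun i => C i `&` D i).
    by move=> i; exact: measurableI.
  by apply/seteqP; split=> w /= => [[h1 h2] i|h]; [split; [exact: h1|exact: h2]|split=> i; have [] := h i].
have sumG (x : 'I_n -> T -> R) (k : 'I_n -> R) (C : set R) : measurable C ->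
    <<s G x >> ((fun w => \sum_i k i * x i w) @^-1` C).
  move=> mC.
  pose T' : measurableType _ := g_sigma_algebraType (G x).
  have mx i : measurable_fun setT (x i : T' -> R).
    move=> _ D mD; rewrite setTI; apply: sub_sigma_algebra.
    exists (fun j => if j == i then D else setT).
      by move=> j; case: ifP.
    apply/seteqP; split=> w /= => [h j|/(_ i)]; last by rewrite eqxx.
    by case: eqP => // ->.
  have ms : measurable_fun setT ((fun w => \sum_i k i * x i w) : T' -> R).
    by apply: measurable_sum => i; exact: measurable_funM.
  by have := ms measurableT C mC; rewrite setTI.
have sub (x : 'I_n -> T -> R) S : (forall i, measurable_fun setT (x i)) -> <<s G x >> S -> measurable S.
  move=> mx; apply: smallest_sub; first exact: sigma_algebra_measurable.
  exact: Gm.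
have cover (x : 'I_n -> T -> R) : \bigcup_(k : nat) (setT : set T) = setT.
  by apply/seteqP; split=> // w _; exists 0%N.
(* For a fixed cylinder E, both sides are finite measures in S that agree on the cylinders of z. *)
have step1 E S : G e E -> <<s G z >> S -> P (S `&` E) = (P S * P E)%E.
  move=> GE; have mE := Gm _ me _ GE.
  have fE : 0 <= fine (P E) by rewrite fine_ge0.
  have PE : (fine (P E))%:E = P E by rewrite fineK// fin_num_measure.
  move=> sS; rewrite muleC -PE.
  apply: (g_sigma_algebra_measure_unique (G z) (Gm _ mz) (fun=> setT) (fun=> GT z) (cover z)
    (mrestr P mE) (mscale (NngNum fE) P) (GI z) _ _ S sS) => /=.
    move=> C [A' mA' ->]; case: GE => B' mB' EE.
    by rewrite /mrestr /mscale/= PE EE ze// muleC.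
  by move=> k; rewrite /mrestr setTI (le_lt_trans (probability_le1 P mE)) ?ltry.
have step2 S E : <<s G z >> S -> <<s G e >> E -> P (S `&` E) = (P S * P E)%E.
  move=> sS; have mS := sub _ _ mz sS.
  have fS : 0 <= fine (P S) by rewrite fine_ge0.
  have PS : (fine (P S))%:E = P S by rewrite fineK// fin_num_measure.
  move=> sE; rewrite setIC -PS.
  apply: (g_sigma_algebra_measure_unique (G e) (Gm _ me) (fun=> setT) (fun=> GT e) (cover e)
    (mrestr P mS) (mscale (NngNum fS) P) (GI e) _ _ E sE) => /=.
    by move=> C GC; rewrite /mrestr /mscale/= PS setIC step1.
  by move=> k; rewrite /mrestr setTI (le_lt_trans (probability_le1 P mS)) ?ltry.
by apply: step2; exact: sumG.
Qed.

End Independence.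

(** * Variance of a quadratic form *)

Section QuadraticForm.
Variable R : realType.
Context {d : measure_display} {T : measurableType d} (P : probability T R).

Lemma expect_lin (I : Type) (r : seq I) (a : I -> R) (f : I -> T -> R) :
  (forall i, P.-integrable setT (EFin \o f i)) ->
  P.-integrable setT (EFin \o (fun w => \sum_(i <- r) a i * f i w)) /\
  expect P (fun w => \sum_(i <- r) a i * f i w) = \sum_(i <- r) a i * expect P (f i).
Proof.
move=> If; elim: r => [|i r [IH1 IH2]].
  under eq_fun do rewrite big_nil; rewrite big_nil; split.
    exact: (integrable_cst P 0).
  by rewrite /expect (Rintegral_cst P measurableT 0) mul0r.
have iZ : P.-integrable setT (EFin \o (fun w => a i * f i w)).
  rewrite (_ : EFin \o _ = (fun w => (a i)%:E * (EFin \o f i) w)%E).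
    exact: integrableZl.
  by apply/funext => w /=; rewrite EFinM.
under eq_fun do rewrite big_cons; rewrite big_cons; split.
  rewrite (_ : EFin \o _ = ((EFin \o (fun w => (a i * f i w)%R)) \+
    (EFin \o (fun w => \sum_(i <- r) a i * f i w)%R))%E).
    exact: integrableD.
  by apply/funext => w /=; rewrite EFinD.
by rewrite -IH2 /expect RintegralD// RintegralZl.
Qed.

Variables (n : nat) (y : 'I_n -> T -> R) (S : 'M[R]_n).
Hypothesis my : forall i, measurable_fun setT (y i).
Let q (c : 'I_n -> R) := \sum_i \sum_j c i * c j * S i j.
Let L (c : 'I_n -> R) w := \sum_i c i * y i w.
Hypothesis iL : forall c, P.-integrable setT (EFin \o (fun w => L c w ^+ 4)).
Hypothesis L2 : forall c, expect P (fun w => L c w ^+ 2) = q c.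
Hypothesis L4 : forall c, expect P (fun w => L c w ^+ 4) = 3 * q c ^+ 2.
Hypothesis Ssym : forall i j, S i j = S j i.

(** Coefficients of y_i + t1 y_j + t2 y_k + t3 y_l. Written as a sum of indicators, they stay
    correct when indices coincide. *)
Let unit4 (i j k l : 'I_n) (t : R * R * R) (m : 'I_n) : R :=
  (m == i)%:R + t.1.1 * (m == j)%:R + t.1.2 * (m == k)%:R + t.2 * (m == l)%:R.

Let sum_delta (f : 'I_n -> R) i : \sum_m (m == i)%:R * f m = f i.
Proof.
rewrite (bigD1 i)//= eqxx mul1r big1 ?addr0// => j /negbTE ->.
by rewrite mul0r.
Qed.

Let sum_unit4 (f : 'I_n -> R) i j k l t :
  \sum_m unit4 i j k l t m * f m = f i + t.1.1 * f j + t.1.2 * f k + t.2 * f l.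
Proof.
rewrite -(sum_delta f i) -(sum_delta f j) -(sum_delta f k) -(sum_delta f l).
rewrite !mulr_sumr -!big_split/=; apply: eq_bigr => m _.
by rewrite /unit4; ring.
Qed.

Let q_unit4 i j k l t : q (unit4 i j k l t) =
  S i i + t.1.1 ^+ 2 * S j j + t.1.2 ^+ 2 * S k k + t.2 ^+ 2 * S l l +
  2 * (t.1.1 * S i j + t.1.2 * S i k + t.2 * S i l +
       t.1.1 * t.1.2 * S j k + t.1.1 * t.2 * S j l + t.1.2 * t.2 * S k l).
Proof.
rewrite /q.
transitivity (\sum_a unit4 i j k l t a * (\sum_b unit4 i j k l t b * S a b)).
  by apply: eq_bigr => a _; rewrite mulr_sumr; apply: eq_bigr => b _; rewrite mulrA.
under eq_bigr do rewrite sum_unit4.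
rewrite sum_unit4 (Ssym j i) (Ssym k i) (Ssym l i) (Ssym k j) (Ssym l j) (Ssym l k).
ring.
Qed.

Let signs : seq (R * R * R) := [:: (1, 1, 1); (1, 1, -1); (1, -1, 1); (1, -1, -1);
  (-1, 1, 1); (-1, 1, -1); (-1, -1, 1); (-1, -1, -1)].

(* polarization: 192 a b c d = \sum e2 e3 e4 (a + e2 b + e3 c + e4 d)^4 over signs e2, e3, e4 *)
Lemma isserlis i j k l :
  P.-integrable setT (EFin \o (fun w => y i w * y j w * (y k w * y l w))) /\
  expect P (fun w => y i w * y j w * (y k w * y l w)) =
    S i j * S k l + S i k * S j l + S i l * S j k.
Proof.
have E : (fun w => y i w * y j w * (y k w * y l w)) =
   (fun w => \sum_(t <- signs) (192%:R^-1 * (t.1.1 * t.1.2 * t.2)) *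
               (L (unit4 i j k l t) w) ^+ 4).
  apply/funext => w; rewrite /L; under eq_bigr do rewrite sum_unit4.
  by rewrite /signs !big_cons big_nil/=; field.
rewrite E; have [h1 h2] := expect_lin signs (fun t => 192%:R^-1 * (t.1.1 * t.1.2 * t.2))
  (fun t => iL (unit4 i j k l t)).
split=> //; rewrite h2; under eq_bigr do rewrite L4 q_unit4.
by rewrite /signs !big_cons big_nil/=; field.
Qed.

Let pairsigns : seq R := [:: 1; -1].

(** 4 a b = (a + b)^2 - (a - b)^2; the last two slots of [unit4] are filled with coefficient
    zero. *)
Lemma second_moment i j :
  P.-integrable setT (EFin \o (fun w => y i w * y j w)) /\
  expect P (fun w => y i w * y j w) = S i j.
Proof.
have E : (fun w => y i w * y j w) = (fun w => \sum_(t <- pairsigns) (4%:R^-1 * t) *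
               (L (unit4 i j i i (t, 0, 0)) w) ^+ 2).
  apply/funext => w; rewrite /L; under eq_bigr do rewrite sum_unit4.
  by rewrite /pairsigns !big_cons big_nil/=; field.
have mL c : measurable_fun setT (L c).
  by apply: measurable_sum => m; exact: measurable_funM.
rewrite E; have [h1 h2] := expect_lin pairsigns (fun t => 4%:R^-1 * t)
  (fun t => integrable_pow4 (isT : (2 <= 4)%N) (mL _) (iL (unit4 i j i i (t, 0, 0)))).
split=> //; rewrite h2; under eq_bigr do rewrite L2 q_unit4.
by rewrite /pairsigns !big_cons big_nil/=; field.
Qed.

Variable B : 'M[R]_n.
Hypothesis Bsym : forall i j, B i j = B j i.
Definition quad w := \sum_(p : 'I_n * 'I_n) B p.1 p.2 * (y p.1 w * y p.2 w).

Lemma measurable_quad : measurable_fun setT quad.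
Proof.
apply: measurable_sum => p; apply: measurable_funM => //.
exact: measurable_funM.
Qed.

(** Of the three Isserlis pairings, the one within each copy of the form gives the squared mean; the
    two across the copies give one trace each, by symmetry of B and S. *)
Lemma quad_variance : P.-integrable setT (EFin \o (fun w => (quad w - \tr (B *m S)) ^+ 2)) /\
  expect P (fun w => (quad w - \tr (B *m S)) ^+ 2) = 2 * \tr (B *m S *m (B *m S)).
Proof.
set m := \tr (B *m S).
have mE : m = \sum_(p : 'I_n * 'I_n) B p.1 p.2 * S p.1 p.2.
  rewrite -(pair_bigA _ (fun i j => B i j * S i j))/= /m /mxtrace.
  by apply: eq_bigr => i _; rewrite mxE; apply: eq_bigr => j _; rewrite (Ssym j).
have [i2 e2] := expect_lin (index_enum _) (fun p : 'I_n * 'I_n => B p.1 p.2)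
  (fun p => (second_moment p.1 p.2).1).
have [i4 e4] := expect_lin (index_enum _)
  (fun p : ('I_n * 'I_n) * ('I_n * 'I_n) => B p.1.1 p.1.2 * B p.2.1 p.2.2)
  (fun p => (isserlis p.1.1 p.1.2 p.2.1 p.2.2).1).
(* The expansion Q^2 - 2 m Q + m^2 is indexed by 0, 1, 2 so that [expect_lin] handles it as one
   linear combination. *)
pose coef (t : nat) := if t == 0%N then 1 else if t == 1%N then - 2 * m else m ^+ 2.
have E : (fun w => (quad w - m) ^+ 2) = (fun w => \sum_(t <- [:: 0%N; 1%N; 2%N])
    coef t *
    (if t == 0%N then \sum_(p : ('I_n * 'I_n) * ('I_n * 'I_n)) (B p.1.1 p.1.2 * B p.2.1 p.2.2) *
        (y p.1.1 w * y p.1.2 w * (y p.2.1 w * y p.2.2 w))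
     else if t == 1%N then quad w else 1)).
  apply/funext => w; rewrite !big_cons big_nil/=.
  have -> : \sum_(p : ('I_n * 'I_n) * ('I_n * 'I_n)) (B p.1.1 p.1.2 * B p.2.1 p.2.2) *
        (y p.1.1 w * y p.1.2 w * (y p.2.1 w * y p.2.2 w)) = quad w ^+ 2.
    rewrite expr2 /quad big_distrlr/= pair_bigA/=.
    by apply: eq_bigr => p _; ring.
  rewrite /coef/=; ring.
have It (t : nat) : P.-integrable setT (EFin \o (fun w =>
    (if t == 0%N then \sum_(p : ('I_n * 'I_n) * ('I_n * 'I_n)) (B p.1.1 p.1.2 * B p.2.1 p.2.2) *
        (y p.1.1 w * y p.1.2 w * (y p.2.1 w * y p.2.2 w))
     else if t == 1%N then quad w else 1))).
  case: eqP => _ //; case: eqP => _ //; exact: (integrable_cst P 1).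
rewrite E; have [h1 h2] := expect_lin [:: 0%N; 1%N; 2%N]
   coef It.
split=> //; rewrite h2 !big_cons big_nil/= e4.
have -> : expect P quad = m.
  by rewrite e2 mE; apply: eq_bigr => p _; rewrite (second_moment p.1 p.2).2.
have -> : expect P (fun=> 1) = 1.
  by rewrite /expect (Rintegral_cst P measurableT 1) mul1r/= [X in fine X]probability_setT.
under eq_bigr do rewrite (isserlis _ _ _ _).2 !mulrDr.
rewrite !big_split/=.
have -> : \sum_(p : ('I_n * 'I_n) * ('I_n * 'I_n))
    B p.1.1 p.1.2 * B p.2.1 p.2.2 * (S p.1.1 p.1.2 * S p.2.1 p.2.2) = m * m.
  by rewrite mE big_distrlr/= pair_bigA/=; apply: eq_bigr => p _; ring.
have trE : \tr (B *m S *m (B *m S)) =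
    \sum_i \sum_j \sum_k \sum_l B i j * S j k * (B k l * S l i).
  rewrite /mxtrace; apply: eq_bigr => i _; rewrite mxE exchange_big/=.
  apply: eq_bigr => k _; rewrite !mxE mulr_suml; apply: eq_bigr => j _.
  by rewrite mulr_sumr.
have -> : \sum_(p : ('I_n * 'I_n) * ('I_n * 'I_n))
    B p.1.1 p.1.2 * B p.2.1 p.2.2 * (S p.1.1 p.2.2 * S p.1.2 p.2.1) = \tr (B *m S *m (B *m S)).
  rewrite trE pair_bigA/= -(pair_bigA _ (fun u v => B u.1 u.2 * B v.1 v.2 * (S u.1 v.2 * S u.2 v.1)))/=.
  apply: eq_bigr => u _; rewrite pair_bigA/=; apply: eq_bigr => v _.
  by rewrite (Ssym v.2); ring.
have -> : \sum_(p : ('I_n * 'I_n) * ('I_n * 'I_n))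
    B p.1.1 p.1.2 * B p.2.1 p.2.2 * (S p.1.1 p.2.1 * S p.1.2 p.2.2) = \tr (B *m S *m (B *m S)).
  rewrite trE pair_bigA/= -(pair_bigA _ (fun u v => B u.1 u.2 * B v.1 v.2 * (S u.1 v.1 * S u.2 v.2)))/=.
  apply: eq_bigr => u _; rewrite exchange_big pair_bigA/=; apply: eq_bigr => v _.
  by rewrite (Bsym v.2) (Ssym v.1); ring.
rewrite /coef/=; ring.
Qed.

Lemma quad_chebyshev (e : R) : 0 < e ->
  (P [set w | (e < `|quad w - \tr (B *m S)|)%R] <=
   (2 * \tr (B *m S *m (B *m S)) / e ^+ 2)%:E)%E.
Proof.
move=> e0; have [iV eV] := quad_variance.
set m := \tr (B *m S) in iV eV *.
have mf : measurable_fun setT (EFin \o (fun w => (quad w - m) ^+ 2)).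
  by case/integrableP : iV.
have e20 : 0 < e ^+ 2 by rewrite exprn_gt0.
have := le_integral_abse P measurableT mf e20.
have mQ := measurable_quad.
have intE : (\int[P]_w `|(EFin \o (fun w => (quad w - m) ^+ 2)%R) w| =
   (2 * \tr (B *m S *m (B *m S)))%:E)%E.
  rewrite -eV /expect /Rintegral fineK; last exact: integrable_fin_num.
  by apply: eq_integral => w _ /=; rewrite ger0_norm// sqr_ge0.
rewrite intE => h.
have mS : measurable [set w | e < `|quad w - m|].
  rewrite -[X in measurable X]setTI.
  have -> : [set w | e < `|quad w - m|] = (fun w => `|quad w - m|) @^-1` `]e, +oo[.
    by apply/seteqP; split=> w /=; rewrite in_itv/= andbT.
  have mabs : measurable_fun setT (fun w => `|quad w - m|).
    by apply: measurableT_comp => //; exact: measurable_funB.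
  exact: mabs.
rewrite EFinM -[leLHS]mul1e.
have -> : 1%E = ((e ^+ 2)%:E * (e ^- 2)%:E)%E by rewrite -EFinM mulfV// lt0r_neq0.
rewrite -muleA muleCA [leRHS]muleC lee_pmul2l// ?lte_fin ?invr_gt0//.
apply: le_trans h; rewrite lee_pmul2l// ?lte_fin//.
apply: le_measure; rewrite ?inE//.
  rewrite setTI.
  have -> : [set x | ((e ^+ 2)%:E <= `|(EFin \o (fun w => (quad w - m) ^+ 2)%R) x|)%E] =
     (fun w => (quad w - m) ^+ 2) @^-1` `[e ^+ 2, +oo[.
    by apply/seteqP; split=> w /=; rewrite in_itv/= andbT lee_fin ger0_norm// sqr_ge0.
  rewrite -[X in measurable X]setTI; move/measurable_EFinP : mf; exact.
move=> w /= ew; split=> //; rewrite lee_fin normrX.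
by rewrite lerXn2r ?nnegrE// ltW.
Qed.

End QuadraticForm.

(** * Moments of a sum of two independent normal variables *)

Section SumMoments.
Variable R : realType.
Context {d : measure_display} {T : measurableType d} (P : probability T R).

(** The law of X + Y is never identified. In the binomial expansion the odd moments vanish, and 3
    v1^2 + 6 v1 v2 + 3 v2^2 = 3 (v1 + v2)^2. *)
Lemma indep_sum_moments (X Y : T -> R) (v1 v2 : R) : 0 <= v1 -> 0 <= v2 ->
  measurable_fun setT X -> measurable_fun setT Y ->
  centered_normal_law P X v1 -> centered_normal_law P Y v2 -> indep2 P X Y ->
  [/\ P.-integrable setT (EFin \o (fun w => (X w + Y w) ^+ 4)),
      expect P (fun w => (X w + Y w) ^+ 2) = v1 + v2 &
      expect P (fun w => (X w + Y w) ^+ 4) = 3 * (v1 + v2) ^+ 2].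
Proof.
move=> v10 v20 mX mY lX lY XY.
have [iX4 [X1 X2 X3 X4]] := centered_normal_moments v10 mX lX.
have [iY4 [Y1 Y2 Y3 Y4]] := centered_normal_moments v20 mY lY.
have one : expect P (fun=> 1) = 1.
  by rewrite /expect (Rintegral_cst P measurableT 1) mul1r/= [X in fine X]probability_setT.
have EX k : (k <= 4)%N -> expect P (fun w => X w ^+ k) = [:: 1; 0; v1; 0; 3 * v1 ^+ 2]`_k.
  case: k => [_|[|[|[|[|//]]]]] //=.
have EY k : (k <= 4)%N -> expect P (fun w => Y w ^+ k) = [:: 1; 0; v2; 0; 3 * v2 ^+ 2]`_k.
  case: k => [_|[|[|[|[|//]]]]] //=.
have H (k l : nat) : (k <= 4)%N -> (l <= 4)%N ->
    P.-integrable setT (EFin \o (fun w => X w ^+ k * Y w ^+ l)) /\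
    expect P (fun w => X w ^+ k * Y w ^+ l) =
      [:: 1; 0; v1; 0; 3 * v1 ^+ 2]`_k * [:: 1; 0; v2; 0; 3 * v2 ^+ 2]`_l.
  move=> k4 l4; rewrite -EX// -EY//.
  apply: expectM.
  - exact: measurable_funX.
  - exact: measurable_funX.
  - apply: (@indep2_comp _ _ _ _ X Y (fun x => x ^+ k) (fun x => x ^+ l)) => //; exact: exprn_measurable.
  - exact: integrable_pow4 k4 mX iX4.
  - exact: integrable_pow4 l4 mY iY4.
(* [expect_lin] asks for integrability at every index, so exponents are capped at 4; the cap is
   inactive in the binomial range. *)
pose g m (t : nat) w := X w ^+ minn 4 (m - t) * Y w ^+ minn 4 t.
have ig m t : P.-integrable setT (EFin \o g m t).
  by have [] := H (minn 4 (m - t)) (minn 4 t) (geq_minl _ _) (geq_minl _ _).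
have eg m t : expect P (g m t) = [:: 1; 0; v1; 0; 3 * v1 ^+ 2]`_(minn 4 (m - t)) *
    [:: 1; 0; v2; 0; 3 * v2 ^+ 2]`_(minn 4 t).
  by have [] := H (minn 4 (m - t)) (minn 4 t) (geq_minl _ _) (geq_minl _ _).
have E m : (m <= 4)%N -> (fun w => (X w + Y w) ^+ m) =
    (fun w => \sum_(t <- index_iota 0 m.+1) 'C(m, t)%:R * g m t w).
  move=> m4; apply/funext => w; rewrite exprDn big_mkord; apply: eq_bigr => t _.
  have tm := leq_trans (ltn_ord t : (t <= m)%N) m4.
  rewrite /g (minn_idPr tm) (minn_idPr _) ?mulr_natl//.
  exact: leq_trans (leq_subr _ _) m4.
have [h2 e2] := expect_lin (index_iota 0 3) (fun t => 'C(2, t)%:R) (ig 2%N).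
have [h4 e4] := expect_lin (index_iota 0 5) (fun t => 'C(4, t)%:R) (ig 4%N).
rewrite !E// h4 e2 e4; split=> //; under eq_bigr do rewrite eg.
  by rewrite /index_iota/= !big_cons big_nil/= bin0 bin1 binn; ring.
rewrite /index_iota/= !big_cons big_nil/= bin0 bin1 binn.
have -> : 'C(4, 2) = 6%N by [].
have -> : 'C(4, 3) = 4%N by [].
ring.
Qed.

End SumMoments.

(** * The sampled spectral density *)

Section GammaPos.
Variable R : realType.
Notation mu := (@lebesgue_measure R).

Lemma FTC_Rintegral_gt0 (F f : R -> R) (a b : R) : 0 < a -> a < b ->
  (forall x : R, 0 < x -> is_derive x (1 : R) F (f x)) ->
  (forall x : R, 0 < x -> {for x, continuous f}) ->
  mu.-integrable `[a, b] (EFin \o f) /\ Rintegral mu `[a, b] f = F b - F a.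
Proof.
move=> a0 ab dF cf; have cF x : 0 < x -> {for x, continuous F}.
  move=> x0; apply/differentiable_continuous/derivable1_diffP.
  by case: (dF x x0).
have pos x : x \in `[a, b] -> 0 < x by rewrite in_itv/= => /andP[/(lt_le_trans a0)].
have wf : {within `[a, b], continuous f}.
  apply: continuous_in_subspaceT => x; rewrite inE => xab; exact/cf/pos.
split; first by apply: continuous_compact_integrable => //; exact: segment_compact.
rewrite /Rintegral (@continuous_FTC2 _ f F) ?EFinN//.
- split.
  + move=> x; rewrite in_itv/= => /andP[ax _].
    by case: (dF x (lt_trans a0 ax)).
  + by apply: cvg_at_right_filter; exact: cF.
  + by apply: cvg_at_left_filter; apply: cF; exact: lt_trans ab.
- move=> x; rewrite in_itv/= => /andP[ax _]; rewrite derive1E.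
  by case: (dF x (lt_trans a0 ax)).
Qed.

Lemma continuous_powR_gt0 (p x : R) : 0 < x -> {for x, continuous (fun t : R => powR t p)}.
Proof.
move=> x0; apply/differentiable_continuous/derivable1_diffP.
by apply: derivable_powR; rewrite in_itv/= x0.
Qed.

(** Controls the Gamma integrand at 0. The interval is exhausted by [1/(n+1), 1], away from the
    singularity, where 2 t^(1/2) is a primitive. *)
Lemma inv_sqrt_integral : (\int[mu]_(t in `]0%R, 1%R]) (powR t (- 2^-1))%:E <= 2%:E)%E.
Proof.
have mf : measurable_fun setT (fun t : R => powR t (- 2^-1)) by exact: measurable_powR.
have f0 (t : R) : 0 <= powR t (- 2^-1) by exact: powR_ge0.
have dF (x : R) : 0 < x -> is_derive x (1 : R) (fun t : R => 2 * powR t 2^-1) (powR x (- 2^-1)).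
  move=> x0; have := is_deriveZ 2 (@is_derive1_powR _ 2^-1 _ x0).
  rewrite /GRing.scale/= mulrA mulfV// mul1r.
  by have -> : 2^-1 - 1 = - 2^-1 :> R by lra.
have := @ge0_nondecreasing_set_cvg_integral _ (measurableTypeR R) R
  (fun n : nat => `[n.+1%:R^-1, 1]%classic : set R) (fun t => (powR t (- 2^-1))%:E) mu.
have -> : \bigcup_n (`[n.+1%:R^-1, 1]%classic : set R) = `]0, 1]%classic.
  apply/seteqP; split=> t /=; rewrite in_itv/=.
    by case=> n _ /=; rewrite in_itv/= => /andP[nt ->]; rewrite (lt_le_trans _ nt)// invr_gt0.
  move=> /andP[t0 t1]; exists (Num.bound t^-1) => //=; rewrite in_itv/= t1 andbT.
  rewrite invf_ple ?posrE// ltW//; apply: lt_le_trans (archi_boundP _) _.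
    by rewrite invr_ge0 ltW.
  by rewrite ler_nat.
have H1 : {homo (fun n : nat => `[n.+1%:R^-1, 1]%classic : set R) :
    n m / (n <= m)%N >-> (n <= m)%O}.
  move=> n m nm; rewrite subsetEset; apply: subset_itv; rewrite bnd_simp//.
  by rewrite lef_pV2 ?posrE// ler_nat.
move=> /(_ H1 (fun=> measurable_itv _)).
have H3 (i : nat) : measurable_fun (`[i.+1%:R^-1, 1]%classic : set R)
    (fun t : R => (powR t (- 2^-1))%:E).
  by apply: measurable_funTS; exact/measurable_EFinP.
move=> /(_ H3 (fun i x _ => f0 x)) h.
rewrite -(cvg_lim _ h)//; apply: lime_le; first by apply/cvg_ex; eexists; exact: h.
apply: nearW => n.
have [->|n0] := eqVneq n 0%N.
  by rewrite invr1 set_itv1 integral_set1.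
have n1 : n.+1%:R^-1 < 1 :> R by rewrite invf_lt1// ltr1n ltnS lt0n.
have np : 0 < n.+1%:R^-1 :> R by rewrite invr_gt0.
have [i1 i2] := FTC_Rintegral_gt0 np n1 dF (fun x x0 => continuous_powR_gt0 x0).
rewrite -[leLHS]fineK; last exact: integrable_fin_num.
rewrite lee_fin -/(Rintegral mu _ _) i2 powR1 mulr1 gerBl.
by rewrite mulr_ge0// powR_ge0.
Qed.

(** [Gamma] is the [fine] of an extended integral, which would be 0 if that integral were infinite;
    its positivity therefore rests on this. *)
Lemma Gamma_integrable (x : R) : 2^-1 <= x ->
  mu.-integrable `]0, +oo[ (EFin \o (fun t => powR t (x - 1) * expR (- t))).
Proof.
move=> x2.
have mf : measurable_fun setT (fun t : R => powR t (x - 1) * expR (- t)).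
  apply: measurable_funM; first exact: measurable_powR.
  by apply: measurableT_comp => //; exact: measurable_expR.
have f0 (t : R) : 0 <= powR t (x - 1) * expR (- t) by rewrite mulr_ge0 ?powR_ge0 ?expR_ge0.
pose N := Num.bound x.
have xN : x <= N%:R by rewrite ltW// archi_boundP// (le_trans _ x2).
(* From exp t >= t^(N+2) / (N+2)!, which leaves t^(-2) after division of t^N; the 2 comes from 1 +
   t^2 <= 2 t^2 for t >= 1. *)
pose C : R := 2 * (N.+2)`!%:R.
have C0 : 0 <= C by rewrite mulr_ge0.
have od (t : R) : 0 <= (oneDsqr t)^-1 by rewrite invr_ge0 (le_trans _ (oneDsqr_ge1 t)).
have far (t : R) : 1 <= t -> powR t (x - 1) * expR (- t) <= C * (oneDsqr t)^-1.
  move=> t1; have t0 : 0 < t by exact: lt_le_trans t1.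
  have h1 : powR t (x - 1) <= t ^+ N.
    rewrite -powR_mulrn ?(ltW t0)//; apply: ler_powR => //.
    by rewrite lerBlDr (le_trans xN)// lerDl.
  have h2 : t ^+ N.+2 / N.+2`!%:R <= expR t.
    by apply: le_trans (expR_ge1Dxn N.+1 (ltW t0)); rewrite lerDr.
  rewrite expRN ler_pdivrMr ?expR_gt0//.
  have fp : 0 < N.+2`!%:R :> R by rewrite ltr0n fact_gt0.
  have op : 0 < oneDsqr t by rewrite (lt_le_trans _ (oneDsqr_ge1 t)).
  apply: le_trans h1 _.
  apply: (@le_trans _ _ (C * (oneDsqr t)^-1 * (t ^+ N.+2 / N.+2`!%:R))); last first.
    by rewrite ler_wpM2l// mulr_ge0 ?invr_ge0 ?(ltW op)// mulr_ge0.
  have -> : C * (oneDsqr t)^-1 * (t ^+ N.+2 / N.+2`!%:R) = t ^+ N * (2 * t ^+ 2 / oneDsqr t).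
    by rewrite /C !exprS expr0; field; rewrite !lt0r_neq0.
  rewrite ler_peMr ?exprn_ge0 ?(ltW t0)// ler_pdivlMr// mul1r /oneDsqr.
  have : 1 <= t ^+ 2 by rewrite exprn_ege1.
  by lra.
have near0 (t : R) : 0 < t -> t <= 1 -> powR t (x - 1) * expR (- t) <= powR t (- 2^-1).
  move=> t0 t1; rewrite -[leRHS]mulr1 ler_pM ?powR_ge0 ?expR_ge0//.
    by apply: ger_powR; rewrite ?t0//; lra.
  by rewrite -expR0 ler_expR oppr_le0 ltW.
apply/integrableP; split; first by apply: measurable_funTS; exact/measurable_EFinP.
under eq_integral => t _ do rewrite /= ger0_norm//.
have -> : (`]0, +oo[%classic : set R) = `]0, 1]%classic `|` `]1, +oo[%classic.
  by rewrite -itv_bndbnd_setU// bnd_simp.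
have mfE : measurable_fun setT (fun t : R => (powR t (x - 1) * expR (- t))%:E).
  exact/measurable_EFinP.
rewrite ge0_integral_setU//=.
- apply: lte_add_pinfty.
    apply: le_lt_trans (le_lt_trans inv_sqrt_integral (ltry _)).
    apply: ge0_le_integral => //.
    + by move=> t _; rewrite lee_fin.
    + exact: measurable_funTS.
    + by apply: measurable_funTS; apply/measurable_EFinP; exact: measurable_powR.
    + by move=> t /=; rewrite in_itv/= => /andP[t0 t1]; rewrite lee_fin near0.
  apply: (@le_lt_trans _ _ (\int[mu]_(t in `[0%R, +oo[) (C%:E * (oneDsqr t)^-1%:E))%E).
    apply: (@le_trans _ _ (\int[mu]_(t in `]1%R, +oo[) (C%:E * (oneDsqr t)^-1%:E))%E).
      apply: ge0_le_integral => //.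
      + by move=> t _; rewrite lee_fin.
      + exact: measurable_funTS.
      + apply: measurable_funTS; apply/measurable_EFinP; apply: measurable_funM => //.
        by apply: continuous_measurable_fun; exact: continuous_oneDsqrV.
      + move=> t /=; rewrite in_itv/= andbT => t1; rewrite -EFinM lee_fin far//.
        exact: ltW.
    apply: ge0_subset_integral => //.
    + apply: measurable_funTS; apply/measurable_EFinP; apply: measurable_funM => //.
      by apply: continuous_measurable_fun; exact: continuous_oneDsqrV.
    + by move=> t _; rewrite -EFinM lee_fin mulr_ge0 ?C0 ?od.
    + by apply: subset_itvr; rewrite bnd_simp.
  rewrite ge0_integralZl//.
  + by rewrite integral0y_oneDsqr -EFinM ltry.
  + apply: measurable_funTS; apply/measurable_EFinP.
    by apply: continuous_measurable_fun; exact: continuous_oneDsqrV.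
- exact: measurable_funTS.
- by move=> t _; rewrite lee_fin.
- apply/disj_setPS => t [/=]; rewrite !in_itv/= andbT => /andP[_ t1] t2.
  by have := le_lt_trans t1 t2; rewrite ltxx.
Qed.

Lemma Gamma_gt0 (x : R) : 2^-1 <= x -> 0 < Gamma x.
Proof.
move=> x2; have iG := Gamma_integrable x2.
have f0 (t : R) : 0 <= powR t (x - 1) * expR (- t) by rewrite mulr_ge0 ?powR_ge0 ?expR_ge0.
(* A lower bound of the integrand on [1, 2], an interval of length one: t^(x-1) >= t^(-1/2) >=
   2^(-1/2) and exp (- t) >= exp (- 2). *)
pose c : R := powR 2 (- 2^-1) * expR (- 2).
have c0 : 0 < c by rewrite mulr_gt0 ?powR_gt0 ?expR_gt0.
have sub : (`[1%R, 2%R]%classic : set R) `<=` `]0, +oo[%classic.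
  by move=> t /=; rewrite !in_itv/= => /andP[t1 _]; rewrite (lt_le_trans _ t1).
have i12 : mu.-integrable (`[1%R, 2%R]%classic : set R)
    (EFin \o (fun t => powR t (x - 1) * expR (- t))).
  by apply: integrableS iG.
have mu12 : fine (mu (`[1%R, 2%R]%classic : set R)) = 1.
  by rewrite lebesgue_measure_itv/= lte_fin ltr1n/=; lra.
have icst : mu.-integrable (`[1%R, 2%R]%classic : set R) (EFin \o cst c).
  apply: continuous_compact_integrable; first exact: segment_compact.
  by apply: continuous_subspaceT => t; exact: cvg_cst.
have h1 : c <= Rintegral mu `[1, 2] (fun t => powR t (x - 1) * expR (- t)).
  have <- : Rintegral mu `[1, 2] (cst c) = c by rewrite Rintegral_cst// [X in c * X]mu12 mulr1.
  apply: le_Rintegral => //.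
  move=> t /=; rewrite in_itv/= => /andP[t1 t2]; rewrite /c ler_pM ?powR_ge0 ?expR_ge0//.
    apply: (@le_trans _ _ (powR t (- 2^-1))).
      rewrite !powRN lef_pV2 ?posrE ?powR_gt0//; last by rewrite (lt_le_trans _ t1).
      by apply: ge0_ler_powR; rewrite ?nnegrE// (le_trans _ t1).
    by apply: ler_powR => //; lra.
  by rewrite ler_expR lerN2.
apply: lt_le_trans c0 (le_trans h1 _).
rewrite /Gamma /Rintegral fine_le//.
- exact: integrable_fin_num.
- exact: integrable_fin_num.
- apply: ge0_subset_integral => //.
  + by case/integrableP : iG.
  + by move=> t _; rewrite lee_fin.
Qed.

Lemma Cnu_gt0 (nu : R) : 2^-1 <= nu -> 0 < Cnu nu.
Proof.
move=> hnu; have nu0 : 0 < nu by rewrite (lt_le_trans _ hnu).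
rewrite /Cnu divr_gt0 ?mulr_gt0 ?Gamma_gt0 ?sqrtr_gt0 ?pi_gt0//.
by rewrite lerDr ltW.
Qed.

End GammaPos.

(** * Limits of real-valued integrals *)

Section RintegralLimits.
Variable R : realType.
Notation mu := (@lebesgue_measure R).

Lemma Rintegral_dominated (D : set R) (f_ : nat -> R -> R) (f g : R -> R) :
  measurable D -> (forall n, measurable_fun D (f_ n)) ->
  (forall x, D x -> f_ n x @[n --> \oo] --> f x) ->
  (forall n x, D x -> `|f_ n x| <= g x) ->
  mu.-integrable D (EFin \o g) ->
  mu.-integrable D (EFin \o f) /\
  Rintegral mu D (f_ n) @[n --> \oo] --> Rintegral mu D f.
Proof.
move=> mD mf_ f_f f_g ig.
have mf : measurable_fun D f by exact: (measurable_fun_cvg mf_ f_f).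
have h1 : {ae mu, forall x, D x -> (f_ n x)%:E @[n --> \oo] --> (f x)%:E}.
  by apply: aeW => x Dx; apply: cvg_EFin; [exact: nearW|exact: f_f].
have h2 : {ae mu, forall x (n : nat), D x -> (`|(f_ n x)%:E| <= (g x)%:E)%E}.
  by apply: aeW => x n Dx; rewrite lee_fin f_g.
have m_ n : measurable_fun D (fun x => (f_ n x)%:E) by exact/measurable_EFinP.
have m0 : measurable_fun D (fun x => (f x)%:E) by exact/measurable_EFinP.
have [i1 _ i3] := @dominated_convergence _ (measurableTypeR R) R mu D mD _ _ _ m_ m0 h1 ig h2.
by split=> //; apply: fine_cvg; rewrite fineK//; exact: integrable_fin_num.
Qed.

Lemma integrable_oneDsqr : mu.-integrable setT (EFin \o (fun x : R => (oneDsqr x)^-1)).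
Proof.
have c : continuous (fun x : R => (oneDsqr x)^-1) by exact: continuous_oneDsqrV.
have f0 (x : R) : 0 <= (oneDsqr x)^-1 by rewrite invr_ge0 (le_trans _ (oneDsqr_ge1 x)).
apply/integrableP; split.
  by apply/measurable_EFinP; exact: continuous_measurable_fun.
under eq_integral => x _ do rewrite /= ger0_norm//.
have e : (fun x : R => (oneDsqr x)^-1) =1 (fun x : R => (oneDsqr x)^-1) \o -%R.
  by move=> x; rewrite /= /oneDsqr sqrrN.
rewrite (ge0_symfun_integralT f0 c e).
by rewrite -set_itvcy integral0y_oneDsqr -EFinM ltry.
Qed.

Lemma cvg_Rintegral_itv (f : R -> R) (c_ : nat -> R) : measurable_fun setT f ->
  mu.-integrable setT (EFin \o f) -> c_ @ \oo --> +oo ->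
  Rintegral mu `[- c_ n, c_ n] f @[n --> \oo] --> Rintegral mu setT f.
Proof.
move=> mf intf cy.
have [] := @Rintegral_dominated setT (fun n => f \_ `[- c_ n, c_ n]) f (fun x => `|f x|)
  measurableT.
- move=> n; apply/(measurable_restrictT f); first exact: measurable_itv.
  exact: measurable_funTS.
- move=> x _; apply: (@cvg_near_cst _ R).
  near=> n; rewrite patchE mem_set//= in_itv/= -ler_norml.
  by near: n; move/cvgryPge : cy; exact.
- move=> n x _; rewrite patchE; case: ifP => // _; by rewrite normr0.
- exact: (integrable_norm intf).
move=> _; apply: cvg_trans; apply: near_eq_cvg; apply: nearW => n.
exact/esym/Rintegral_mkcond.
Unshelve. all: by end_near. Qed.

End RintegralLimits.

(** * The spectral density on the line *)

Section SpectralDensity.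
Variable R : realType.
Notation mu := (@lebesgue_measure R).
Notation circ := (`[- pi, pi]%classic : set R).
Variable nu : R.
Hypothesis hnu : 2^-1 <= nu.

Let nu0 : 0 < nu. Proof. by rewrite (lt_le_trans _ hnu). Qed.
Let C0 : 0 < Cnu nu. Proof. exact: Cnu_gt0. Qed.
Let p1 : 1 <= nu + 2^-1. Proof. by move: hnu; lra. Qed.

Lemma pi_ge1 : 1 <= pi :> R.
Proof. by apply: le_trans (pi_ge2 _); rewrite ler1n. Qed.

Section Alpha.
Variable a : R.
Hypothesis a0 : 0 < a.

Definition gcoef : R := Cnu nu * powR a (2 * nu).

Lemma gcoef_gt0 : 0 < gcoef.
Proof. by rewrite mulr_gt0// powR_gt0. Qed.

Lemma base_gt0 (w : R) : 0 < a ^+ 2 + w ^+ 2.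
Proof. by rewrite ltr_pwDl ?exprn_gt0// sqr_ge0. Qed.

Lemma gstar_gt0 w : 0 < gstar nu a w.
Proof. by rewrite mulr_gt0 ?gcoef_gt0// powR_gt0// base_gt0. Qed.

Lemma gstarN w : gstar nu a (- w) = gstar nu a w.
Proof. by rewrite /gstar sqrrN. Qed.

Lemma gstar_continuous : continuous (gstar nu a).
Proof.
move=> w; apply: cvgMr; apply: (@continuous_comp _ _ _ (fun w : R => a ^+ 2 + w ^+ 2)
   (fun x => powR x (- (nu + 2^-1)))).
  by apply: cvgD; [exact: cvg_cst|exact: exprn_continuous].
by apply: continuous_powR_gt0; exact: base_gt0.
Qed.

Lemma measurable_gstar : measurable_fun setT (gstar nu a).
Proof. by apply: continuous_measurable_fun; exact: gstar_continuous. Qed.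

(** The base a^2 + w^2 is at least k^2 >= 1 and the exponent nu + 1/2 is at least 1. This
    inverse-square decay makes the sum over shifts converge. *)
Lemma gstar_far (w k : R) : 1 <= k -> k <= `|w| -> gstar nu a w <= gcoef / k ^+ 2.
Proof.
move=> k1 kw; rewrite ler_pM2l ?gcoef_gt0// powRN.
have k0 : 0 < k by rewrite (lt_le_trans _ k1).
have kb : k ^+ 2 <= a ^+ 2 + w ^+ 2.
  apply: (@le_trans _ _ (w ^+ 2)); last by rewrite lerDr sqr_ge0.
  by rewrite -(real_normK (num_real w)) lerXn2r ?nnegrE// ltW.
rewrite lef_pV2 ?posrE ?powR_gt0 ?base_gt0 ?exprn_gt0//.
apply: le_trans kb _; apply: le1r_powR => //.
rewrite (le_trans _ (_ : k ^+ 2 <= _))//; first by rewrite exprn_ege1.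
apply: (@le_trans _ _ (w ^+ 2)); last by rewrite lerDr sqr_ge0.
by rewrite -(real_normK (num_real w)) lerXn2r ?nnegrE// ltW.
Qed.

Lemma gstar_le0 w : gstar nu a w <= gstar nu a 0.
Proof.
rewrite ler_pM2l ?gcoef_gt0// !powRN lef_pV2 ?posrE ?powR_gt0 ?base_gt0//.
apply: ge0_ler_powR; rewrite ?nnegrE ?(ltW (base_gt0 _))//.
  by rewrite (le_trans _ p1).
by rewrite lerD2l expr0n/= sqr_ge0.
Qed.

Lemma gstar_integrable : mu.-integrable setT (EFin \o gstar nu a).
Proof.
pose m := Num.min (a ^+ 2) 1.
have m0 : 0 < m by rewrite lt_min exprn_gt0//=.
(* One power of the base is compared with m (1 + w^2); the remaining power nu - 1/2 >= 0 is bounded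
   by its value at w = 0. *)
pose K := gcoef * powR (a ^+ 2) (- (nu - 2^-1)) / m.
have K0 : 0 <= K.
  by rewrite divr_ge0 ?(ltW m0)// mulr_ge0 ?powR_ge0// ltW// gcoef_gt0.
have le_g w : gstar nu a w <= K * (oneDsqr w)^-1.
  have op : 0 < oneDsqr w by rewrite (lt_le_trans _ (oneDsqr_ge1 w)).
  have -> : gstar nu a w = gcoef * powR (a ^+ 2 + w ^+ 2) (- (nu + 2^-1)) by [].
  have -> : K * (oneDsqr w)^-1 =
    gcoef * (powR (a ^+ 2) (- (nu - 2^-1)) * (m^-1 * (oneDsqr w)^-1)) by rewrite /K; ring.
  rewrite ler_pM2l ?gcoef_gt0//.
  have -> : - (nu + 2^-1) = - (nu - 2^-1) + - 1 by lra.
  rewrite powRD; last by rewrite (lt0r_neq0 (base_gt0 w)) implybT.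
  apply: ler_pM; rewrite ?powR_ge0//.
    rewrite !powRN lef_pV2 ?posrE ?powR_gt0 ?base_gt0 ?exprn_gt0//.
    apply: ge0_ler_powR; rewrite ?nnegrE ?(ltW (base_gt0 _)) ?sqr_ge0 ?subr_ge0//.
    by rewrite lerDl sqr_ge0.
  rewrite powR_inv1 ?(ltW (base_gt0 _))// -invfM lef_pV2 ?posrE ?base_gt0 ?mulr_gt0//.
  rewrite /oneDsqr mulrDr mulr1 lerD//; first by rewrite ge_min lexx.
  by rewrite ler_piMl ?sqr_ge0// ge_min lexx orbT.
have iK : mu.-integrable setT (EFin \o (fun w => K * (oneDsqr w)^-1)).
  rewrite (_ : EFin \o _ = (fun w : R => K%:E * (EFin \o (fun x : R => (oneDsqr x)^-1)%R) w)%E).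
    by apply: integrableZl => //; exact: integrable_oneDsqr.
  by apply/funext => w /=; rewrite EFinM.
apply: le_integrable iK => //.
  by apply/measurable_EFinP; exact: measurable_gstar.
move=> w _ /=; rewrite lee_fin gtr0_norm ?gstar_gt0// (le_trans (le_g w))//.
exact: ler_norm.
Qed.

Definition glip : R := 2 * (nu + 2^-1) / a.

(** The logarithm of g* is Lipschitz with a constant of order 1/a. In this multiplicative form the
    bound passes to sums of shifts with the same constant, without termwise differentiation. *)
Lemma gstar_ratio (u v : R) : gstar nu a u <= expR (glip * `|u - v|) * gstar nu a v.
Proof.
set z := `|u - v|; have z0 : 0 <= z by exact: normr_ge0.
have e2 : a ^+ 2 + v ^+ 2 <= expR (2 * (z / a)) * (a ^+ 2 + u ^+ 2).
  (* With t = z / a, |v| <= |u| + t a; the cross term 2 t |u| a is at most t (a^2 + u^2). *)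
  have h1 : a ^+ 2 + v ^+ 2 <= (1 + z / a) ^+ 2 * (a ^+ 2 + u ^+ 2).
    set t := z / a; have t0 : 0 <= t by rewrite divr_ge0// ltW.
    have zE : z = t * a by rewrite /t divfK// lt0r_neq0.
    have v1 : `|v| <= `|u| + z.
      by rewrite -[v](subKr u) (le_trans (ler_normB _ _)).
    have v2 : v ^+ 2 <= (`|u| + t * a) ^+ 2.
      by rewrite -(real_normK (num_real v)) lerXn2r ?nnegrE ?addr_ge0// -?zE.
    have u2 : `|u| ^+ 2 = u ^+ 2 by rewrite real_normK ?num_real.
    have am : 2 * (`|u| * a) <= a ^+ 2 + u ^+ 2.
      by rewrite -u2; have := sqr_ge0 (`|u| - a); rewrite sqrrB; lra.
    have am' : t * (2 * (`|u| * a)) <= t * (a ^+ 2 + u ^+ 2) by rewrite ler_wpM2l.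
    have t2u : 0 <= t ^+ 2 * u ^+ 2 by rewrite mulr_ge0 ?sqr_ge0.
    have ta : 0 <= t * (a ^+ 2 + u ^+ 2) by rewrite mulr_ge0 ?(ltW (base_gt0 _)).
    apply: (@le_trans _ _ (a ^+ 2 + (u ^+ 2 + t * (2 * (`|u| * a)) + t ^+ 2 * a ^+ 2))).
      by rewrite lerD2l (le_trans v2)// -u2 sqrrD exprMn le_eqVlt; apply/orP; left; apply/eqP; ring.
    have -> : (1 + t) ^+ 2 * (a ^+ 2 + u ^+ 2) = a ^+ 2 + u ^+ 2 + 2 * (t * (a ^+ 2 + u ^+ 2)) +
       t ^+ 2 * a ^+ 2 + t ^+ 2 * u ^+ 2 by ring.
    lra.
  apply: le_trans h1 _; rewrite ler_wpM2r ?(ltW (base_gt0 _))//.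
  rewrite (mulrC 2) expRM_natr lerXn2r ?nnegrE ?expR_ge0 ?expR_ge1Dx//.
  by rewrite addr_ge0// divr_ge0// ltW.
rewrite mulrCA ler_pM2l ?gcoef_gt0// !powRN.
rewrite ler_pdivlMr ?powR_gt0 ?base_gt0// mulrC ler_pdivrMr ?powR_gt0 ?base_gt0//.
have -> : expR (glip * z) = powR (expR (2 * (z / a))) (nu + 2^-1).
  by rewrite /powR gt_eqF ?expR_gt0// expRK; congr expR; rewrite /glip; field; exact: lt0r_neq0.
rewrite -powRM ?expR_ge0 ?(ltW (base_gt0 _))//.
apply: ge0_ler_powR; rewrite ?nnegrE ?mulr_ge0 ?expR_ge0 ?(ltW (base_gt0 _))//.
by rewrite (le_trans _ p1).
Qed.

End Alpha.
End SpectralDensity.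

(** * Folding the density onto the circle *)

Section FoldedDensity.
Variable R : realType.
Notation mu := (@lebesgue_measure R).
Notation circ := (`[- pi, pi]%classic : set R).
Variable nu : R.
Hypothesis hnu : 2^-1 <= nu.
Variable a : R.
Hypothesis a0 : 0 < a.

(** The summand of [gdelta] at a = delta theta, so that [gdelta nu delta theta] is
    [gfold (delta * theta)] by conversion. *)
Definition gterm (k : nat) (l : R) : R :=
  if k == 0%N then gstar nu a l
  else gstar nu a (l + 2 * k%:R * pi) + gstar nu a (l - 2 * k%:R * pi).

Definition gpart (N : nat) (l : R) : R := \sum_(0 <= k < N) gterm k l.

Definition gfold (l : R) : R := limn (fun N => gpart N l).

Lemma gterm_gt0 k l : 0 < gterm k l.
Proof. by rewrite /gterm; case: ifP => _; rewrite ?addr_gt0 ?gstar_gt0. Qed.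

Lemma gtermN k l : gterm k (- l) = gterm k l.
Proof.
rewrite /gterm; case: ifP => _; first exact: gstarN.
by rewrite addrC -opprD gstarN -[- l + _]opprK opprD opprK gstarN.
Qed.

Lemma gfoldN l : gfold (- l) = gfold l.
Proof.
rewrite /gfold (_ : (fun N => gpart N (- l)) = (fun N => gpart N l))//.
by apply/funext => N; apply: eq_bigr => k _; rewrite gtermN.
Qed.

Lemma gpart_nd l : nondecreasing_seq (fun N => gpart N l).
Proof.
apply/nondecreasing_seqP => n; rewrite /gpart big_nat_recr//= lerDl.
exact/ltW/gterm_gt0.
Qed.

(** For l in the circle, both arguments have absolute value at least (2 k - 1) pi >= k. *)
Lemma gterm_far k l : (0 < k)%N -> circ l -> gterm k l <= gcoef nu a * (2 / k%:R ^+ 2).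
Proof.
move=> k0; rewrite /= in_itv/= => /andP[l1 l2]; rewrite /gterm gtn_eqF//.
have k1 : 1 <= k%:R :> R by rewrite ler1n.
have pi1 := pi_ge1 R.
have kp : k%:R <= (2 * k%:R - 1) * pi :> R.
  by rewrite -[leLHS]mulr1 ler_pM//; lra.
have E : (2 * k%:R - 1) * pi = 2 * k%:R * pi - pi :> R by ring.
have -> : gcoef nu a * (2 / k%:R ^+ 2) = gcoef nu a / k%:R ^+ 2 + gcoef nu a / k%:R ^+ 2 by ring.
apply: lerD; apply: gstar_far => //.
  by rewrite ler_normr; apply/orP; left; lra.
by rewrite ler_normr; apply/orP; right; lra.
Qed.

Lemma sum_inv_sqr N : \sum_(1 <= k < N.+1) (2 / k%:R ^+ 2 : R) <= 4%:R.
Proof.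
(* Strengthened for induction: 2 / (N+2)^2 <= 2 / (N+1) - 2 / (N+2). *)
suff : \sum_(1 <= k < N.+2) (2 / k%:R ^+ 2 : R) <= 4%:R - 2 / N.+1%:R.
  move=> h; apply: le_trans (le_trans h _); last by rewrite gerBl divr_ge0.
  by rewrite [leRHS]big_nat_recr//= lerDl divr_ge0.
elim: N => [|N IH]; first by rewrite big_nat1 expr1n; lra.
rewrite big_nat_recr//= (le_trans (lerD IH (lexx _)))//.
have n1 : 0 < N.+1%:R :> R by rewrite ltr0n.
have n2 : 0 < N.+2%:R :> R by rewrite ltr0n.
rewrite -addrA lerD2l -subr_ge0.
have -> : - (2 / N.+2%:R) - (- (2 / N.+1%:R) + 2 / N.+2%:R ^+ 2) =
  2 / (N.+1%:R * N.+2%:R ^+ 2) :> R.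
  rewrite -(natr1 N.+1); move: (N.+1%:R) n1 => x x0; field.
  by rewrite !lt0r_neq0// addr_gt0.
by rewrite divr_ge0// mulr_ge0// ?exprn_ge0 ltW.
Qed.

Lemma gpart_le N l : circ l -> gpart N l <= gstar nu a l + 4 * gcoef nu a.
Proof.
move=> cl; apply: (@le_trans _ _ (gpart N.+1 l)); first exact: gpart_nd.
rewrite /gpart big_nat_recl//= lerD2l.
have -> : \sum_(0 <= i < N) gterm i.+1 l = \sum_(1 <= k < N.+1) gterm k l.
  by rewrite big_add1.
apply: (@le_trans _ _ (\sum_(1 <= k < N.+1) gcoef nu a * (2 / k%:R ^+ 2))).
  by apply: ler_sum_nat => k /andP[k0 _]; exact: gterm_far.
rewrite -mulr_sumr mulrC ler_wpM2r ?sum_inv_sqr//.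
exact/ltW/gcoef_gt0.
Qed.

Lemma gpart_cvg l : circ l -> gpart N l @[N --> \oo] --> gfold l.
Proof.
move=> cl; apply: nondecreasing_is_cvgn; first exact: gpart_nd.
by exists (gstar nu a l + 4 * gcoef nu a) => _ [N _ <-]; exact: gpart_le.
Qed.

Lemma gpart_le_gfold N l : circ l -> gpart N l <= gfold l.
Proof.
move=> cl; apply: nondecreasing_cvgn_le; first exact: gpart_nd.
by apply/cvg_ex; eexists; exact: gpart_cvg.
Qed.

Lemma gfold_ge_gstar l : circ l -> gstar nu a l <= gfold l.
Proof. by move=> cl; apply: le_trans (gpart_le_gfold 1 cl); rewrite /gpart big_nat1. Qed.

Lemma gfold_gt0 l : circ l -> 0 < gfold l.
Proof. by move=> /gfold_ge_gstar; apply: lt_le_trans; exact: gstar_gt0. Qed.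

Lemma gfold_le l : circ l -> gfold l <= gstar nu a l + 4 * gcoef nu a.
Proof.
move=> cl; apply: limr_le; first by apply/cvg_ex; eexists; exact: gpart_cvg.
by apply: nearW => N; exact: gpart_le.
Qed.

Lemma gpart_measurable N : measurable_fun setT (gpart N).
Proof.
have mg (c : R) : measurable_fun setT (fun l : R => gstar nu a (l + c)).
  rewrite (_ : (fun _ => _) = gstar nu a \o (fun l => l + c))//.
  apply: measurableT_comp; first exact: measurable_gstar.
  by apply: measurable_funD => //; exact: measurable_id.
apply: measurable_sum => k; rewrite /gterm; case: (k == 0%N).
  exact: measurable_gstar.
by apply: measurable_funD; exact: mg.
Qed.

Lemma nice_gfold : nice gfold.
Proof.
split.
  apply: (@measurable_fun_cvg _ _ _ _ gpart).
    by move=> N; apply: measurable_funTS; exact: gpart_measurable.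
  by move=> l cl; exact: gpart_cvg.
exists (gstar nu a 0 + 4 * gcoef nu a) => l cl; rewrite gtr0_norm ?gfold_gt0//.
by apply: le_trans (gfold_le cl) _; rewrite lerD2r gstar_le0.
Qed.

Lemma gfold_ratio (x y : R) : circ x -> circ y ->
  gfold x <= expR (glip nu a * `|x - y|) * gfold y.
Proof.
move=> cx cy; apply: limr_le; first by apply/cvg_ex; eexists; exact: gpart_cvg.
apply: nearW => N; apply: (@le_trans _ _ (expR (glip nu a * `|x - y|) * gpart N y)); last first.
  by rewrite ler_wpM2l ?expR_ge0// gpart_le_gfold.
rewrite /gpart mulr_sumr; apply: ler_sum => k _; rewrite /gterm; case: ifP => _.
  exact: gstar_ratio.
have h c : gstar nu a (x + c) <= expR (glip nu a * `|x - y|) * gstar nu a (y + c).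
  by have := gstar_ratio hnu a0 (x + c) (y + c); rewrite opprD addrACA subrr addr0.
by rewrite [leRHS]mulrDr lerD// h.
Qed.

(** Duplication and the mean value theorem give sin z = z cos (z / 2) cos c with 0 < c < z / 2. Both
    cosines are at least cos (pi / 4), whose square is 1/2. *)
Lemma sin_half_bound (z : R) : 0 <= z -> z <= pi / 2 -> z / 2 <= sin z.
Proof.
rewrite le_eqVlt => /predU1P[<- _|z0 zpi]; first by rewrite mul0r sin0.
have pi0 := pi_gt0 R.
have z20 : 0 < z / 2 by rewrite divr_gt0.
have [c] := MVT z20 (fun x _ => is_derive_sin x) (continuous_subspaceT (@continuous_sin R)).
rewrite in_itv/= sin0 !subr0 => /andP[c0 cz] sz.
have cq : cos (pi / 4) <= cos c.
  have [<-//|] := eqVneq c (pi / 4); rewrite neq_lt => /orP[cl|cl]; last by lra.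
  by rewrite ltW// ltr_cos ?in_itv//=; apply/andP; split; lra.
have cq2 : cos (pi / 4) <= cos (z / 2).
  have [->//|zn] := eqVneq (z / 2) (pi / 4).
  by rewrite ltW// ltr_cos ?in_itv//=; [lra|apply/andP; split; lra|apply/andP; split; lra].
have cq0 : 0 <= cos (pi / 4) :> R by apply: cos_ge0_pihalf; apply/andP; split; lra.
have csq : cos (pi / 4) ^+ 2 = 2^-1 :> R.
  have := cos_mulr2n (pi / 4 : R); have -> : (pi / 4) *+ 2 = pi / 2 :> R by rewrite -mulr_natr; field.
  rewrite cos_pihalf -mulr_natr; lra.
have -> : sin z = 2 * (cos (z / 2) * sin (z / 2)).
  have {1}-> : z = (z / 2) *+ 2 by rewrite -mulr_natr; field.
  by rewrite sin_mulr2n -mulr_natr mulrC.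
rewrite sz; have h : cos (pi / 4) * cos (pi / 4) <= cos (z / 2) * cos c by apply: ler_pM.
have : z * (cos (pi / 4) * cos (pi / 4)) <= z * (cos (z / 2) * cos c) by rewrite ler_wpM2l// ltW.
rewrite -expr2 csq; lra.
Qed.

Lemma gfold_lip : exists2 L, 0 <= L & forall x y : R, circ x -> circ y ->
  `|gfold x - gfold y| <= L * `|x - y|.
Proof.
pose M := gstar nu a 0 + 4 * gcoef nu a.
have M0 : 0 <= M.
  by rewrite addr_ge0 ?(ltW (gstar_gt0 _ _ _))// mulr_ge0// ltW// gcoef_gt0.
have gl0 : 0 <= glip nu a.
  by rewrite divr_ge0 ?(ltW a0)// mulr_ge0// addr_ge0// (le_trans _ hnu).
have pi0 := pi_gt0 R.
(* From exp s - 1 <= s exp s with s <= [glip] 2 pi, times the uniform bound M of the folded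
   density. *)
pose L := glip nu a * expR (glip nu a * (2 * pi)) * M.
have key x y : circ x -> circ y -> gfold x - gfold y <= L * `|x - y|.
  move=> cx cy; set z := `|x - y|; have z0 : 0 <= z by exact: normr_ge0.
  have z2 : z <= 2 * pi.
    move: cx cy; rewrite /= !in_itv/= => /andP[? ?] /andP[? ?].
    by rewrite /z ler_norml; apply/andP; split; lra.
  apply: (@le_trans _ _ ((expR (glip nu a * z) - 1) * gfold y)).
    by rewrite mulrBl mul1r lerD2r gfold_ratio.
  have gy : gfold y <= M by apply: le_trans (gfold_le cy) _; rewrite lerD2r gstar_le0.
  have e1 : expR (glip nu a * z) - 1 <= glip nu a * z * expR (glip nu a * z).
    have := expR_ge1Dx (- (glip nu a * z)); rewrite expRN => h.
    have ep := expR_gt0 (glip nu a * z).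
    have : (1 + - (glip nu a * z)) * expR (glip nu a * z) <= 1.
      by rewrite -ler_pdivlMr// mul1r.
    by rewrite mulrDl mul1r mulNr; lra.
  have e2 : expR (glip nu a * z) <= expR (glip nu a * (2 * pi)).
    by rewrite ler_expR ler_wpM2l.
  have e3 : expR (glip nu a * z) - 1 <= glip nu a * expR (glip nu a * (2 * pi)) * z.
    apply: le_trans e1 _; rewrite mulrAC ler_wpM2r//.
    by rewrite ler_wpM2l.
  have g0 : 0 <= gfold y by exact/ltW/gfold_gt0.
  have e0 : 0 <= glip nu a * expR (glip nu a * (2 * pi)) * z by rewrite mulr_ge0// mulr_ge0// expR_ge0.
  apply: (@le_trans _ _ (glip nu a * expR (glip nu a * (2 * pi)) * z * M)).
    apply: le_trans (ler_wpM2r g0 e3) _; exact: ler_wpM2l.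
  by rewrite /L mulrAC.
exists L; first by rewrite /L mulr_ge0// mulr_ge0// expR_ge0.
move=> x y cx cy; rewrite ler_norml key// andbT lerNl opprB distrC key//.
Qed.

(** When x - y exceeds pi, the short way round crosses the seam at pi. Evenness replaces y by - y,
    and |x + y| <= 2 pi - (x - y), so periodicity of the density is never invoked. *)
Lemma gfold_sin_lip : exists C, forall x y : R, circ x -> circ y ->
  `|gfold x - gfold y| <= C * `|sin ((x - y) / 2)|.
Proof.
have [L L0 lip] := gfold_lip; have pi0 := pi_gt0 R.
exists (4 * L) => x y cx cy.
have step (t s : R) : circ t -> circ s -> s <= t -> (`|gfold t - gfold s| <= 4 * L * `|sin ((t - s) / 2)|).
  move=> ct cs st; have := lip _ _ ct cs; have := lip _ (- s) ct.
  move: ct cs; rewrite /= !in_itv/= => /andP[t1 t2] /andP[s1 s2].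
  rewrite gfoldN opprK lerNl opprK lerNl s2 s1 /= => /(_ isT) l1 l2.
  have z0 : 0 <= (t - s) / 2 by rewrite divr_ge0// subr_ge0.
  have [zs|zl] := leP ((t - s) / 2) (pi / 2).
    have h := sin_half_bound z0 zs.
    apply: le_trans l2 _; rewrite (mulrC 4) -mulrA ler_wpM2l//.
    rewrite ger0_norm ?subr_ge0// ger0_norm; last by rewrite (le_trans _ h)// divr_ge0.
    lra.
  have sE : sin ((t - s) / 2) = sin (pi - (t - s) / 2).
    by rewrite sinB sinpi cospi mul0r sub0r mulN1r opprK.
  have w0 : 0 <= pi - (t - s) / 2 by lra.
  have w1 : pi - (t - s) / 2 <= pi / 2 by lra.
  have h := sin_half_bound w0 w1.
  rewrite sE; apply: le_trans l1 _; rewrite (mulrC 4) -mulrA ler_wpM2l//.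
  rewrite [`|sin _|]ger0_norm; last by rewrite (le_trans _ h)// divr_ge0.
  by rewrite ler_norml; apply/andP; split; lra.
have [xy|/ltW xy] := leP y x; first exact: step.
rewrite distrC; have -> : `|sin ((x - y) / 2)| = `|sin ((y - x) / 2)|.
  by rewrite -[x - y]opprB mulNr sinN normrN.
exact: step.
Qed.

End FoldedDensity.

(** * Fourier coefficients of the folded density *)

Section FourierCoefficients.
Variable R : realType.
Notation mu := (@lebesgue_measure R).
Notation circ := (`[- pi, pi]%classic : set R).

Lemma Rintegral_itv_cat (G : R -> R) (a b c : R) : continuous G -> a <= b -> b <= c ->
  Rintegral mu `[a, c] G = Rintegral mu `[a, b] G + Rintegral mu `[b, c] G.
Proof.
move=> cG ab bc.
have iG (x y : R) : mu.-integrable `[x, y] (EFin \o G).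
  by apply: continuous_compact_integrable; [exact: segment_compact|exact: continuous_subspaceT].
have := @Rintegral_itvB R G (BLeft a) (BRight c) b (iG a c).
rewrite !bnd_simp => /(_ ab bc) h.
rewrite -[LHS](subrK (Rintegral mu `[a, b] G)) h addrC; congr (_ + _).
apply: Rintegral_itv_obnd_cbnd; apply: integrableS (iG b c) => //.
by apply: subset_itvr; rewrite bnd_simp.
Qed.

Variables (nu a : R) (n : nat).
Hypotheses (hnu : 2^-1 <= nu) (a0 : 0 < a).
Let G (x : R) := gstar nu a x * cos (n%:R * x).

Let cG : continuous G.
Proof.
move=> x; apply: cvgM; first exact: gstar_continuous.
by apply: continuous_comp; [exact: mulrl_continuous|exact: continuous_cos].
Qed.

Let mG : measurable_fun setT G. Proof. exact: continuous_measurable_fun. Qed.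

Lemma gstar_cos_integrable : mu.-integrable setT (EFin \o G).
Proof.
apply: le_integrable (gstar_integrable hnu a0) => //; first exact/measurable_EFinP.
move=> x _ /=; rewrite lee_fin normrM ler_piMr//.
exact: cos_max.
Qed.

Lemma cos_shift k (x : R) : cos (n%:R * (x + 2 * k%:R * pi)) = cos (n%:R * x).
Proof.
have -> : n%:R * (x + 2 * k%:R * pi) = n%:R * x + (pi *+ 2) *+ (n * k).
  by rewrite -(mulr_natl (pi *+ 2)) -(mulr_natl pi) natrM; ring.
exact: (periodicn (@cosD2pi R)).
Qed.

Lemma cos_shiftN k (x : R) : cos (n%:R * (x - 2 * k%:R * pi)) = cos (n%:R * x).
Proof. by rewrite -(cos_shift k (x - _)) subrK. Qed.

Lemma Rintegral_shift (c : R) : Rintegral mu circ (fun x => G (x + c)) =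
  Rintegral mu `[c - pi, c + pi] G.
Proof.
have n1 : (1 : R) != 0 by exact: oner_neq0.
have iG : mu.-integrable `[c - pi, c + pi] (EFin \o G).
  by apply: integrableS gstar_cos_integrable.
have := @Rintegral_affine R 1 c `[c - pi, c + pi] G n1 (measurable_itv _) iG.
rewrite normr1 invr1 mul1r => <-.
have -> : (fun x : R => 1 * x + c) @^-1` `[c - pi, c + pi] = circ.
  apply/seteqP; split=> x /=; rewrite !in_itv/= mul1r => /andP[? ?]; apply/andP; split; lra.
by apply: eq_Rintegral => x _; rewrite mul1r.
Qed.

(** The cosine has period 2 pi, so each shifted term is an integral over a neighbouring period; the
    terms k = 0, ..., N tile 2 N + 1 periods. *)
Lemma gpart_fourier N : Rintegral mu circ (fun x => gpart nu a N.+1 x * cos (n%:R * x)) =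
  Rintegral mu `[- ((2 * N%:R + 1) * pi), (2 * N%:R + 1) * pi] G.
Proof.
have pi0 := pi_gt0 R.
elim: N => [|N IH].
  rewrite mulr0 add0r mul1r; apply: eq_Rintegral => x _.
  by rewrite /gpart big_nat1.
have iGc (c : R) : mu.-integrable circ (EFin \o (fun x => G (x + c))).
  apply: continuous_compact_integrable; first exact: segment_compact.
  apply: continuous_subspaceT => x; apply: (@continuous_comp _ _ _ (fun x : R => x + c) G); last exact: cG.
  by apply: cvgD => //; exact: cvg_cst.
have iP : mu.-integrable circ (EFin \o (fun x => gpart nu a N.+1 x * cos (n%:R * x))).
  apply: nice_integrable; apply: niceM; last exact: nice_cos.
  split; first by apply: measurable_funTS; exact: gpart_measurable.
  exists (gstar nu a 0 + 4 * gcoef nu a) => x cx.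
  rewrite ger0_norm; last by apply: sumr_ge0 => k _; exact/ltW/gterm_gt0.
  by apply: le_trans (gpart_le hnu a0 _ cx) _; rewrite lerD2r gstar_le0.
set k := N.+1; rewrite (_ : Rintegral _ _ _ = Rintegral mu circ (fun x =>
   gpart nu a N.+1 x * cos (n%:R * x) + (G (x + 2 * k%:R * pi) + G (x + - (2 * k%:R * pi))))); last first.
  apply: eq_Rintegral => x _; rewrite {1}/gpart big_nat_recr//= mulrDl; congr (_ + _).
  by rewrite /G cos_shift cos_shiftN -mulrDl.
have iG2 : mu.-integrable circ (EFin \o (fun x => G (x + 2 * k%:R * pi) + G (x + - (2 * k%:R * pi)))).
  rewrite (_ : EFin \o _ = ((EFin \o (fun x => G (x + 2 * k%:R * pi))) \+
     (EFin \o (fun x => G (x + - (2 * k%:R * pi)))))%E).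
    exact: integrableD.
  by apply/funext => x.
rewrite RintegralD// RintegralD// !Rintegral_shift IH.
have e1 : 2 * k%:R * pi - pi = (2 * N%:R + 1) * pi :> R by rewrite /k -natr1; ring.
have e2 : 2 * k%:R * pi + pi = (2 * k%:R + 1) * pi :> R by ring.
have e3 : - (2 * k%:R * pi) - pi = - ((2 * k%:R + 1) * pi) :> R by ring.
have e4 : - (2 * k%:R * pi) + pi = - ((2 * N%:R + 1) * pi) :> R by rewrite /k -natr1; ring.
rewrite e1 e2 e3 e4.
have N0 : 0 <= N%:R :> R by [].
have q0 : 0 <= (2 * N%:R + 1) * pi :> R by apply: mulr_ge0; [rewrite addr_ge0// mulr_ge0|exact: ltW].
have q1 : (2 * N%:R + 1) * pi <= (2 * k%:R + 1) * pi :> R by rewrite ler_pM2r// /k -natr1; lra.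
move: ((2 * N%:R + 1) * pi) ((2 * k%:R + 1) * pi) q0 q1 => A B A0 AB.
rewrite (@Rintegral_itv_cat G (- B) (- A) B)//; [|lra|lra].
rewrite (@Rintegral_itv_cat G (- A) A B)//; [ring|lra].
Qed.

(** Both sides are limits of the identity for partial sums: by dominated convergence on the circle,
    and by exhaustion of the line. *)
Lemma gfold_fourier : Rintegral mu circ (fun x => gfold nu a x * cos (n%:R * x)) =
  Rintegral mu setT G.
Proof.
have pi0 := pi_gt0 R.
have nc := nice_cos (n%:R : R).
have h1 : Rintegral mu circ (fun x => gpart nu a N.+1 x * cos (n%:R * x)) @[N --> \oo] -->
    Rintegral mu circ (fun x => gfold nu a x * cos (n%:R * x)).
  apply: (proj2 (@Rintegral_dominated R circ (fun N x => gpart nu a N.+1 x * cos (n%:R * x))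
    (fun x => gfold nu a x * cos (n%:R * x)) (cst (gstar nu a 0 + 4 * gcoef nu a)) _ _ _ _ _)).
  - exact: measurable_circ.
  - move=> N; apply: measurable_funM; last by case: nc.
    by apply: measurable_funTS; exact: gpart_measurable.
  - move=> x cx; apply: cvgMl; have := gpart_cvg hnu a0 cx.
    by move=> h; rewrite (cvg_shiftS (fun N => gpart nu a N x)).
  - move=> N x cx; rewrite normrM; have gp : 0 <= gpart nu a N.+1 x.
      by apply: sumr_ge0 => k _; exact/ltW/gterm_gt0.
    rewrite ger0_norm// (le_trans (ler_piMr _ (cos_max _)))//.
    by apply: le_trans (gpart_le hnu a0 _ cx) _; rewrite lerD2r gstar_le0.
  - exact/nice_integrable/nice_cst.
have cy : (fun N => (2 * N%:R + 1) * pi : R) @ \oo --> +oo.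
  apply/cvgryPge => A; near=> N; have : A <= N%:R by near: N; exact: nbhs_infty_ger.
  have N0 : 0 <= N%:R :> R by [].
  have := pi_ge1 R => p1 AN; apply: (le_trans AN).
  by rewrite -[leLHS]mulr1 ler_pM//; lra.
have h2 := cvg_Rintegral_itv mG gstar_cos_integrable cy.
have h3 : Rintegral mu circ (fun x => gpart nu a N.+1 x * cos (n%:R * x)) @[N --> \oo] -->
    Rintegral mu setT G.
  by apply: cvg_trans h2; apply: near_eq_cvg; apply: nearW => N; rewrite gpart_fourier.
exact: (cvg_unique _ h1 h3).
Unshelve. all: by end_near. Qed.

End FourierCoefficients.

(** * The sampled covariance as a Toeplitz matrix *)

Section Covariance.
Variable R : realType.
Notation mu := (@lebesgue_measure R).
Notation circ := (`[- pi, pi]%classic : set R).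
Variables (nu delta theta : R).
Hypotheses (hnu : 2^-1 <= nu) (d0 : 0 < delta) (t0 : 0 < theta).

Lemma gstar_scale (w : R) : gstar nu (delta * theta) (delta * w) = delta^-1 * gstar nu theta w.
Proof.
have d0' := ltW d0.
have dE : delta^-1 = powR delta (2 * nu) * powR (delta ^+ 2) (- (nu + 2^-1)).
  rewrite -powR_mulrn// -powRrM -powRD; last by rewrite (lt0r_neq0 d0) implybT.
  by rewrite -powR_inv1//; congr powR; field.
rewrite /gstar powRM ?ltW// !exprMn -mulrDr powRM ?sqr_ge0 ?(ltW (base_gt0 t0 _))// dE.
ring.
Qed.

(** Substituting x = delta w turns the lag delta n into the integer frequency n and theta into delta
    theta; the line integral then folds onto the circle. *)
Lemma Kmat_fourier (n : nat) : Kmat nu theta (delta * n%:R) =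
  Rintegral mu circ (fun x => gdelta nu delta theta x * cos (n%:R * x)).
Proof.
have a0 : 0 < delta * theta by rewrite mulr_gt0.
have dn0 := lt0r_neq0 d0.
rewrite (gfold_fourier n hnu a0) /Kmat.
have iG := gstar_cos_integrable n hnu a0.
have iK : mu.-integrable setT (EFin \o (fun w => gstar nu theta w * cos (w * (delta * n%:R)))).
  have := gstar_integrable hnu t0; apply: le_integrable => //.
    apply/measurable_EFinP; apply: measurable_funM; first exact: measurable_gstar.
    apply: continuous_measurable_fun => x.
    by apply: continuous_comp; [exact: mulrr_continuous|exact: continuous_cos].
  by move=> w _ /=; rewrite lee_fin normrM ler_piMr// cos_max.
have := Rintegral_affine 0 dn0 measurableT iG.
rewrite preimage_setT gtr0_norm//.
rewrite (_ : Rintegral _ _ _ = Rintegral mu setT (fun w => delta^-1 *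
    (gstar nu theta w * cos (w * (delta * n%:R))))); last first.
  apply: eq_Rintegral => w _; rewrite addr0 gstar_scale -mulrA; congr (_ * (_ * cos _)).
  ring.
rewrite RintegralZl// => /(mulfI _) ->//.
by rewrite invr_eq0.
Qed.

Lemma KmatN t : Kmat nu theta (- t) = Kmat nu theta t.
Proof. by apply: eq_Rintegral => w _; rewrite mulrN cosN. Qed.

Lemma Kmat_Tz n (i j : 'I_n) : Kmat nu theta (delta * (i%:R - j%:R)) =
  Tz n (fun x => 2 * pi * gdelta nu delta theta x) i j.
Proof.
have pi0 := pi_gt0 R.
have twopi : (2 * pi : R) != 0 by rewrite lt0r_neq0// mulr_gt0.
have key (m : nat) : Kmat nu theta (delta * m%:R) =
    mean (fun x => 2 * pi * gdelta nu delta theta x * cos (m%:R * x)).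
  have a0 : 0 < delta * theta by rewrite mulr_gt0.
  rewrite Kmat_fourier (_ : mean _ = mean (fun x => 2 * pi * (gdelta nu delta theta x * cos (m%:R * x)))).
    rewrite meanZ; last by apply: niceM; [exact: nice_gfold|exact: nice_cos].
    by rewrite /mean mulrA mulfV// mul1r.
  by apply: eq_mean => x _; rewrite mulrA.
rewrite mxE; have [ij|/ltnW ij] := leqP j i.
  by rewrite -natrB// key.
have -> : delta * (i%:R - j%:R) = - (delta * (j - i)%:R) by rewrite natrB//; ring.
rewrite KmatN key; apply: eq_mean => x _.
by rewrite -cosN natrB// -mulNr opprB.
Qed.

End Covariance.

(** * Convergence of the statistic *)

Section QuadraticStatistic.
Variable R : realType.
Notation mu := (@lebesgue_measure R).
Notation circ := (`[- pi, pi]%classic : set R).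
Variables (nu delta : R).
Hypotheses (hnu : 2^-1 <= nu) (d0 : 0 < delta).

(** The factor 2 pi compensates the normalization of [mean] in [Tz], and turns the (2 pi)^-1 of
    [adelta] into 1. *)
Definition symb (theta x : R) := 2 * pi * gdelta nu delta theta x.

Lemma twopi_gt0 : 0 < 2 * pi :> R.
Proof. by rewrite mulr_gt0// pi_gt0. Qed.

Section Symb.
Variable theta : R.
Hypothesis t0 : 0 < theta.
Let a0 : 0 < delta * theta. Proof. exact: mulr_gt0. Qed.

Lemma nice_symb : nice (symb theta).
Proof. by apply: niceZ; exact: (nice_gfold hnu a0). Qed.

Lemma symbN x : symb theta (- x) = symb theta x.
Proof. exact: congr1 (gfoldN nu (delta * theta) x). Qed.

Lemma symb_gt0 x : circ x -> 0 < symb theta x.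
Proof. by move=> cx; rewrite mulr_gt0 ?twopi_gt0//; exact: (gfold_gt0 hnu a0 cx). Qed.

Lemma symb_ge0 x : circ x -> 0 <= symb theta x.
Proof. by move=> /symb_gt0/ltW. Qed.

Lemma symb_sin_lip : exists C, forall x y : R, circ x -> circ y ->
  `|symb theta x - symb theta y| <= C * `|sin ((x - y) / 2)|.
Proof.
have [C hC] := gfold_sin_lip hnu a0; exists (2 * pi * C) => x y cx cy.
rewrite /symb -mulrBr normrM gtr0_norm ?twopi_gt0// -(mulrA (2 * pi)).
by apply: ler_wpM2l; [exact/ltW/twopi_gt0|exact: hC].
Qed.

(** The unfolded density decreases in |x|, so its value at pi is a lower bound. It keeps the limit
    of tr A / n away from 0. *)
Lemma symb_lower : exists2 c, 0 < c & forall x, circ x -> c <= symb theta x.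
Proof.
exists (2 * pi * gstar nu (delta * theta) pi).
  by rewrite mulr_gt0 ?twopi_gt0// gstar_gt0.
move=> x cx; rewrite ler_pM2l ?twopi_gt0//.
apply: le_trans (gfold_ge_gstar hnu a0 cx).
have xpi : x ^+ 2 <= pi ^+ 2.
  rewrite -(real_normK (num_real x)) lerXn2r ?nnegrE ?pi_ge0//.
  by move: cx; rewrite /= in_itv/= -ler_norml.
rewrite ler_pM2l ?gcoef_gt0// !powRN lef_pV2 ?posrE ?powR_gt0 ?base_gt0//.
apply: ge0_ler_powR; rewrite ?nnegrE ?(ltW (base_gt0 _ _))//; last by rewrite lerD2l.
by move: hnu; lra.
Qed.

Lemma Rmat_Tz n : Rmat nu delta theta n = Tz n (symb theta).
Proof.
apply/matrixP => i j; rewrite mxE -Kmat_Tz//.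
have [h|h] := leP 0 (i%:R - j%:R : R); first by rewrite ger0_norm.
by rewrite ltr0_norm// mulrN KmatN.
Qed.

End Symb.

Variables (b theta b0 theta0 : R).
Hypotheses (hb : 0 < b) (ht : 0 < theta) (hb0 : 0 < b0) (ht0 : 0 < theta0).

Let f := symb theta.
Let f0 := symb theta0.
Let r x := (1 + b * f x)^-1.
Let M n : 'M[R]_n := resolvent f b n.
Let T0 n : 'M[R]_n := Tz n f0.
Definition covmx n : 'M[R]_n := b0 *: T0 n + 1%:M.
(** The matrix A(I - A) of the statistic, rewritten with A = I - M ([Amat_filter]). *)
Definition filtermx n : 'M[R]_n := M n - M n *m M n.

Let nf : nice f. Proof. exact: nice_symb. Qed.
Let nf0 : nice f0. Proof. exact: nice_symb. Qed.
Let nr : nice r. Proof. by apply: nice_resolvent => // x; exact: symb_ge0. Qed.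

Let rN x : r (- x) = r x. Proof. by rewrite /r /f symbN. Qed.

Let hM : has_symbol M r.
Proof.
have [C hC] := symb_sin_lip ht.
by apply: (resolvent_symbol nf _ _ hb hC) => x; [exact: symbN|exact: symb_ge0].
Qed.

Let hT0 : has_symbol T0 f0.
Proof. by have [C hC] := symb_sin_lip ht0; apply: (has_symbol_Tz nf0 _ hC) => x; exact: symbN. Qed.

Let contr n (u : 'cV[R]_n) : sqn (M n *m u) <= sqn u.
Proof. exact: (resolvent_contraction nf (symbN theta) (symb_ge0 ht) hb). Qed.

(** This is (r - r^2) (1 + b0 f0), in the shape that [has_symbol_lin] and [has_symbol_mul]
    produce. *)
Let phi x := 1 * (1 * r x + -1 * (r x * r x)) +
   b0 * (1 * (r x * f0 x) + -1 * (r x * (r x * f0 x))).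

Let nphi : nice phi.
Proof.
have nrr := niceM nr nr; have nrf := niceM nr nf0.
by apply: niceD; apply: niceZ; apply: niceD; apply: niceZ => //; exact: niceM.
Qed.

Let phiN x : phi (- x) = phi x.
Proof. by rewrite /phi rN /f0 symbN. Qed.

Lemma has_symbol_ext (X Y : forall n, 'M[R]_n) xi : (forall n, X n = Y n) ->
  has_symbol X xi -> has_symbol Y xi.
Proof.
by move=> XY; apply: cvg_trans; apply: near_eq_cvg; apply: nearW => n; rewrite XY.
Qed.

Lemma filter_cov_symbol : has_symbol (fun n => filtermx n *m covmx n) phi.
Proof.
have nrr := niceM nr nr; have nrf := niceM nr nf0; have nrrf := niceM nr nrf.
have hMM := has_symbol_mul nr nr contr hM hM.
have hMT := has_symbol_mul nr nf0 contr hM hT0.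
have hMMT := has_symbol_mul nr nrf contr hM hMT.
have h1 := has_symbol_lin 1 (-1) nr nrr hM hMM.
have h2 := has_symbol_lin 1 (-1) nrf nrrf hMT hMMT.
have n1 : nice (fun x => 1 * r x + -1 * (r x * r x)) by apply: niceD; exact: niceZ.
have n2 : nice (fun x => 1 * (r x * f0 x) + -1 * (r x * (r x * f0 x))).
  by apply: niceD; exact: niceZ.
have h := has_symbol_lin 1 b0 n1 n2 h1 h2.
apply: has_symbol_ext h => n; rewrite /filtermx /covmx mulmxDr mulmx1 -scalemxAr mulmxBl.
by rewrite !scale1r !scaleN1r mulmxA addrC.
Qed.

Let onemr x := 1 * cst 1 x + -1 * r x.

Let nonemr : nice onemr.
Proof. by apply: niceD; apply: niceZ => //; exact: nice_cst. Qed.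

Lemma Amat_resolvent n : Amat nu delta b theta n = 1%:M - M n.
Proof.
have u : 1%:M + b *: Tz n f \in unitmx.
  exact: (unit_shift nf (symbN theta) (symb_ge0 ht) hb).
rewrite /Amat Rmat_Tz// -/f /M /resolvent.
have E : b *: Tz n f = (1%:M + b *: Tz n f) - 1%:M by rewrite addrC addKr.
by move: (1%:M + b *: Tz n f) E u => G -> u; rewrite mulmxBl mul1mx mulmxV.
Qed.

Lemma Amat_symbol : has_symbol (Amat nu delta b theta) onemr.
Proof.
have h := has_symbol_lin 1 (-1) (nice_cst _) nr (@has_symbol1 R) hM.
by apply: has_symbol_ext h => n; rewrite Amat_resolvent scale1r scaleN1r.
Qed.

Lemma adelta_onemr x : circ x -> adelta nu delta b theta x = onemr x.
Proof.
move=> cx; have g0 : 0 < gdelta nu delta theta x by exact: (gfold_gt0 hnu (mulr_gt0 d0 ht) cx).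
have pi0 := pi_gt0 R.
rewrite /adelta /onemr /r /f /symb /cst; move: (gdelta _ _ _ _) g0 => g g0.
have := twopi_gt0; move: (2 * pi) => P P0; field.
by rewrite !lt0r_neq0// addr_gt0// mulr_gt0// mulr_gt0.
Qed.

Lemma onemr_mean_gt0 : 0 < mean onemr.
Proof.
have [c c0 fc] := symb_lower ht.
apply: (@lt_le_trans _ _ (1 - (1 + b * c)^-1)).
  by rewrite subr_gt0 invf_lt1 ?ltrDl ?addr_gt0 ?mulr_gt0.
rewrite -[leLHS]mean_cst; apply: le_mean => //; first exact: nice_cst.
move=> x cx; rewrite /onemr /r /cst !mul1r mulN1r lerD2l lerN2.
have bc : 0 < b * c by rewrite mulr_gt0.
have bf : b * c <= b * f x by rewrite ler_pM2l// fc.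
by rewrite lef_pV2 ?posrE ?lerD2l//; lra.
Qed.

(** With a = 1 - r = b f r, the identity a^2 (b0 f0 / (b f) - 1) = phi - a holds pointwise, and the
    mean of a over itself gives the -1. *)
Lemma psi_mean : mean phi / mean onemr - 1 = psi nu delta b theta b0 theta0.
Proof.
have m0 := onemr_mean_gt0.
have pi0 := pi_gt0 R.
pose h x := adelta nu delta b theta x ^+ 2 *
  (b0 * gdelta nu delta theta0 x / (b * gdelta nu delta theta x) - 1).
have hE x : circ x -> h x = phi x - onemr x.
  move=> cx; rewrite /h adelta_onemr// /onemr /phi /r /f /f0 /symb /cst.
  have g0 : 0 < gdelta nu delta theta x by exact: (gfold_gt0 hnu (mulr_gt0 d0 ht) cx).
  move: (gdelta _ _ theta _) (gdelta _ _ theta0 _) g0 => g g' g0.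
  have := twopi_gt0; move: (2 * pi) => P P0; field.
  by rewrite !lt0r_neq0// addr_gt0// mulr_gt0// mulr_gt0.
have -> : psi nu delta b theta b0 theta0 = mean h / mean (adelta nu delta b theta).
  rewrite /psi /mean -/h.
  have := twopi_gt0; move: (2 * pi) => P P0.
  by rewrite (invfM P^-1) invrK mulrACA mulVf ?mul1r// lt0r_neq0.
rewrite (eq_mean adelta_onemr) (eq_mean hE) meanB//.
by rewrite mulrBl mulfV// lt0r_neq0.
Qed.

Lemma trace_asymptotics : exists m l C, [/\ 0 < m, l / m - 1 = psi nu delta b theta b0 theta0,
  (fun n => n%:R^-1 * \tr (Amat nu delta b theta n)) @ \oo --> m,
  (fun n => n%:R^-1 * \tr (filtermx n *m covmx n)) @ \oo --> l &
  \forall n \near \oo, \sum_i \sum_j (filtermx n *m covmx n) i j ^+ 2 <= C * n%:R].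
Proof.
have [C hC] := frobenius_symbol nphi filter_cov_symbol.
exists (mean onemr), (mean phi), C; split.
- exact: onemr_mean_gt0.
- exact: psi_mean.
- by apply: tr_symbol nonemr _ Amat_symbol => x; rewrite /onemr rN.
- exact: tr_symbol nphi phiN filter_cov_symbol.
- exact: hC.
Qed.

Lemma Amat_filter n : Amat nu delta b theta n *m (1%:M - Amat nu delta b theta n) = filtermx n.
Proof.
rewrite Amat_resolvent /filtermx opprB addrCA subrr addr0.
by rewrite mulmxBl mul1mx.
Qed.

Lemma filtermx_sym n : (filtermx n)^T = filtermx n.
Proof.
have MT : (M n)^T = M n.
  by rewrite /M /resolvent trmx_inv linearD/= linearZ/= tr_Tzsym trmx1.
by rewrite /filtermx linearB/= trmx_mul MT.
Qed.

Lemma covmxE n (i j : 'I_n) : covmx n i j =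
  b0 * Kmat nu theta0 (delta * (i%:R - j%:R)) + (i == j)%:R.
Proof. by rewrite (Kmat_Tz hnu d0 ht0) !mxE. Qed.

Lemma covmx_sym n (i j : 'I_n) : covmx n i j = covmx n j i.
Proof.
rewrite !covmxE eq_sym.
have -> : delta * (i%:R - j%:R) = - (delta * (j%:R - i%:R)) by ring.
by rewrite KmatN.
Qed.

(** The moment formulas require a nonnegative variance, which [gaussian_family] does not assert of
    its covariance function. *)
Lemma Kmat_form_ge0 n (c : 'I_n -> R) :
  0 <= \sum_i \sum_j c i * c j * (b0 * Kmat nu theta0 (delta * (i%:R - j%:R))).
Proof.
pose u : 'cV[R]_n := \col_i c i.
have h : 0 <= dot u (T0 n *m u).
  exact: (dot_Tz_ge0 u nf0 (symbN theta0) (symb_ge0 ht0)).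
have -> : \sum_i \sum_j c i * c j * (b0 * Kmat nu theta0 (delta * (i%:R - j%:R))) =
  b0 * dot u (T0 n *m u).
  rewrite dotMr mulr_sumr; apply: eq_bigr => i _; rewrite mulr_sumr.
  by apply: eq_bigr => j _; rewrite Kmat_Tz// [u i 0]mxE [u j 0]mxE; ring.
by rewrite mulr_ge0// ltW.
Qed.

End QuadraticStatistic.

(** * Concentration of the statistic *)

Section ConvergenceInProbability.
Variable R : realType.
Context {d : measure_display} {T : measurableType d} (P : probability T R).
Variables (nu b0 theta0 delta b theta : R).
Hypotheses (hnu : 2^-1 <= nu) (hb0 : 0 < b0) (ht0 : 0 < theta0).
Hypotheses (d0 : 0 < delta) (hb : 0 < b) (ht : 0 < theta).
Variables (Z : R -> T -> R) (eps : nat -> T -> R).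
Hypothesis gZ : gaussian_family P Z (fun s t => b0 * Kmat nu theta0 (t - s)).
Hypothesis geps : gaussian_family P eps (fun i j => (i == j)%:R).
Hypothesis hind : indep_families P Z eps.

(** Ordinals start at 0, so coordinate i is sampled at time (i + 1) delta; the covariance depends
    only on time differences. *)
Let y n (i : 'I_n) (w : T) := Z (i.+1%:R * delta) w + eps i w.
Let S n := covmx nu delta b0 theta0 n.
Let B n := filtermx nu delta b theta n.

Let mZ t : measurable_fun setT (Z t). Proof. by case: gZ. Qed.
Let me i : measurable_fun setT (eps i). Proof. by case: geps. Qed.
Let my n (i : 'I_n) : measurable_fun setT (@y n i).
Proof. exact: measurable_funD. Qed.

(** A linear form in y splits into a form in Z and a form in the noise, which are independent
    centered normal variables. *)
Let sample_moments n (c : 'I_n -> R) :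
  [/\ P.-integrable setT (EFin \o (fun w => (\sum_i c i * @y n i w) ^+ 4)),
      expect P (fun w => (\sum_i c i * @y n i w) ^+ 2) = \sum_i \sum_j c i * c j * S n i j &
      expect P (fun w => (\sum_i c i * @y n i w) ^+ 4) =
        3 * (\sum_i \sum_j c i * c j * S n i j) ^+ 2].
Proof.
pose X w := \sum_i c i * Z (i.+1%:R * delta) w.
pose Y w := \sum_i c i * eps i w.
have yE : (fun w => \sum_i c i * @y n i w) = (fun w => X w + Y w).
  apply/funext => w; rewrite /X /Y -big_split/=; apply: eq_bigr => i _.
  by rewrite mulrDr.
have mX : measurable_fun setT X by apply: measurable_sum => i; exact: measurable_funM.
have mY : measurable_fun setT Y by apply: measurable_sum => i; exact: measurable_funM.
have lX := gZ.2 n (fun i : 'I_n => i.+1%:R * delta) c.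
have lY := geps.2 n (fun i : 'I_n => i : nat) c.
have cX : \sum_(i < n) \sum_(j < n) c i * c j * (b0 * Kmat nu theta0 (j.+1%:R * delta - i.+1%:R * delta)) =
   \sum_i \sum_j c i * c j * (b0 * Kmat nu theta0 (delta * (i%:R - j%:R))).
  apply: eq_bigr => i _; apply: eq_bigr => j _; rewrite -KmatN; congr (_ * (_ * Kmat _ _ _)).
  by rewrite -[i.+1%:R]natr1 -[j.+1%:R]natr1; ring.
rewrite cX in lX.
have v10 := Kmat_form_ge0 hnu d0 hb0 ht0 c.
have v20 : 0 <= \sum_(i < n) \sum_(j < n) c i * c j * ((i : nat) == j)%:R.
  apply: sumr_ge0 => i _; rewrite (bigD1 i)//= big1 => [|j ji].
    by rewrite eqxx mulr1 addr0 -expr2 sqr_ge0.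
  by rewrite (_ : (_ == _) = false) ?mulr0//; apply/negbTE; rewrite eq_sym.
have XY : indep2 P X Y.
  apply: (@cylinder_indep R _ _ P n (fun i => Z (i.+1%:R * delta)) (fun i => eps i)) => //.
  by move=> A C mA mC; exact: hind.
have [h1 h2 h3] := indep_sum_moments v10 v20 mX mY lX lY XY.
have qE : \sum_i \sum_j c i * c j * S n i j =
    \sum_i \sum_j c i * c j * (b0 * Kmat nu theta0 (delta * (i%:R - j%:R))) +
    \sum_(i < n) \sum_(j < n) c i * c j * ((i : nat) == j)%:R.
  rewrite -big_split/=; apply: eq_bigr => i _; rewrite -big_split/=; apply: eq_bigr => j _.
  by rewrite -mulrDr /S covmxE.
have yk k : (fun w => (\sum_i c i * @y n i w) ^+ k) = fun w => (X w + Y w) ^+ k.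
  by apply/funext => w; rewrite (congr1 (fun f => f w) yE).
by rewrite qE !yk.
Qed.

Let Bsym n i j : B n i j = B n j i.
Proof.
by have := congr1 (fun M : 'M[R]_n => M i j) (filtermx_sym nu delta b theta n); rewrite mxE.
Qed.

Let tA n := \tr (Amat nu delta b theta n).

Lemma stat_quad n w : stat nu delta b theta (\col_(i < n) @y n i w) =
  quad (@y n) (B n) w / tA n - 1.
Proof.
rewrite /stat -/(tA n); congr (_ / _ - 1).
set u := \col_i _; rewrite -(mulmxA u^T) Amat_filter// -/(B n) mxE.
rewrite /quad -(pair_bigA _ (fun i j => B n i j * (@y n i w * @y n j w)))/= exchange_big/=.
apply: eq_bigr => j _; rewrite mxE mulr_suml; apply: eq_bigr => i _.
by rewrite !mxE; ring.
Qed.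

Let measurable_stat n : measurable_fun setT
  (fun w => stat nu delta b theta (\col_(i < n) @y n i w)).
Proof.
under eq_fun do rewrite stat_quad.
apply: measurable_funB => //; apply: measurable_funM => //.
exact: measurable_quad.
Qed.

Lemma stat_conv_in_prob : conv_in_prob P
  (fun n w => stat nu delta b theta (\col_(i < n) (Z (i.+1%:R * delta) w + eps i w)))
  (psi nu delta b theta b0 theta0).
Proof.
move=> e e0.
have [m [l [C [m0 lm trA trBS fro]]]] := trace_asymptotics hnu d0 b0 hb ht ht0.
have m2 : 0 < m / 2 by rewrite divr_gt0.
have trAm : \forall n \near \oo, m / 2 < n%:R^-1 * tA n.
  by move/cvgrPdist_lt : trA => /(_ _ m2); apply: filterS => n; rewrite ltr_distlC; lra.
have ratio : (fun n => (n%:R^-1 * \tr (B n *m S n)) / (n%:R^-1 * tA n) - 1) @ \oo -->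
    psi nu delta b theta b0 theta0.
  rewrite -lm; apply: cvgB; last exact: cvg_cst.
  by apply: cvgM => //; apply: cvgV => //; exact: lt0r_neq0.
have e2 : 0 < e / 2 by rewrite divr_gt0.
(* A variance of at most 2 C n against a squared deviation (e / 2 * (n m / 2))^2 leaves D / n. *)
pose D := 2 * C / (e / 2 * (m / 2)) ^+ 2.
apply: (@squeeze_cvge _ _ _ _ (cst 0%E) _ (fun n => (D * n%:R^-1)%:E)); last 2 first.
- exact: cvg_cst.
- apply: cvg_EFin; first exact: nearW.
  rewrite -[X in _ --> X](mulr0 D); apply: cvgMr.
  apply/gtr0_cvgV0; last exact: cvgr_idn.
  by near=> n; rewrite ltr0n; near: n; exists 1%N.
near=> n; rewrite measure_ge0/=.
have n0 : (0 < n)%N by near: n; exists 1%N.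
have n0' : 0 < n%:R :> R by rewrite ltr0n.
have nn0 := lt0r_neq0 n0'.
have h1 : m / 2 < n%:R^-1 * tA n by near: n; exact: trAm.
have h2 : `|psi nu delta b theta b0 theta0 -
    ((n%:R^-1 * \tr (B n *m S n)) / (n%:R^-1 * tA n) - 1)| < e / 2.
  by near: n; move/cvgrPdist_lt : ratio; apply.
have h3 : \sum_i \sum_j (B n *m S n) i j ^+ 2 <= C * n%:R by near: n; exact: fro.
have t0 : n%:R * (m / 2) < tA n by rewrite -ltr_pdivlMl.
have tpos : 0 < tA n by apply: lt_trans t0; rewrite mulr_gt0.
have Ssym i j : S n i j = S n j i by exact: covmx_sym.
have cheb := @quad_chebyshev R _ _ P n (@y n) (S n) (@my n)
   (fun c => let: And3 h _ _ := sample_moments c in h)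
   (fun c => let: And3 _ h _ := sample_moments c in h)
   (fun c => let: And3 _ _ h := sample_moments c in h) Ssym (B n) (@Bsym n)
   (e / 2 * (n%:R * (m / 2))).
have ep : 0 < e / 2 * (n%:R * (m / 2)) by rewrite mulr_gt0// mulr_gt0.
(* The expected quotient minus 1 is within e / 2 of psi, and tr A exceeds n m / 2. A deviation e of
   the statistic thus forces this deviation of the quadratic form. *)
apply: (@le_trans _ _ (P [set w | e / 2 * (n%:R * (m / 2)) <
    `|quad (@y n) (B n) w - \tr (B n *m S n)|])).
  apply: le_measure; rewrite ?inE.
  - rewrite -[X in measurable X]setTI.
    have -> : [set w | e < `|stat nu delta b theta (\col_(i < n) (Z (i.+1%:R * delta) w + eps i w)) -
        psi nu delta b theta b0 theta0|] =
      (fun w => `|stat nu delta b theta (\col_(i < n) @y n i w) -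
        psi nu delta b theta b0 theta0|) @^-1` `]e, +oo[%classic.
      by apply/seteqP; split=> w /=; rewrite in_itv/= andbT.
    have mm : measurable_fun setT (fun w => `|stat nu delta b theta (\col_(i < n) @y n i w) -
        psi nu delta b theta b0 theta0|).
      by apply: measurableT_comp => //; apply: measurable_funB => //; exact: measurable_stat.
    exact: mm.
  - rewrite -[X in measurable X]setTI.
    have -> : [set w | e / 2 * (n%:R * (m / 2)) < `|quad (@y n) (B n) w - \tr (B n *m S n)|] =
      (fun w => `|quad (@y n) (B n) w - \tr (B n *m S n)|) @^-1` `]e / 2 * (n%:R * (m / 2)), +oo[%classic.
      by apply/seteqP; split=> w /=; rewrite in_itv/= andbT.
    have mm : measurable_fun setT (fun w => `|quad (@y n) (B n) w - \tr (B n *m S n)|).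
      by apply: measurableT_comp => //; apply: measurable_funB => //; exact: measurable_quad.
    exact: mm.
  move=> w /=; rewrite stat_quad => ew.
  set q := quad _ _ w in ew *; set t := \tr (B n *m S n) in h2 *.
  have h2' : `|t / tA n - 1 - psi nu delta b theta b0 theta0| < e / 2.
    rewrite distrC; move: h2; congr (`|_ - (_ - 1)| < _).
    by field; rewrite nn0 lt0r_neq0.
  have h4 : e / 2 < `|(q - t) / tA n|.
    have : `|q / tA n - 1 - psi nu delta b theta b0 theta0| <=
       `|(q - t) / tA n| + `|t / tA n - 1 - psi nu delta b theta b0 theta0|.
      apply: le_trans (ler_normD _ _); rewrite le_eqVlt; apply/orP; left; apply/eqP.
      by congr (`|_|); rewrite mulrBl; ring.
    by lra.
  move: h4; rewrite normrM (gtr0_norm (_ : 0 < (tA n)^-1)) ?invr_gt0// ltr_pdivlMr//.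
  by apply: lt_trans; rewrite ltr_pM2l.
apply: le_trans (cheb ep) _; rewrite lee_fin.
(* The trace of K^2 is at most the squared Frobenius norm, by 2 x y <= x^2 + y^2 on transposed
   entries. *)
have trle : \tr (B n *m S n *m (B n *m S n)) <= C * n%:R.
  apply: le_trans h3; move: (B n *m S n) => K.
  have h i j : K i j * K j i <= (K i j ^+ 2 + K j i ^+ 2) / 2.
    by have := sqr_ge0 (K i j - K j i); rewrite sqrrB; lra.
  have -> : \tr (K *m K) = \sum_i \sum_j K i j * K j i.
    by apply: eq_bigr => i _; rewrite mxE.
  apply: (@le_trans _ _ (\sum_i \sum_j (K i j ^+ 2 + K j i ^+ 2) / 2)).
    by apply: ler_sum => i _; apply: ler_sum => j _; exact: h.
  rewrite le_eqVlt; apply/orP; left; apply/eqP.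
  under eq_bigr do rewrite -mulr_suml big_split/=.
  rewrite -mulr_suml big_split/= [X in _ + X]exchange_big/=.
  by field.
rewrite ler_pdivrMr ?exprn_gt0//.
have -> : D * n%:R^-1 * (e / 2 * (n%:R * (m / 2))) ^+ 2 = 2 * (C * n%:R).
  by rewrite /D; field; rewrite nn0 !lt0r_neq0.
by rewrite ler_pM2l.
Unshelve. all: by end_near. Qed.

End ConvergenceInProbability.

(** * The limit of vanishing spacing *)

Section LimitProfile.
Variable R : realType.
Notation mu := (@lebesgue_measure R).

Lemma integrable_le_oneDsqr (D : set R) (f : R -> R) (K : R) : measurable D ->
  measurable_fun D f -> (forall x, D x -> `|f x| <= K * (oneDsqr x)^-1) ->
  mu.-integrable D (EFin \o f).
Proof.
move=> mD mf fK.
have iK : mu.-integrable D (EFin \o (fun w => K * (oneDsqr w)^-1)).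
  apply: (@integrableS _ (measurableTypeR R) R mu setT) => //.
  rewrite (_ : EFin \o _ = (fun w : R => K%:E * (EFin \o (fun x : R => (oneDsqr x)^-1)%R) w)%E).
    by apply: integrableZl => //; exact: integrable_oneDsqr.
  by apply/funext => w /=; rewrite EFinM.
apply: le_integrable iK => //; first exact/measurable_EFinP.
by move=> w /fK h /=; rewrite lee_fin (le_trans h)// ler_norm.
Qed.

Variables (p c : R).
Hypotheses (p2 : 2 <= p) (c0 : 0 < c).

(** Taken on the half-line u > 0, where [powR u p] is |u|^p; evenness supplies the other half. *)
Definition profile (u : R) := c / (c + powR u p).

Let den0 u : 0 < c + powR u p.
Proof. by rewrite ltr_pwDl// powR_ge0. Qed.

Lemma profile_gt0 u : 0 < profile u.
Proof. by rewrite divr_gt0. Qed.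

Lemma profile_le1 u : profile u <= 1.
Proof. by rewrite ler_pdivrMr// mul1r lerDl powR_ge0. Qed.

Lemma profile_le u : 0 < u -> profile u <= c * powR u (- p).
Proof.
move=> u0; rewrite powRN ler_pM2l// lef_pV2 ?posrE ?powR_gt0//.
by rewrite lerDr ltW.
Qed.

Lemma powRN_le_oneDsqr (u : R) : 1 <= u -> powR u (- p) <= 2 * (oneDsqr u)^-1.
Proof.
move=> u1; have u0 : 0 < u by exact: lt_le_trans u1.
have op : 0 < oneDsqr u by rewrite (lt_le_trans _ (oneDsqr_ge1 u)).
have u21 : 1 <= u ^+ 2 by rewrite exprn_ege1.
rewrite powRN ler_pdivlMr// ler_pdivrMl ?powR_gt0//.
apply: (@le_trans _ _ (u ^+ 2 * 2)); first by rewrite /oneDsqr; lra.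
by rewrite ler_pM2r// -powR_mulrn ?(ltW u0)//; apply: ler_powR.
Qed.

Lemma one_le_oneDsqr (u : R) : `|u| <= 1 -> 1 <= 2 * (oneDsqr u)^-1.
Proof.
move=> u1; have op : 0 < oneDsqr u by rewrite (lt_le_trans _ (oneDsqr_ge1 u)).
rewrite ler_pdivlMr// mul1r /oneDsqr.
have : u ^+ 2 <= 1 by rewrite -(real_normK (num_real u)) exprn_ile1.
by lra.
Qed.

(** The bound 1 serves up to u = 1 and the decay c u^(-p), with p >= 2, beyond it. *)
Lemma profile_le_oneDsqr u : 0 < u -> profile u <= 2 * (1 + c) * (oneDsqr u)^-1.
Proof.
move=> u0; have ov : 0 <= (oneDsqr u)^-1.
  by rewrite invr_ge0 (le_trans _ (oneDsqr_ge1 u)).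
have cov : 0 <= c * (oneDsqr u)^-1 by rewrite mulr_ge0// ltW.
have -> : 2 * (1 + c) * (oneDsqr u)^-1 = 2 * (oneDsqr u)^-1 + 2 * (c * (oneDsqr u)^-1) by ring.
have [u1|/ltW u1] := leP u 1.
  apply: le_trans (profile_le1 u) _; have := @one_le_oneDsqr u.
  by rewrite gtr0_norm// => /(_ u1); lra.
apply: le_trans (profile_le u0) _.
have := powRN_le_oneDsqr u1; rewrite -(ler_pM2l c0); lra.
Qed.

Lemma measurable_profile : measurable_fun setT profile.
Proof.
rewrite (_ : profile = fun u => c * ((@powR R ^~ (-1)) \o (fun u => c + powR u p)) u).
  apply: measurable_funM => //; apply: measurableT_comp; first exact: (measurable_powR (-1)).
  by apply: measurable_funD => //; exact: measurable_powR.
by apply/funext => u; rewrite /= powR_inv1// ltW.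
Qed.

Let drv u := profile u - p * profile u + p * profile u ^+ 2.

(* [drv] is the derivative of [prim], which vanishes at both ends of ]0, +oo[. *)
Let prim u := u * profile u.

(** With q the profile, u^p / (c + u^p) = 1 - q, whence u q' = - p q (1 - q). *)
Let is_derive_prim (u : R) : 0 < u -> is_derive u (1 : R) prim (drv u).
Proof.
move=> u0.
have d1 : is_derive u (1 : R) (fun t => c + powR t p) (p * powR u (p - 1)).
  have := is_deriveD (is_derive_cst c u 1) (@is_derive1_powR _ p _ u0).
  by rewrite add0r.
have d2 := @is_deriveV R (fun t : R => c + powR t p) u _ 1 (lt0r_neq0 (den0 u)) d1.
have d3 := is_deriveM (is_derive_id u (1 : R)) (is_deriveZ c d2).
have E : powR u p = u * powR u (p - 1).
  by rewrite mulr_powRB1 ?(ltW u0)// (lt_le_trans _ p2).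
apply: (is_derive_eq d3); rewrite /drv /profile /GRing.scale/=.
rewrite E; have := den0 u; rewrite E.
by move: (powR u (p - 1)) => U; move/lt0r_neq0 => D0;
  rewrite (_ : c *: (c + u * U)^-1 = c * (c + u * U)^-1)//; field.
Qed.

Let drv_continuous (u : R) : 0 < u -> {for u, continuous drv}.
Proof.
move=> u0; have cp : {for u, continuous profile}.
  apply: cvgM; first exact: cvg_cst.
  apply: cvgV; first exact: lt0r_neq0.
  by apply: cvgD; [exact: cvg_cst|exact: continuous_powR_gt0].
apply: cvgD; last by apply: cvgMr; apply: cvgM.
by apply: cvgB => //; exact: cvgMr.
Qed.

Lemma profile_integrable : mu.-integrable `]0, +oo[ (EFin \o profile).
Proof.
apply: (@integrable_le_oneDsqr _ _ (2 * (1 + c))) => //.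
  exact: measurable_funTS measurable_profile.
move=> u /=; rewrite in_itv/= andbT => u0.
by rewrite gtr0_norm ?profile_gt0// profile_le_oneDsqr.
Qed.

Lemma profile_sqr_integrable : mu.-integrable `]0, +oo[ (EFin \o (fun u => profile u ^+ 2)).
Proof.
apply: le_integrable profile_integrable => //.
  by apply/measurable_EFinP; apply: measurable_funX; exact: measurable_funTS measurable_profile.
move=> u _ /=; rewrite lee_fin ger0_norm ?sqr_ge0// gtr0_norm ?profile_gt0//.
by rewrite expr2 ler_piMr ?profile_le1// ltW// profile_gt0.
Qed.

Let mdrv : measurable_fun setT drv.
Proof.
have mp := measurable_profile.
apply: measurable_funD; last by apply: measurable_funM => //; exact: measurable_funX.
by apply: measurable_funB => //; exact: measurable_funM.
Qed.

Let drv_integral : Rintegral mu `]0, +oo[ drv = 0.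
Proof.
(* The shift by 2 keeps the two end points distinct already at n = 0. *)
pose J (n : nat) : set R := `[n.+2%:R^-1, n.+2%:R]%classic.
pose I : set R := `]0, +oo[%classic.
have p0 : 0 < p by rewrite (lt_le_trans _ p2).
have bnd u : 0 < u -> `|drv u| <= (1 + 2 * p) * (2 * (1 + c)) * (oneDsqr u)^-1.
  move=> u0; have q0 := ltW (profile_gt0 u); have q1 := profile_le1 u.
  have qq : profile u ^+ 2 <= profile u by rewrite expr2 ler_piMr.
  have pqq : p * profile u ^+ 2 <= p * profile u by rewrite ler_pM2l.
  have pq : 0 <= p * profile u by rewrite mulr_ge0// ltW.
  have pq2 : 0 <= p * profile u ^+ 2 by rewrite mulr_ge0 ?sqr_ge0// ltW.
  apply: (@le_trans _ _ ((1 + 2 * p) * profile u)).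
    by rewrite /drv ler_norml; apply/andP; split; lra.
  rewrite -mulrA ler_wpM2l ?profile_le_oneDsqr//; lra.
have [] := @Rintegral_dominated R setT (fun n => drv \_ (J n)) (drv \_ I)
    (fun u => (1 + 2 * p) * (2 * (1 + c)) * (oneDsqr u)^-1) measurableT.
- by move=> n; apply/(measurable_restrictT drv); [exact: measurable_itv|exact: measurable_funTS].
- move=> u _; apply: (@cvg_near_cst _ R).
  have [u0|u0] := leP u 0.
    apply: nearW => n; rewrite !patchE !memNset//.
      by rewrite /I/= in_itv/= ltNge u0.
    rewrite /J/= in_itv/= => /andP[h _].
    by have := le_trans h u0; rewrite leNgt invr_gt0 ltr0n.
  near=> n; rewrite !patchE !mem_set//; first by rewrite /I/= in_itv/= u0.
  rewrite /J/= in_itv/=; apply/andP; split.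
    rewrite invf_ple ?posrE//; apply: (@le_trans _ _ n%:R); last by rewrite ler_nat ltnW.
    by near: n; exact: nbhs_infty_ger.
  apply: (@le_trans _ _ n%:R); last by rewrite ler_nat ltnW.
  by near: n; exact: nbhs_infty_ger.
- have ov (u : R) : 0 <= (1 + 2 * p) * (2 * (1 + c)) * (oneDsqr u)^-1.
    by rewrite !mulr_ge0 ?invr_ge0 ?(le_trans _ (oneDsqr_ge1 u))// ?addr_ge0// ?mulr_ge0// ltW.
  move=> n u _; rewrite patchE; case: ifPn => [|_]; last by rewrite normr0.
  rewrite inE /J/= in_itv/= => /andP[nu _]; apply: bnd.
  by rewrite (lt_le_trans _ nu)// invr_gt0 ltr0n.
- apply: (@integrable_le_oneDsqr _ _ ((1 + 2 * p) * (2 * (1 + c)))) => //.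
    apply: measurable_funM => //; apply: continuous_measurable_fun.
    exact: continuous_oneDsqrV.
  move=> u _; rewrite ger0_norm//.
  by rewrite !mulr_ge0 ?invr_ge0 ?(le_trans _ (oneDsqr_ge1 u))// ?addr_ge0// ?mulr_ge0// ltW.
move=> _; rewrite -Rintegral_mkcond => lim.
have E n : Rintegral mu setT (drv \_ (J n)) = prim n.+2%:R - prim n.+2%:R^-1.
  rewrite -Rintegral_mkcond.
  have n1 : 1 < n.+2%:R :> R by rewrite ltr1n.
  have n0 : 0 < n.+2%:R^-1 :> R by rewrite invr_gt0 ltr0n.
  have nn : n.+2%:R^-1 < n.+2%:R :> R by rewrite (lt_trans _ n1)// invf_lt1// ltr0n.
  by have [_ ->] := FTC_Rintegral_gt0 n0 nn is_derive_prim drv_continuous.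
apply: (cvg_unique _ lim); first exact: norm_hausdorff.
have inv0 : (fun n => n.+2%:R^-1 : R) @ \oo --> (0 : R).
  have := @cvg_harmonic R; rewrite -(cvg_shiftS (@harmonic R)); exact.
(* With N = n + 2, the lower end contributes at most 1 / N because the profile is at most 1, the
   upper end at most c / N because p >= 2. *)
apply: (@squeeze_cvgr _ _ _ _ (fun n => - (n.+2%:R^-1)) (fun n => c * n.+2%:R^-1)).
- apply: nearW => n; rewrite E.
  have n1 : 1 <= n.+2%:R :> R by rewrite ler1n.
  have n0 : 0 < n.+2%:R :> R by rewrite ltr0n.
  have i0 : 0 < n.+2%:R^-1 :> R by rewrite invr_gt0.
  have h1 : prim n.+2%:R^-1 <= n.+2%:R^-1.
    by rewrite /prim ler_piMr ?profile_le1// ltW.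
  have h2 : 0 <= prim n.+2%:R^-1 by rewrite /prim mulr_ge0 ?ltW ?profile_gt0.
  have h3 : 0 <= prim n.+2%:R by rewrite /prim mulr_ge0 ?ltW ?profile_gt0.
  have h4 : prim n.+2%:R <= c * n.+2%:R^-1.
    rewrite /prim -ler_pdivlMl// (le_trans (profile_le n0))// mulrCA ler_pM2l//.
    rewrite powRN -invfM lef_pV2 ?posrE ?powR_gt0 ?mulr_gt0//.
    by rewrite -expr2 -powR_mulrn ?(ltW n0)//; apply: ler_powR.
  move: h1 h2 h3 h4; move: (prim n.+2%:R) (prim n.+2%:R^-1) => a b.
  by move: (n.+2%:R^-1) => i h1 h2 h3 h4; apply/andP; split; lra.
- by rewrite -[X in _ --> X]oppr0; exact: cvgN.
- by rewrite -[X in _ --> X](mulr0 c); exact: cvgMr.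
Unshelve. all: by end_near. Qed.

Lemma profile_sqr_integral :
  p * Rintegral mu `]0, +oo[ (fun u => profile u ^+ 2) = (p - 1) * Rintegral mu `]0, +oo[ profile.
Proof.
have i1 := profile_integrable; have i2 := profile_sqr_integrable.
have h : Rintegral mu `]0, +oo[ drv = Rintegral mu `]0, +oo[ profile -
    p * Rintegral mu `]0, +oo[ profile + p * Rintegral mu `]0, +oo[ (fun u => profile u ^+ 2).
  have iZ (f : R -> R) : mu.-integrable `]0, +oo[ (EFin \o f) ->
      mu.-integrable `]0, +oo[ (EFin \o (fun u => p * f u)).
    by move=> i; apply: (integrableZl _ p i).
  have iB : mu.-integrable `]0, +oo[ (EFin \o (fun u => profile u - p * profile u)).
    exact: (integrableB _ i1 (iZ _ i1)).
  have iZ1 := iZ _ i1; have iZ2 := iZ _ i2.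
  rewrite -(RintegralZl p _ i1)// -(RintegralZl p _ i2)// -(RintegralB _ i1 iZ1)//.
  exact: (RintegralD _ iB iZ2).
move: h; rewrite drv_integral; lra.
Qed.

Lemma profile_integral_gt0 : 0 < Rintegral mu `]0, +oo[ profile.
Proof.
have i1 := profile_integrable.
(* The profile decreases, so on ]0, 1] it is at least its value at 1. *)
have k0 : 0 < c / (c + 1) by rewrite divr_gt0// addr_gt0.
have sub : (`]0, 1]%classic : set R) `<=` `]0, +oo[%classic.
  by move=> t /=; rewrite !in_itv/= => /andP[->].
have mu01 : fine (mu (`]0%R, 1%R]%classic : set R)) = 1.
  by rewrite lebesgue_measure_itv/= lte_fin ltr01 sube0.
have i01 : mu.-integrable (`]0, 1]%classic : set R) (EFin \o profile).
  exact: (@integrableS _ (measurableTypeR R) R mu `]0, +oo[%classic).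
have ic : mu.-integrable (`]0, 1]%classic : set R) (EFin \o cst (c / (c + 1))).
  apply: le_integrable i01 => //; first exact/measurable_EFinP.
  move=> t /=; rewrite in_itv/= => /andP[t0 t1]; rewrite lee_fin gtr0_norm// gtr0_norm ?profile_gt0//.
  rewrite ler_pM2l// lef_pV2 ?posrE ?addr_gt0 ?powR_gt0//.
  rewrite lerD2l (_ : 1 = powR 1 p); last by rewrite powR1.
  apply: ge0_ler_powR; rewrite ?nnegrE ?(ltW t0)//.
  by rewrite (le_trans _ p2).
apply: (lt_le_trans k0).
have <- : Rintegral mu `]0, 1] (cst (c / (c + 1))) = c / (c + 1).
  by rewrite Rintegral_cst// [X in _ * X]mu01 mulr1.
apply: (@le_trans _ _ (Rintegral mu `]0, 1] profile)).
  apply: le_Rintegral => // t /=; rewrite in_itv/= => /andP[t0 t1].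
  rewrite /cst ler_pM2l// lef_pV2 ?posrE ?addr_gt0 ?powR_gt0//.
  rewrite lerD2l (_ : 1 = powR 1 p); last by rewrite powR1.
  apply: ge0_ler_powR; rewrite ?nnegrE ?(ltW t0)//.
  by rewrite (le_trans _ p2).
rewrite /Rintegral fine_le//; [exact: integrable_fin_num|exact: integrable_fin_num|].
apply: ge0_subset_integral => //.
  by case/integrableP : i1.
by move=> t _; rewrite lee_fin ltW// profile_gt0.
Qed.

End LimitProfile.

(** * Rescaled integrals over the circle *)

Section ScaledLimit.
Variable R : realType.
Notation mu := (@lebesgue_measure R).
Notation circ := (`[- pi, pi]%classic : set R).
Notation arc := (`]0, pi]%classic : set R).

Lemma arc_circ : arc `<=` circ.
Proof.
by move=> x /=; rewrite !in_itv/= => /andP[x0 ->]; rewrite (le_trans _ (ltW x0))// oppr_le0 pi_ge0.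
Qed.

Lemma arc_integrable h : nice h -> mu.-integrable arc (EFin \o h).
Proof.
move=> nh; apply: (@integrableS _ (measurableTypeR R) R mu circ) => //.
- exact: arc_circ.
- exact: nice_integrable.
Qed.

Lemma Rintegral_circ_even h : nice h -> (forall x, h (- x) = h x) ->
  Rintegral mu circ h = 2 * Rintegral mu arc h.
Proof.
move=> nh hN; have ih := nice_integrable nh; have ia := arc_integrable nh.
have pi0 := pi_gt0 R.
have E : circ = `[- pi, 0[%classic `|` `[0, pi]%classic.
  by rewrite -itv_bndbnd_setU// bnd_simp ?oppr_le0 ?pi_ge0.
rewrite [in LHS]E Rintegral_setU -?E//; last first.
  apply/disj_setPS => t [/=]; rewrite !in_itv/= => /andP[_ t1] /andP[t2 _].
  by have := lt_le_trans t1 t2; rewrite ltxx.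
rewrite -(Rintegral_itv_obnd_cbnd ia) mulrDl mul1r; congr (_ + _).
have n10 : (-1 : R) != 0 by rewrite oppr_eq0 oner_neq0.
have := @Rintegral_affine R (-1) 0 arc h n10 (measurable_itv _) ia.
rewrite normrN1 invr1 mul1r => <-.
have -> : (fun x : R => -1 * x + 0) @^-1` arc = `[- pi, 0[%classic.
  apply/seteqP; split=> x /=; rewrite !in_itv/= addr0 mulN1r => /andP[? ?]; apply/andP; split; lra.
by apply: eq_Rintegral => x _; rewrite addr0 mulN1r hN.
Qed.

Lemma scaled_arc_preimage (s : R) : 0 < s ->
  (fun x : R => s * x + 0) @^-1` arc = `]0, pi / s]%classic.
Proof.
move=> s0; apply/seteqP; split=> x /=; rewrite !in_itv/= addr0 pmulr_rgt0// ler_pdivlMr//.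
  by rewrite (mulrC x).
by rewrite (mulrC x).
Qed.

Lemma scaled_arc (s : R) h : 0 < s -> nice h ->
  measurable_fun setT ((fun u => h (s * u)) \_ `]0, pi / s]) /\
  s^-1 * Rintegral mu arc h = Rintegral mu setT ((fun u => h (s * u)) \_ `]0, pi / s]).
Proof.
move=> s0 nh; have ia := arc_integrable nh; have sn := lt0r_neq0 s0.
have hE : (fun u => h (s * u + 0)) = fun u => h (s * u) by apply/funext => u; rewrite addr0.
split.
  apply/(measurable_restrictT (fun u => h (s * u))); first exact: measurable_itv.
  have := integrable_affine 0 sn (measurable_itv _) ia; rewrite scaled_arc_preimage// hE.
  by move/measurable_int/measurable_EFinP.
rewrite -Rintegral_mkcond.
have := Rintegral_affine 0 sn (measurable_itv _) ia; rewrite scaled_arc_preimage// hE.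
by rewrite gtr0_norm.
Qed.

(** Halving by evenness, substituting x = s u and extending by zero puts all the integrals on one
    fixed line, where K / (1 + u^2) dominates them. *)
Lemma cvg_scaled_circ (h_ : nat -> R -> R) (s_ : nat -> R) (L : R -> R) (K : R) :
  (forall n, nice (h_ n)) -> (forall n x, h_ n (- x) = h_ n x) ->
  (forall n, 0 < s_ n) -> s_ @ \oo --> 0 ->
  (forall u, 0 < u -> h_ n (s_ n * u) @[n --> \oo] --> L u) ->
  (forall n u, 0 < u -> s_ n * u <= pi -> `|h_ n (s_ n * u)| <= K * (oneDsqr u)^-1) ->
  (s_ n)^-1 * Rintegral mu circ (h_ n) @[n --> \oo] --> 2 * Rintegral mu `]0, +oo[ L.
Proof.
move=> nh hN s0 s_0 hL hK.
have pi0 := pi_gt0 R.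
(* The sign of K is read off from its own bound at u = pi / s_0, the end of the first range. *)
have K0 : 0 <= K.
  have u0 : 0 < pi / s_ 0%N by rewrite divr_gt0.
  have := hK 0%N _ u0; rewrite mulrC divfK ?lt0r_neq0// => /(_ (lexx _)) /(le_trans (normr_ge0 _)).
  by rewrite pmulr_lge0// invr_gt0 (lt_le_trans _ (oneDsqr_ge1 _)).
have E n : (s_ n)^-1 * Rintegral mu circ (h_ n) =
    2 * Rintegral mu setT ((fun u => h_ n (s_ n * u)) \_ `]0, pi / s_ n]).
  by rewrite Rintegral_circ_even// -(scaled_arc (s0 n) (nh n)).2 mulrCA.
rewrite (_ : (fun n => _) = fun n => 2 * Rintegral mu setT
   ((fun u => h_ n (s_ n * u)) \_ `]0, pi / s_ n])); last exact/funext.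
apply: cvgMr; rewrite Rintegral_mkcond.
have ov (u : R) : 0 <= K * (oneDsqr u)^-1.
  by rewrite mulr_ge0// invr_ge0 (le_trans _ (oneDsqr_ge1 u)).
have [] := @Rintegral_dominated R setT
  (fun n => (fun u => h_ n (s_ n * u)) \_ `]0, pi / s_ n]) (L \_ `]0, +oo[)
  (fun u => K * (oneDsqr u)^-1) measurableT.
- by move=> n; have [] := scaled_arc (s0 n) (nh n).
- move=> u _; have [u0|u0] := leP u 0.
    apply: (@cvg_near_cst _ R); apply: nearW => n; rewrite !patchE !memNset//.
      by rewrite /= in_itv/= ltNge u0.
    by rewrite /= in_itv/= ltNge u0.
  rewrite [X in _ --> X]patchE mem_set; last by rewrite /= in_itv/= u0.
  have pu : 0 < pi / u by rewrite divr_gt0.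
  apply: cvg_trans (hL u u0); apply: near_eq_cvg; near=> n.
  rewrite patchE mem_set//= in_itv/= u0/= ler_pdivlMr// mulrC -ler_pdivlMr//.
  near: n; move/cvgrPdist_le : s_0 => /(_ _ pu); apply: filterS => n.
  by rewrite sub0r normrN => /(le_trans (ler_norm _)).
- move=> n u _; rewrite patchE; case: ifPn => [|_]; last by rewrite normr0.
  rewrite inE/= in_itv/= => /andP[u0 us]; apply: hK => //.
  by rewrite mulrC -ler_pdivlMr.
- apply: (@integrable_le_oneDsqr _ _ _ K) => //.
    apply: measurable_funM => //; apply: continuous_measurable_fun.
    exact: continuous_oneDsqrV.
  by move=> u _; rewrite ger0_norm.
by move=> _.
Unshelve. all: by end_near. Qed.

End ScaledLimit.

(** * The folded density at small spacing *)

Section SmallSpacing.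
Variable R : realType.
Notation circ := (`[- pi, pi]%classic : set R).
Variable nu : R.
Hypothesis hnu : 2^-1 <= nu.

Let p := 2 * nu + 1.
Let p2 : 2 <= p. Proof. by rewrite /p; move: hnu; lra. Qed.
Let p0 : 0 < p. Proof. by rewrite (lt_le_trans _ p2). Qed.
Let nu0 : 0 < nu. Proof. by rewrite (lt_le_trans _ hnu). Qed.

(* The frequency scale on which b g^delta is of order one. *)
Definition bandwidth (delta : R) := powR delta (2 * nu / p).

Lemma bandwidth_gt0 delta : 0 < delta -> 0 < bandwidth delta.
Proof. exact: powR_gt0. Qed.

Lemma powR_bandwidth delta : powR (bandwidth delta) p = powR delta (2 * nu).
Proof. by rewrite -powRrM divfK// lt0r_neq0. Qed.

Lemma bandwidth_cvg0 : bandwidth d @[d --> 0^'+] --> 0.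
Proof. by apply: powR_cvg0; rewrite divr_gt0// mulr_gt0. Qed.

Lemma powR_sqr_half (u : R) : 0 <= u -> powR (u ^+ 2) (- (nu + 2^-1)) = powR u (- p).
Proof.
move=> u0; rewrite -powR_mulrn// -powRrM; congr powR; rewrite /p.
by rewrite mulrN mulrDr divff.
Qed.

Section OneScale.
Variable theta : R.
Hypothesis ht : 0 < theta.

Lemma gcoef_scaled delta : 0 < delta ->
  gcoef nu (delta * theta) = powR (bandwidth delta) p * gcoef nu theta.
Proof. by move=> d0; rewrite /gcoef powRM ?ltW// powR_bandwidth mulrCA. Qed.

(** Since delta = [bandwidth delta] * delta^(1/p), all powers of the bandwidth cancel, and delta
    survives only in an offset that vanishes in the limit. *)
Lemma gstar_scaled delta u : 0 < delta ->
  gstar nu (delta * theta) (bandwidth delta * u) =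
  gcoef nu theta * powR ((theta * powR delta p^-1) ^+ 2 + u ^+ 2) (- (nu + 2^-1)).
Proof.
move=> d0; have s0 := bandwidth_gt0 d0.
have dE : delta = bandwidth delta * powR delta p^-1.
  rewrite /bandwidth -powRD; last by rewrite (lt0r_neq0 d0) implybT.
  have -> : 2 * nu / p + p^-1 = 1.
    by rewrite -[X in _ + X]mul1r -mulrDl divff// lt0r_neq0.
  by rewrite powRr1// ltW.
have -> : gstar nu (delta * theta) (bandwidth delta * u) =
  gcoef nu (delta * theta) * powR ((delta * theta) ^+ 2 + (bandwidth delta * u) ^+ 2) (- (nu + 2^-1)).
  by [].
rewrite gcoef_scaled//.
have -> : (delta * theta) ^+ 2 + (bandwidth delta * u) ^+ 2 =
    bandwidth delta ^+ 2 * ((theta * powR delta p^-1) ^+ 2 + u ^+ 2).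
  by rewrite {1}dE; ring.
rewrite powRM ?sqr_ge0 ?addr_ge0 ?sqr_ge0// powR_sqr_half ?(ltW s0)// powRN.
have : powR (bandwidth delta) p != 0 by rewrite lt0r_neq0// powR_gt0.
by move: (powR (bandwidth delta) p) (powR (_ + _) _) => x y x0; field.
Qed.

Lemma gstar_scaled_le delta u : 0 < delta -> 0 < u ->
  gstar nu (delta * theta) (bandwidth delta * u) <= gcoef nu theta * powR u (- p).
Proof.
move=> d0 u0; rewrite gstar_scaled// ler_pM2l ?gcoef_gt0// -powR_sqr_half ?(ltW u0)//.
have u20 : 0 < u ^+ 2 by rewrite exprn_gt0.
have w0 : 0 < (theta * powR delta p^-1) ^+ 2 + u ^+ 2 by rewrite ltr_wpDl ?sqr_ge0.
rewrite !powRN lef_pV2 ?posrE ?powR_gt0//.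
apply: ge0_ler_powR; rewrite ?nnegrE ?(ltW w0) ?(ltW u20) ?addr_ge0 ?(ltW nu0)//.
by rewrite lerDr sqr_ge0.
Qed.

Lemma scaled_circ delta u : 0 < delta -> 0 < u -> bandwidth delta * u <= pi ->
  circ (bandwidth delta * u).
Proof.
move=> d0 u0 su; rewrite /= in_itv/= su andbT (@le_trans _ _ 0) ?oppr_le0 ?pi_ge0//.
by rewrite mulr_ge0 ?ltW// bandwidth_gt0.
Qed.

(** With s the bandwidth, the shifted copies add at most 4 s^p [gcoef nu theta], and s u <= pi turns
    s^p into pi^p u^(-p). *)
Lemma gfold_scaled_le delta u : 0 < delta -> 0 < u -> bandwidth delta * u <= pi ->
  gfold nu (delta * theta) (bandwidth delta * u) <=
  gcoef nu theta * (1 + 4 * powR pi p) * powR u (- p).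
Proof.
move=> d0 u0 su; have s0 := bandwidth_gt0 d0.
have dt : 0 < delta * theta by rewrite mulr_gt0.
apply: le_trans (gfold_le hnu dt (scaled_circ d0 u0 su)) _.
rewrite mulrDr mulr1 mulrDl lerD ?gstar_scaled_le// gcoef_scaled//.
have -> : gcoef nu theta * (4 * powR pi p) * powR u (- p) =
  4 * (powR pi p * powR u (- p) * gcoef nu theta) by ring.
rewrite ler_pM2l// ler_pM2r ?gcoef_gt0// powRN ler_pdivlMr ?powR_gt0//.
rewrite -powRM ?(ltW s0) ?(ltW u0)//; apply: ge0_ler_powR => //; rewrite ?nnegrE ?pi_ge0 ?(ltW p0)//.
by rewrite mulr_ge0 ?ltW.
Qed.

(** Squeezed between the unshifted term and that term plus a contribution of the shifted copies of
    order delta^(2 nu). *)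
Lemma gfold_scaled_cvg (u : R) : 0 < u ->
  gfold nu (d * theta) (bandwidth d * u) @[d --> 0^'+] --> gcoef nu theta * powR u (- p).
Proof.
move=> u0.
have d1 : (theta * powR d p^-1) ^+ 2 + u ^+ 2 @[d --> 0^'+] --> u ^+ 2.
  rewrite -[X in _ --> X]add0r; apply: cvgD; last exact: cvg_cst.
  have h : theta * powR d p^-1 @[d --> (0 : R)^'+] --> (0 : R).
    by rewrite -[X in _ --> X](mulr0 theta); apply: cvgMr; apply: powR_cvg0; rewrite invr_gt0.
  rewrite [X in _ --> X](_ : 0 = 0 ^+ 2); last by rewrite expr0n.
  exact: (cvg_comp (fun d : R => theta * powR d p^-1) (fun x : R => x ^+ 2) h (@exprn_continuous _ 2 0)).
have u20 : 0 < u ^+ 2 by rewrite exprn_gt0.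
have d2 : gcoef nu theta * powR ((theta * powR d p^-1) ^+ 2 + u ^+ 2) (- (nu + 2^-1))
    @[d --> 0^'+] --> gcoef nu theta * powR u (- p).
  rewrite -powR_sqr_half ?(ltW u0)//; apply: cvgMr.
  exact: (cvg_comp (fun d : R => (theta * powR d p^-1) ^+ 2 + u ^+ 2)
    (fun x : R => powR x (- (nu + 2^-1))) d1 (continuous_powR_gt0 u20)).
have d3 : gcoef nu theta * powR ((theta * powR d p^-1) ^+ 2 + u ^+ 2) (- (nu + 2^-1)) +
    4 * (powR d (2 * nu) * gcoef nu theta)
    @[d --> 0^'+] --> gcoef nu theta * powR u (- p).
  rewrite -[X in _ --> X]addr0; apply: cvgD => //.
  rewrite -[X in _ --> X](mulr0 4); apply: cvgMr.
  rewrite -[X in _ --> X](mul0r (gcoef nu theta)); apply: cvgMl.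
  by apply: powR_cvg0; rewrite mulr_gt0.
apply: squeeze_cvgr d2 d3; near=> d.
have d0 : 0 < d by near: d; exact: nbhs_right_gt.
have su : bandwidth d * u <= pi.
  rewrite -ler_pdivlMr//; near: d.
  have pu : 0 < pi / u by rewrite divr_gt0// pi_gt0.
  move/cvgrPdist_le : bandwidth_cvg0 => /(_ _ pu); apply: filterS => d.
  by rewrite sub0r normrN => /(le_trans (ler_norm _)).
have dt : 0 < d * theta by rewrite mulr_gt0.
have cu := scaled_circ d0 u0 su.
rewrite -gstar_scaled//; apply/andP; split; first exact: gfold_ge_gstar.
by have := gfold_le hnu dt cu; rewrite gcoef_scaled// powR_bandwidth.
Unshelve. all: by end_near. Qed.

End OneScale.

Section TwoScales.
Variables theta theta0 : R.
Hypotheses (ht : 0 < theta) (ht0 : 0 < theta0).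

(** The prefactors carry the same power of delta, and (delta theta)^2 + w^2 <= m ((delta theta0)^2 +
    w^2) with m = 1 + (theta / theta0)^2, so k is uniform in delta and w. *)
Lemma gstar_scale_ratio : exists2 k, 0 < k & forall delta w, 0 < delta ->
  gstar nu (delta * theta0) w <= k * gstar nu (delta * theta) w.
Proof.
pose m := 1 + (theta / theta0) ^+ 2.
have m0 : 0 < m by rewrite ltr_pwDl ?sqr_ge0.
have g0 := gcoef_gt0 hnu ht; have g00 := gcoef_gt0 hnu ht0.
exists (gcoef nu theta0 / gcoef nu theta * powR m (nu + 2^-1)).
  by rewrite mulr_gt0 ?powR_gt0// divr_gt0.
move=> delta w d0.
have dt : 0 < delta * theta by rewrite mulr_gt0.
have dt0 : 0 < delta * theta0 by rewrite mulr_gt0.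
have -> : gstar nu (delta * theta0) w =
  gcoef nu (delta * theta0) * powR ((delta * theta0) ^+ 2 + w ^+ 2) (- (nu + 2^-1)) by [].
have -> : gstar nu (delta * theta) w =
  gcoef nu (delta * theta) * powR ((delta * theta) ^+ 2 + w ^+ 2) (- (nu + 2^-1)) by [].
rewrite !gcoef_scaled// !powRN.
have b0 := base_gt0 dt0 w; have b1 := base_gt0 dt w.
have -> : gcoef nu theta0 / gcoef nu theta * powR m (nu + 2^-1) *
   (powR (bandwidth delta) p * gcoef nu theta *
     (powR ((delta * theta) ^+ 2 + w ^+ 2) (nu + 2^-1))^-1) =
   powR (bandwidth delta) p * gcoef nu theta0 * (powR m (nu + 2^-1) *
     (powR ((delta * theta) ^+ 2 + w ^+ 2) (nu + 2^-1))^-1).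
  by rewrite -[in RHS](divfK (lt0r_neq0 g0) (gcoef nu theta0)); ring.
have kk : 0 < powR (bandwidth delta) p * gcoef nu theta0.
  by apply: mulr_gt0 => //; rewrite powR_gt0// bandwidth_gt0.
rewrite (ler_pM2l kk) ler_pdivlMr ?powR_gt0// ler_pdivrMl ?powR_gt0//.
rewrite -powRM ?(ltW m0) ?(ltW b0)//.
have nn : 0 <= nu + 2^-1 by rewrite addr_ge0// ltW.
apply: ge0_ler_powR => //; rewrite ?nnegrE ?mulr_ge0 ?(ltW b0) ?(ltW b1) ?(ltW m0)//.
rewrite [leRHS]mulrC /m mulrDl mul1r.
have -> : (theta / theta0) ^+ 2 * ((delta * theta0) ^+ 2 + w ^+ 2) =
  (delta * theta) ^+ 2 + (theta / theta0) ^+ 2 * w ^+ 2.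
  by field; exact: lt0r_neq0.
have := sqr_ge0 (delta * theta0); have := mulr_ge0 (sqr_ge0 (theta / theta0)) (sqr_ge0 w).
lra.
Qed.

Lemma gfold_scale_ratio : exists2 k, 0 < k & forall delta x, 0 < delta -> circ x ->
  gfold nu (delta * theta0) x <= k * gfold nu (delta * theta) x.
Proof.
have [k k0 hk] := gstar_scale_ratio; exists k => // delta x d0 cx.
have dt : 0 < delta * theta by rewrite mulr_gt0.
have dt0 : 0 < delta * theta0 by rewrite mulr_gt0.
apply: limr_le; first by apply/cvg_ex; eexists; exact: (gpart_cvg hnu dt0 cx).
apply: nearW => N; apply: (@le_trans _ _ (k * gpart nu (delta * theta) N x)); last first.
  by rewrite ler_pM2l// gpart_le_gfold.
rewrite /gpart mulr_sumr; apply: ler_sum => j _; rewrite /gterm; case: ifP => _; first exact: hk.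
by rewrite [leRHS]mulrDr lerD// hk.
Qed.

End TwoScales.

End SmallSpacing.

(** * The limit of psi *)

Section InfillLimit.
Variable R : realType.
Notation mu := (@lebesgue_measure R).
Notation circ := (`[- pi, pi]%classic : set R).
Variables (nu b theta b0 theta0 : R).
Hypotheses (hnu : 2^-1 <= nu) (hb : 0 < b) (ht : 0 < theta) (hb0 : 0 < b0) (ht0 : 0 < theta0).

Let p := 2 * nu + 1.
Let p2 : 2 <= p. Proof. by rewrite /p; move: hnu; lra. Qed.
Let p0 : 0 < p. Proof. by rewrite (lt_le_trans _ p2). Qed.
Let c := b * (2 * pi * gcoef nu theta).
Let c0 : 0 < c.
Proof. by apply: mulr_gt0 => //; apply: mulr_gt0; [exact: twopi_gt0|exact: gcoef_gt0]. Qed.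
Let rho := b0 * gcoef nu theta0 / (b * gcoef nu theta).

Let f delta := symb nu delta theta.
Let f0 delta := symb nu delta theta0.
Let r delta x := (1 + b * f delta x)^-1.
Let gain delta x := 1 - r delta x.
(** The numerator integrand of [psi], after one factor a = b f r of a^2 has cancelled the b f of the
    ratio. It is unrelated to the defect of a symbol. *)
Let defect delta x := gain delta x * (b0 * f0 delta x * r delta x) - gain delta x ^+ 2.


Let fpos delta x : 0 < delta -> circ x -> 0 <= f delta x.
Proof. by move=> d0 cx; exact: (symb_ge0 hnu d0 ht cx). Qed.

Let nice_r delta : 0 < delta -> nice (r delta).
Proof.
move=> d0; apply: nice_resolvent => //; first exact: nice_symb.
by move=> x; exact: fpos.
Qed.

Let nice_gain delta : 0 < delta -> nice (gain delta).
Proof. by move=> d0; apply: niceB; [exact: nice_cst|exact: nice_r]. Qed.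

Let nice_defect delta : 0 < delta -> nice (defect delta).
Proof.
move=> d0; have nr := nice_r d0; have ng := nice_gain d0.
apply: niceB; last exact: niceX.
by apply: niceM => //; apply: niceM => //; apply: niceZ; exact: nice_symb.
Qed.

Let gainN delta x : gain delta (- x) = gain delta x.
Proof. by rewrite /gain /r /f symbN. Qed.

Let defectN delta x : defect delta (- x) = defect delta x.
Proof. by rewrite /defect gainN /r /f /f0 !symbN. Qed.

Let gainE delta x : 0 < delta -> circ x -> gain delta x = b * f delta x * r delta x.
Proof.
move=> d0 /(fpos d0) fx; have h : 0 < 1 + b * f delta x by rewrite ltr_pwDl// mulr_ge0// ltW.
by rewrite /gain /r; field; exact: lt0r_neq0.
Qed.

Let r01 delta x : 0 < delta -> circ x -> 0 < r delta x <= 1.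
Proof.
move=> d0 /(fpos d0) fx; have h : 0 <= b * f delta x by rewrite mulr_ge0// ltW.
by rewrite /r invr_gt0 ltr_pwDl//= invf_le1 ?lerDl// ltr_pwDl.
Qed.

Let gain01 delta x : 0 < delta -> circ x -> 0 <= gain delta x <= 1.
Proof. by move=> d0 /(r01 d0) /andP[? ?]; rewrite /gain; apply/andP; split; lra. Qed.

(* In this form no spectral density is divided by, so measurability is immediate. *)
Let psiE delta : 0 < delta -> psi nu delta b theta b0 theta0 =
  Rintegral mu circ (defect delta) / Rintegral mu circ (gain delta).
Proof.
move=> d0; have aE x : circ x -> adelta nu delta b theta x = gain delta x.
  by move=> cx; rewrite (adelta_onemr hnu d0 hb ht cx) /gain /r /f /cst !mul1r mulN1r.
rewrite /psi; congr (_ / _); apply: eq_Rintegral => x; rewrite inE => cx; last exact: aE.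
rewrite aE// /defect.
have := symb_gt0 hnu d0 ht cx; rewrite -/(f delta) => fx.
have -> : b0 * gdelta nu delta theta0 x / (b * gdelta nu delta theta x) =
  b0 * f0 delta x / (b * f delta x).
  have g0 : 0 < gdelta nu delta theta x by exact: (gfold_gt0 hnu (mulr_gt0 d0 ht) cx).
  rewrite /f0 /f /symb; have := twopi_gt0 R.
  move: (gdelta nu delta theta0 x) (gdelta nu delta theta x) g0 (2 * pi) => g' g g0 P P0.
  by field; rewrite !lt0r_neq0.
have bf : 0 < b * f delta x by rewrite mulr_gt0.
rewrite mulrBr mulr1 gainE// expr2; congr (_ - _).
by field; rewrite !lt0r_neq0.
Qed.

(** The majorant of [profile_le_oneDsqr] with c enlarged by 1 + 4 pi^p, which accounts for the
    shifted copies uniformly in delta. *)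
Let gain_le delta u : 0 < delta -> 0 < u -> bandwidth nu delta * u <= pi ->
  gain delta (bandwidth nu delta * u) <= 2 * (1 + c * (1 + 4 * powR pi p)) * (oneDsqr u)^-1.
Proof.
move=> d0 u0 su; have cu := scaled_circ d0 u0 su; have /andP[g0 g1] := gain01 d0 cu.
set M := c * _; have M0 : 0 < M by rewrite mulr_gt0// ltr_pwDl// mulr_ge0// powR_ge0.
have ov : 0 < (oneDsqr u)^-1 by rewrite invr_gt0 (lt_le_trans _ (oneDsqr_ge1 u)).
have Mov : 0 < M * (oneDsqr u)^-1 by rewrite mulr_gt0.
have -> : 2 * (1 + M) * (oneDsqr u)^-1 = 2 * (oneDsqr u)^-1 + 2 * (M * (oneDsqr u)^-1) by ring.
have [u1|/ltW u1] := leP u 1.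
  apply: le_trans g1 _; have := @one_le_oneDsqr _ u.
  by rewrite gtr0_norm// => /(_ u1); lra.
have h1 : gain delta (bandwidth nu delta * u) <= M * powR u (- p).
  rewrite gainE//; have /andP[r0 r1] := r01 d0 cu; have fx := fpos d0 cu.
  apply: (@le_trans _ _ (b * f delta (bandwidth nu delta * u))).
    by rewrite ler_piMr// mulr_ge0// ltW.
  have -> : M * powR u (- p) =
     b * (2 * pi * (gcoef nu theta * (1 + 4 * powR pi p) * powR u (- p))) by rewrite /M /c; ring.
  by rewrite ler_pM2l// ler_pM2l ?twopi_gt0//; exact: (gfold_scaled_le hnu ht d0 u0 su).
have := powRN_le_oneDsqr p2 u1; rewrite -(ler_pM2l M0); lra.
Qed.


(** The two spectral densities are comparable uniformly in delta, so the majorant found for the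
    denominator also serves for the numerator. *)
Let defect_bound : exists2 k, 0 < k & forall delta x, 0 < delta -> circ x ->
  `|defect delta x| <= k * gain delta x.
Proof.
have [k k0 hk] := gfold_scale_ratio hnu ht ht0.
exists (b0 * k / b + 1); first by rewrite addr_gt0// divr_gt0// mulr_gt0.
move=> delta x d0 cx; have /andP[g0 g1] := gain01 d0 cx; have /andP[r0 r1] := r01 d0 cx.
have fx := fpos d0 cx.
have h1 : b0 * f0 delta x * r delta x <= b0 * k / b * gain delta x.
  rewrite gainE//.
  have -> : b0 * k / b * (b * f delta x * r delta x) = b0 * (k * f delta x) * r delta x.
    by field; exact: lt0r_neq0.
  rewrite ler_pM2r// ler_pM2l// /f0 /f /symb mulrCA ler_pM2l ?twopi_gt0//.
  exact: hk.
have f00 : 0 <= b0 * f0 delta x * r delta x.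
  exact: mulr_ge0 (mulr_ge0 (ltW hb0) (symb_ge0 hnu d0 ht0 cx)) (ltW r0).
have bk : 0 <= b0 * k / b by rewrite divr_ge0 ?(ltW hb)// mulr_ge0 ?ltW.
have h2 : gain delta x ^+ 2 <= gain delta x by rewrite expr2 ler_piMr.
have h3 : gain delta x * (b0 * f0 delta x * r delta x) <= b0 * k / b * gain delta x.
  apply: le_trans h1; rewrite -[leRHS]mul1r ler_wpM2r//.
have h4 : 0 <= gain delta x * (b0 * f0 delta x * r delta x) by rewrite mulr_ge0.
have h5 := sqr_ge0 (gain delta x).
have h6 : 0 <= b0 * k / b * gain delta x by rewrite mulr_ge0.
rewrite mulrDl mul1r /defect ler_norml; apply/andP; split; lra.
Qed.

Let f_cvg (t : R) (u : R) : 0 < t -> 0 < u ->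
  symb nu d t (bandwidth nu d * u) @[d --> (0 : R)^'+] --> 2 * pi * (gcoef nu t * powR u (- p)).
Proof. by move=> t0 u0; apply: cvgMr; exact: gfold_scaled_cvg. Qed.

Let r_lim (u : R) : 0 < u ->
  r d (bandwidth nu d * u) @[d --> (0 : R)^'+] --> 1 - profile p c u.
Proof.
move=> u0; have U0 : 0 < powR u p by exact: powR_gt0.
have -> : 1 - profile p c u = (1 + b * (2 * pi * (gcoef nu theta * powR u (- p))))^-1.
  have -> : b * (2 * pi * (gcoef nu theta * powR u (- p))) = c / powR u p.
    by rewrite /c powRN; ring.
  rewrite /profile; field; rewrite !lt0r_neq0// addr_gt0//.
apply: cvgV.
  have gp := ltW (gcoef_gt0 hnu ht); have pp := ltW (twopi_gt0 R).
  by rewrite lt0r_neq0// ltr_pwDl// mulr_ge0 ?(ltW hb)// mulr_ge0// mulr_ge0 ?powR_ge0.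
by apply: cvgD; [exact: cvg_cst|apply: cvgMr; exact: f_cvg].
Qed.

Let gain_lim (u : R) : 0 < u ->
  gain d (bandwidth nu d * u) @[d --> (0 : R)^'+] --> profile p c u.
Proof.
move=> u0; rewrite -[profile p c u](subKr 1).
by apply: cvgB; [exact: cvg_cst|exact: r_lim].
Qed.

Let defect_lim (u : R) : 0 < u ->
  defect d (bandwidth nu d * u) @[d --> (0 : R)^'+] --> (rho - 1) * profile p c u ^+ 2.
Proof.
move=> u0; have U0 : 0 < powR u p by exact: powR_gt0.
have -> : (rho - 1) * profile p c u ^+ 2 =
    profile p c u * (b0 * (2 * pi * (gcoef nu theta0 * powR u (- p))) * (1 - profile p c u)) -
    profile p c u * profile p c u.
  rewrite mulrBl mul1r -expr2; congr (_ - _).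
  have g0 := gcoef_gt0 hnu ht; have cd : 0 < c + powR u p by rewrite addr_gt0.
  rewrite /rho /profile powRN; move: cd; rewrite /c.
  have := twopi_gt0 R; move: (2 * pi) (gcoef nu theta) g0 (powR u p) U0 => P g g0 U U0 P0 cd.
  by field; rewrite !lt0r_neq0.
have gl := gain_lim u0.
have dE : (fun d => defect d (bandwidth nu d * u)) = fun d =>
    gain d (bandwidth nu d * u) * (b0 * f0 d (bandwidth nu d * u) * r d (bandwidth nu d * u)) -
    gain d (bandwidth nu d * u) * gain d (bandwidth nu d * u).
  by apply/funext => d; rewrite /defect expr2.
rewrite dE; apply: cvgB; apply: cvgM => //.
by apply: cvgM; [apply: cvgMr; exact: f_cvg|exact: r_lim].
Qed.

(** The right limit is tested along sequences, as dominated convergence is sequential. The Jacobian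
    of the rescaling is common to numerator and denominator and cancels. *)
Lemma psi_infill : psi nu delta b theta b0 theta0 @[delta --> 0^'+] -->
  (2 * nu) / (2 * nu + 1) *
  (b0 * powR theta0 (2 * nu) / (b * powR theta (2 * nu)) - 1).
Proof.
have rhoE : b0 * powR theta0 (2 * nu) / (b * powR theta (2 * nu)) = rho.
  rewrite /rho /gcoef; have := Cnu_gt0 hnu; have := powR_gt0 (2 * nu) ht.
  move: (powR theta _) (powR theta0 _) (Cnu nu) => x y z x0 z0.
  by field; rewrite !lt0r_neq0.
rewrite rhoE; apply/cvg_at_rightP => d_ [d0 d_0].
have [k k0 hk] := defect_bound.
have seq_lim (g : R -> R) (l : R) : g d @[d --> (0 : R)^'+] --> l -> g (d_ n) @[n --> \oo] --> l.
  by move/cvg_at_rightP; apply.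
pose K := 2 * (1 + c * (1 + 4 * powR pi p)).
have s0 n : 0 < bandwidth nu (d_ n) by exact: bandwidth_gt0.
have s_0 : (fun n => bandwidth nu (d_ n)) @ \oo --> 0 by apply: seq_lim; exact: bandwidth_cvg0.
have gain_cvg := cvg_scaled_circ (fun n => nice_gain (d0 n)) (fun n => gainN (d_ n)) s0 s_0
  (fun u u0 => seq_lim _ _ (gain_lim u0)).
have {}gain_cvg := gain_cvg K.
have defect_cvg := cvg_scaled_circ (fun n => nice_defect (d0 n)) (fun n => defectN (d_ n)) s0 s_0
  (fun u u0 => seq_lim _ _ (defect_lim u0)).
have {}defect_cvg := defect_cvg (k * K).
have h1 n (u : R) : 0 < u -> bandwidth nu (d_ n) * u <= pi ->
    `|gain (d_ n) (bandwidth nu (d_ n) * u)| <= K * (oneDsqr u)^-1.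
  move=> u0 su; rewrite ger0_norm ?gain_le//.
  by have /andP[] := gain01 (d0 n) (scaled_circ (d0 n) u0 su).
have h2 n (u : R) : 0 < u -> bandwidth nu (d_ n) * u <= pi ->
    `|defect (d_ n) (bandwidth nu (d_ n) * u)| <= k * K * (oneDsqr u)^-1.
  move=> u0 su; apply: le_trans (hk _ _ (d0 n) (scaled_circ (d0 n) u0 su)) _.
  by rewrite -mulrA ler_pM2l// gain_le.
have {}gain_cvg := gain_cvg h1; have {}defect_cvg := defect_cvg h2.
pose I := Rintegral mu `]0, +oo[ (profile p c).
have I0 : 0 < I by exact: profile_integral_gt0.
have J : Rintegral mu `]0, +oo[ (fun u => (rho - 1) * profile p c u ^+ 2) = (rho - 1) * ((p - 1) / p * I).
  rewrite RintegralZl//; last exact: profile_sqr_integrable.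
  have := profile_sqr_integral p2 c0; rewrite -/I => h; congr (_ * _).
  by apply: (mulfI (lt0r_neq0 p0)); rewrite h; field; exact: lt0r_neq0.
have -> : 2 * nu / (2 * nu + 1) * (rho - 1) = 2 * ((rho - 1) * ((p - 1) / p * I)) / (2 * I).
  have -> : 2 * nu = p - 1 by rewrite /p addrK.
  rewrite subrK; field; rewrite !lt0r_neq0//.
have I20 : 2 * I != 0 by rewrite lt0r_neq0// mulr_gt0.
rewrite -J; apply: cvg_trans (cvgM defect_cvg (cvgV I20 gain_cvg)); apply: near_eq_cvg.
apply: nearW => n.
rewrite psiE//=; have sn := lt0r_neq0 (s0 n); rewrite invfM invrK mulrACA.
by rewrite mulVf// mul1r.
Qed.

End InfillLimit.

Unset Implicit Arguments. Set Strict Implicit. Set Printing Implicit Defensive.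

Theorem theorem3p1 (R : realType) (nu b0 theta0 : R)
  (hnu : 2^-1 <= nu) (hb0 : 0 < b0) (htheta0 : 0 < theta0) :
  (* (i) *)
  (forall (d : measure_display) (T : measurableType d) (P : probability T R)
          (Z : R -> T -> R) (eps : nat -> T -> R),
      gaussian_family P Z (fun s t => b0 * Kmat nu theta0 (t - s)) ->
      gaussian_family P eps (fun i j => (i == j)%:R) ->
      indep_families P Z eps ->
      forall delta b theta : R, 0 < delta -> 0 < b -> 0 < theta ->
        conv_in_prob P
          (fun n w => stat nu delta b theta
                        (\col_(i < n) (Z (i.+1%:R * delta) w + eps i w)))
          (psi nu delta b theta b0 theta0))
  /\
  (* (ii) *)
  (forall b theta : R, 0 < b -> 0 < theta ->
     psi nu delta b theta b0 theta0 @[delta --> 0^'+] -->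
       (2 * nu) / (2 * nu + 1)
       * (b0 * powR theta0 (2 * nu) / (b * powR theta (2 * nu)) - 1)).
Proof.
split; last by move=> b theta hb ht; exact: psi_infill.
move=> d T P Z eps gZ geps hind delta b theta d0 hb ht.
exact: (stat_conv_in_prob hnu hb0 htheta0 d0 hb ht gZ geps hind).
Qed.
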